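(* Consider the reversible jump MCMC algorithm described in the context. Suppose that 1) the state space $\Theta\times\mathcal{X}\times\mathbb{N}$ has a countably generated $\sigma$-algebra; 2) the following densities are bounded: $p(\theta)$, $p(x_i\mid\theta)$, and $p(s\mid x_{1:n})$; 3) for $i<j<k\in\mathbb{N}$, if $p(n=i)>0$ and $p(n=k)>0$, then $p(n=j)>0$; 4) the supports of $p(x_i\mid\theta)$, $p(s\mid x_{1:n})$, and $p(n_{\mathrm{dp}}\mid n)$ do not depend on the quantity on the right-hand side of the conditioning bar. Then the Markov chain generated by the algorithm is ergodic on the joint space $(\theta,x_{1:n},n)\in\Theta\times\mathcal{X}\times\mathbb{N}$, and has $p(\theta,x_{1:n},n\mid s,n_{\mathrm{dp}})$ as its unique limiting distribution.
   Context: Datasets are finite sequences $x=x_{1:n}=(x_1,\dots,x_n)\in\mathcal{X}=\bigcup_{n\ge1}\mathcal{X}_1^n$; a state is a triple $(\theta,x_{1:n},n)$ with $x_{1:n}\in\mathcal{X}_1^n$. Model: prior density $p(\theta)$ on $\Theta$, prior $p(n)$ on $\mathbb{N}=\{1,2,\dots\}$, $x_1,\dots,x_n$ i.i.d. from $p(\cdot\mid\theta)$ given $(\theta,n)$, privatized summary $s\sim p(s\mid x_{1:n})$, privatized sample size $n_{\mathrm{dp}}\sim p(n_{\mathrm{dp}}\mid n)$. The observed $(s,n_{\mathrm{dp}})$ is fixed (in the common supports) and the target is the (proper) posterior $\pi=p(\theta,x_{1:n},n\mid s,n_{\mathrm{dp}})\propto p(\theta)p(n)\prod_{i=1}^np(x_i\mid\theta)\,p(s\mid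 x_{1:n})p(n_{\mathrm{dp}}\mid n)$. The mechanism for $s$ is record-additive: $p(s\mid x_{1:n})=g(s,\sum_{i=1}^nt(s,x_i))$ for known functions $g,t$. One iteration of the algorithm from state $(\theta,x_{1:n},n)$: 1. Within-model moves: (a) draw $\theta\sim p(\theta\mid x_{1:n})\propto p(\theta)\prod_ip(x_i\mid\theta)$. (b) For $i=1,\dots,n$ sequentially: propose $x_i^*\sim p(\cdot\mid\theta)$, let $x^*$ be $x$ with $x_i$ replaced by $x_i^*$, and accept (set $x=x^*$) with probability $\min\{1,p(s\mid x^* )/p(s\mid x)\}$. 2. Between-models move: draw $n^*$ from $q(n^*\mid n)$, where $q(2\mid1)=1$; $q(n\pm1\mid n)=1/2$ for $n>1$; and $q=0$ otherwise. If $n^*=n+1$, draw $x_{n+1}^*\sim p(\cdot\mid\theta)$ and set $x^*=(x_1,\dots,x_n,x_{n+1}^* )$; if $n^*=n-1$, set $x^*=(x_1,\dots,x_{n-1})$. Accept the move to $(n^*,x^* )$ with probability $$\min\left\{1,\frac{p(n^* )\,p(s\mid x^* )\,p(n_{\mathrm{dp}}\mid n^* )\,q(n\mid n^* )}{p(n)\,p(s\mid x)\,p(n_{\mathrm{dp}}\mid n)\,q(n^*\mid n)}\right\}.$$ Ergodic means: for $\pi$-almost every starting state, the total variation distance between the law of the chain after $t$ iterations and $\pi$ tends to $0$ as $t\to\infty$. *)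

(* Defs.v *)
From HB Require Import structures.
From mathcomp Require Import all_boot all_order all_algebra.
From mathcomp Require Import all_classical all_reals all_analysis.
From mathcomp Require Import measurable_realfun.

Set Implicit Arguments.
Unset Strict Implicit.
Unset Printing Implicit Defensive.

Import Order.TTheory GRing.Theory Num.Theory.
Import numFieldNormedType.Exports.

Local Open Scope classical_set_scope.
Local Open Scope ring_scope.

Definition countably_generated d (T : measurableType d) : Prop :=
  exists G : set (set T), countable G /\ @measurable d T = <<s G >>.

Section densities.
Context d (T : measurableType d) (R : realType).

Definition mdensity (mu : {measure set T -> \bar R}) (f : T -> R)
    of measurable_fun setT f & (forall y, 0 <= f y) : set T -> \bar R :=
  fun A => (\int[mu]_(y in A) (f y)%:E)%E.

Variables (mu : {measure set T -> \bar R}) (f : T -> R).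
Hypotheses (mf : measurable_fun setT f) (f0 : forall y, 0 <= f y).

Let mdensity0 : mdensity mu mf f0 set0 = 0%E.
Proof. by rewrite /mdensity integral_set0. Qed.

Let mdensity_ge0 A : (0 <= mdensity mu mf f0 A)%E.
Proof. by apply: integral_ge0 => y _; rewrite lee_fin. Qed.

Let mdensity_sigma_additive : semi_sigma_additive (mdensity mu mf f0).
Proof.
apply: semi_sigma_additive_nng_induced; first exact/measurable_EFinP.
by move=> y; rewrite lee_fin.
Qed.

HB.instance Definition _ := isMeasure.Build _ _ _ (mdensity mu mf f0)
  mdensity0 mdensity_ge0 mdensity_sigma_additive.

End densities.

Definition is_density d (T : measurableType d) (R : realType)
    (mu : {measure set T -> \bar R}) (f : T -> R) : Prop :=
  [/\ measurable_fun setT f, (forall y, 0 <= f y)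
    & (\int[mu]_y (f y)%:E = 1)%E].

Definition is_cond_density d d' (X : measurableType d) (T : measurableType d')
    (R : realType) (mu : {measure set T -> \bar R}) (f : X -> T -> R) : Prop :=
  measurable_fun setT (fun p : X * T => f p.1 p.2) /\
  (forall x, is_density mu (f x)).

Definition density_support (T : Type) (R : realType) (f : T -> R) : set T :=
  [set y | 0 < f y].

Section kernels_from_densities.
Context d d' (X : measurableType d) (Y : measurableType d') (R : realType).
Variables (mu : {sigma_finite_measure set Y -> \bar R}) (h : X -> Y -> R).
Hypothesis mh : measurable_fun setT (fun p : X * Y => h p.1 p.2).
Hypothesis h0 : forall x y, 0 <= h x y.

Let mhx x : measurable_fun setT (h x).
Proof. exact: (measurable_fun_pair2 x mh). Qed.

Definition kdensity : X -> {measure set Y -> \bar R} :=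
  fun x => mdensity mu (mhx x) (h0 x).

Let measurable_kdensity U : measurable U -> measurable_fun setT (kdensity ^~ U).
Proof.
move=> mU.
pose f (p : X * Y) := (h p.1 p.2 * \1_U p.2)%:E.
have mf : measurable_fun setT f.
  apply/measurable_EFinP; apply: measurable_funM => //.
  exact: (measurableT_comp (measurable_indic mU)).
have f0 p : (0 <= f p)%E by rewrite lee_fin mulr_ge0.
rewrite (_ : (fun x => _) = fubini_F mu f).
  exact: (@measurable_fun_fubini_tonelli_F _ _ _ _ _ mu f mf f0).
apply/funext => x; rewrite /kdensity/= /mdensity /fubini_F integral_mkcond.
apply: eq_integral => y _; rewrite patchE /f/= indicE.
by case: ifPn => yU; rewrite ?yU ?(negbTE yU) ?mulr1 ?mulr0.
Qed.

HB.instance Definition _ :=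
  isKernel.Build _ _ X Y R kdensity measurable_kdensity.

End kernels_from_densities.

Section sampling_from_conditional_densities.
Context d d' (X : measurableType d) (Y : measurableType d') (R : realType).
Variables (mu : {sigma_finite_measure set Y -> \bar R}) (h : X -> Y -> R).
Hypothesis ch : is_cond_density mu h.

Let h0 x y : 0 <= h x y. Proof. by case: (ch.2 x). Qed.

Definition ksample : X -> {measure set Y -> \bar R} := kdensity mu ch.1 h0.

HB.instance Definition _ := Kernel.copy ksample (kdensity mu ch.1 h0).

Let ksampleT x : ksample x setT = 1%E.
Proof. by case: (ch.2 x). Qed.

HB.instance Definition _ :=
  Kernel_isProbability.Build _ _ X Y R ksample ksampleT.

End sampling_from_conditional_densities.

Section kbind.
Context d d' d'' (X : measurableType d) (Y : measurableType d')
  (Z : measurableType d'') (R : realType).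
Variables (k : R.-pker X ~> Y) (l : R.-pker (X * Y)%type ~> Z).

Definition kbind : X -> {measure set Z -> \bar R} := (k \; l)%E.

HB.instance Definition _ := Kernel.copy kbind (k \; l)%E.

Let kbindT x : kbind x setT = 1%E.
Proof.
rewrite /kbind/= /kcomp; under eq_integral do rewrite prob_kernel.
by rewrite integral_cst// prob_kernel mul1e.
Qed.

HB.instance Definition _ :=
  Kernel_isProbability.Build _ _ X Z R kbind kbindT.

End kbind.

Section kthen.
Context d d' d'' (X : measurableType d) (Y : measurableType d')
  (Z : measurableType d'') (R : realType).
Variables (k : R.-pker X ~> Y) (l : R.-pker Y ~> Z).

Definition kthen : X -> {measure set Z -> \bar R} := mkcomp_noparam k l.

HB.instance Definition _ := Kernel.copy kthen (mkcomp_noparam k l).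

Let kthenT x : kthen x setT = 1%E.
Proof.
rewrite /kthen/= /kcomp_noparam; under eq_integral do rewrite prob_kernel.
by rewrite integral_cst// prob_kernel mul1e.
Qed.

HB.instance Definition _ :=
  Kernel_isProbability.Build _ _ X Z R kthen kthenT.

End kthen.

Section kiter.
Context d (Z : measurableType d) (R : realType).

Fixpoint kiter (k : R.-pker Z ~> Z) (t : nat) : R.-pker Z ~> Z :=
  if t is t'.+1 then kthen (kiter k t') k else kdirac (@measurable_id _ Z setT).

End kiter.

Section kmix.
Context d d' (X : measurableType d) (Y : measurableType d') (R : realType).
Variables (a b : X -> R) (k l : R.-pker X ~> Y).

Definition kmix of measurable_fun setT a & measurable_fun setT b
    & (forall x, a x + b x = 1) :=
  fun (a0 : forall x, 0 <= a x) (b0 : forall x, 0 <= b x) x =>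
  measure_add (mscale (NngNum (a0 x)) (k x)) (mscale (NngNum (b0 x)) (l x))
    : {measure set Y -> \bar R}.

Hypotheses (ma : measurable_fun setT a) (mb : measurable_fun setT b).
Hypothesis ab1 : forall x, a x + b x = 1.
Hypotheses (a0 : forall x, 0 <= a x) (b0 : forall x, 0 <= b x).

Let kmixE x A :
  kmix ma mb ab1 a0 b0 x A = ((a x)%:E * k x A + (b x)%:E * l x A)%E.
Proof. exact: measure_addE. Qed.

Let measurable_kmix U : measurable U ->
  measurable_fun setT (kmix ma mb ab1 a0 b0 ^~ U).
Proof.
move=> mU; under eq_fun do rewrite kmixE.
by apply: emeasurable_funD; apply: emeasurable_funM;
  do ?[exact/measurable_EFinP|exact: measurable_kernel].
Qed.

HB.instance Definition _ :=
  isKernel.Build _ _ X Y R (kmix ma mb ab1 a0 b0) measurable_kmix.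

Let kmixT x : kmix ma mb ab1 a0 b0 x setT = 1%E.
Proof. by rewrite kmixE !prob_kernel !mule1 -EFinD ab1. Qed.

HB.instance Definition _ :=
  Kernel_isProbability.Build _ _ X Y R (kmix ma mb ab1 a0 b0) kmixT.

End kmix.

Section metropolis.
Context d (Z : measurableType d) (R : realType).
Variables (prop : R.-pker Z ~> Z) (ratio : Z * Z -> R).
Hypothesis mratio : measurable_fun setT ratio.
Hypothesis ratio0 : forall p, 0 <= ratio p.

Definition accept (p : Z * Z) : R := Num.min 1 (ratio p).

Let maccept : measurable_fun setT accept.
Proof. exact: measurable_minr. Qed.

Let mreject : measurable_fun setT (fun p => 1 - accept p).
Proof. exact: measurable_funB. Qed.

Let accept0 p : 0 <= accept p.
Proof. by rewrite /accept le_min ler01 ratio0. Qed.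

Let reject0 p : 0 <= 1 - accept p.
Proof. by rewrite subr_ge0 /accept ge_min lexx. Qed.

Let accept_reject p : accept p + (1 - accept p) = 1.
Proof. by rewrite addrC subrK. Qed.

(* [ratio (z, z')] is the acceptance ratio of the move from [z] to [z'] *)
Definition metropolis : R.-pker Z ~> Z :=
  kbind prop
    (kmix (kdirac measurable_snd) (kdirac measurable_fst)
       maccept mreject accept_reject accept0 reject0).

End metropolis.

Lemma measurable_invr (R : realType) : measurable_fun setT (@GRing.inv R).
Proof.
have -> : [set: R] = [set 0] `|` [set r | r != 0].
  by apply/seteqP; split => // x _ /=; case: (eqVneq x 0); [left|right].
apply/measurable_funU => //; first exact: open_measurable.
split; first exact: measurable_fun_set1.
apply: open_continuous_measurable_fun => //; apply/in_setP => x /= x0.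
exact: inv_continuous.
Qed.

Definition dataset_display : measure_display -> measure_display.
Proof. exact. Qed.

(* [existT _ m x] is the sample [x] of size [n = m.+1] *)
Definition dataset (X : Type) : Type := {m : nat & m.+1.-tuple X}.

HB.instance Definition _ (X : pointedType) :=
  Choice.copy (dataset X) {m : nat & m.+1.-tuple X}.
HB.instance Definition _ (X : pointedType) :=
  isPointed.Build (dataset X) (existT _ 0%N (point : 1.-tuple X)).

Section dataset_sigma_algebra.
Context d (X : measurableType d).

(* disjoint union of the product sigma-algebras *)
Definition dataset_measurable : set (set (dataset X)) :=
  [set A | forall m, measurable (existT _ m @^-1` A : set (m.+1.-tuple X))].

Let dataset_measurable0 : dataset_measurable set0.
Proof. by move=> m; rewrite preimage_set0. Qed.

Let dataset_measurableC A : dataset_measurable A -> dataset_measurable (~` A).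
Proof. by move=> mA m; rewrite preimage_setC; apply: measurableC; exact: (mA m). Qed.

Let dataset_measurableU (F : (set (dataset X))^nat) :
  (forall i, dataset_measurable (F i)) -> dataset_measurable (\bigcup_i F i).
Proof.
by move=> mF m; rewrite preimage_bigcup; apply: bigcupT_measurable => i; apply: mF.
Qed.

HB.instance Definition _ := @isMeasurable.Build (dataset_display d)
  (dataset X) dataset_measurable dataset_measurable0 dataset_measurableC
  dataset_measurableU.

Lemma measurable_existT m :
  measurable_fun setT (existT _ m : m.+1.-tuple X -> dataset X).
Proof. by move=> _ A mA; rewrite setTI; exact: mA. Qed.

Lemma measurable_existT_comp d' (T : measurableType d') m
    (f : T -> m.+1.-tuple X) : measurable_fun setT f ->
  measurable_fun setT (fun y => existT _ m (f y) : dataset X).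
Proof. by move=> mf; exact: (measurableT_comp (@measurable_existT m) mf). Qed.

Lemma measurable_dataset d' (Y : measurableType d') (f : dataset X -> Y) :
  (forall m, measurable_fun setT (fun x : m.+1.-tuple X => f (existT _ m x))) ->
  measurable_fun setT f.
Proof.
move=> mf _ A mA; rewrite setTI.
suff : dataset_measurable (f @^-1` A) by [].
move=> m; by have := mf m measurableT A mA; rewrite setTI.
Qed.

Let trunc m (x : dataset X) : m.+1.-tuple X :=
  [tuple nth point (tagged x) i | i < m.+1].

Let truncK m x : trunc m (existT _ m x) = x.
Proof.
apply: eq_from_tnth => i; rewrite tnth_mktuple/= (tnth_nth point)//.
Qed.

Let measurable_trunc m : measurable_fun setT (trunc m).
Proof.
apply: measurable_dataset => m'; apply/measurable_fun_tnthP => i.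
have trE (x : m'.+1.-tuple X) : tnth (trunc m (existT _ m' x)) i = nth point x i.
  by rewrite tnth_mktuple.
have [im|mi] := ltnP i m'.+1.
  apply: (eq_measurable_fun (fun x => tnth x (Ordinal im))); last exact: measurable_tnth.
  by move=> x _ /=; rewrite trE (tnth_nth point).
apply: (eq_measurable_fun (cst point)) => // x _ /=.
by rewrite trE nth_default// size_tuple.
Qed.

Lemma measurable_dataset_pair d1 d2 (T : measurableType d1)
    (Y : measurableType d2) (f : T * dataset X -> Y) :
  (forall m, measurable_fun setT
     (fun p : T * m.+1.-tuple X => f (p.1, existT _ m p.2))) ->
  measurable_fun setT f.
Proof.
move=> mf _ A mA; rewrite setTI.
have -> : f @^-1` A = \bigcup_m
    ((setT `*` [set x : dataset X | projT1 x = m]) `&`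
    ((fun p => (p.1, trunc m p.2)) @^-1`
     ((fun p => f (p.1, existT _ m p.2)) @^-1` A))).
  apply/seteqP; split => [[t [m x]] /= Af|[t [m x]] [m' _ [[_ /=]]]].
    by exists m => //=; split => //=; rewrite truncK.
  by move=> <-; rewrite truncK.
apply: bigcup_measurable => m _; apply: measurableI.
  apply: measurableX => //.
  suff : dataset_measurable [set x | projT1 x = m] by [].
  move=> m'.
  have [->|mm'] := eqVneq m' m.
    by rewrite (_ : _ @^-1` _ = setT) //; apply/seteqP; split.
  rewrite (_ : _ @^-1` _ = set0) //; apply/seteqP; split => // x /= /eqP.
  by rewrite (negbTE mm').
have mtr : measurable_fun setT (fun p : T * dataset X => (p.1, trunc m p.2)).
  apply: measurable_fun_pair => //.
  exact: (measurableT_comp (@measurable_trunc m) measurable_snd).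
rewrite -[X in measurable X]setTI; apply: mtr => //.
by have := mf m measurableT A mA; rewrite setTI.
Qed.

End dataset_sigma_algebra.

Section dataset_operations.
Context (X : pointedType).

Definition dsize (x : dataset X) : nat := (projT1 x).+1.

Definition record_of (x : dataset X) (i : 'I_(dsize x)) : X :=
  tnth (projT2 x) i.

(* replace the record of index [i], counted from 0 *)
Definition dreplace (i : nat) (x : dataset X) (y : X) : dataset X :=
  existT _ (projT1 x)
    [tuple if val j == i then y else record_of j | j < dsize x].

Definition dadd (x : dataset X) (y : X) : dataset X :=
  existT _ (projT1 x).+1 [tuple of rcons (projT2 x) y].

(* drop the last record; a dataset of size 1 is returned unchanged *)
Definition dremove (x : dataset X) : dataset X :=
  let: existT m t := x in
  match m return m.+1.-tuple X -> dataset X with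
  | 0%N => existT _ 0%N
  | m'.+1 => fun t =>
      existT _ m' [tuple tnth t (widen_ord (leqnSn m'.+1) i) | i < m'.+1]
  end t.

End dataset_operations.

Section measurable_dataset_operations.
Context d (X : measurableType d).

Lemma measurable_dsize : measurable_fun setT (@dsize X).
Proof.
by apply: measurable_dataset => m; exact: (@measurable_cst _ _ _ _ setT m.+1).
Qed.

Lemma measurable_dreplace i :
  measurable_fun setT (fun p : X * dataset X => dreplace i p.2 p.1).
Proof.
apply: measurable_dataset_pair => m; rewrite /dreplace /=.
apply: measurable_existT_comp.
apply/measurable_fun_tnthP => j.
have [ji|ji] := eqVneq (val j) i.
  apply: (eq_measurable_fun fst) => // p _.
  by rewrite /= tnth_mktuple ji eqxx.
apply: (eq_measurable_fun ((fun x => tnth x j) \o snd)).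
  by move=> p _; rewrite /= tnth_mktuple (negbTE ji).
by apply: measurableT_comp => //; exact: measurable_tnth.
Qed.

Lemma measurable_dadd :
  measurable_fun setT (fun p : X * dataset X => dadd p.2 p.1).
Proof.
apply: measurable_dataset_pair => m; rewrite /dadd /=.
apply: measurable_existT_comp.
apply/measurable_fun_tnthP => j.
have [jm|mj] := ltnP j m.+1.
  apply: (eq_measurable_fun ((fun x => tnth x (Ordinal jm)) \o snd)).
    move=> p _; rewrite /= !(tnth_nth point) /= nth_rcons size_tuple jm//.
  by apply: measurableT_comp => //; exact: measurable_tnth.
apply: (eq_measurable_fun fst) => // p _.
rewrite /= (tnth_nth point) /= nth_rcons size_tuple ltnNge mj/=.
by rewrite eqn_leq mj -ltnS ltn_ord.
Qed.

Lemma measurable_dremove : measurable_fun setT (@dremove X).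
Proof.
apply: measurable_dataset => -[|m] /=; first exact: measurable_existT.
apply: measurable_existT_comp.
apply/measurable_fun_tnthP => j.
apply: (eq_measurable_fun (fun t => tnth t (widen_ord (leqnSn m.+1) j))).
  by move=> t _; rewrite /= tnth_mktuple.
exact: measurable_tnth.
Qed.

End measurable_dataset_operations.

Section tuple_cons_measure.
Context d (X : measurableType d) (R : realType) (n : nat).
Variables (mu : {sigma_finite_measure set X -> \bar R}).
Variables (nu : {sigma_finite_measure set (n.-tuple X) -> \bar R}).

Let cons (p : X * n.-tuple X) : n.+1.-tuple X := [tuple of p.1 :: p.2].

Let mcons : measurable_fun setT cons.
Proof. exact: measurable_cons. Qed.

Definition cons_measure (A : set (n.+1.-tuple X)) : \bar R :=
  (mu \x nu)%E [set p : X * n.-tuple X | A [tuple of p.1 :: p.2]].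

Let cons_measureE A : cons_measure A = (mu \x nu)%E (cons @^-1` A).
Proof. by []. Qed.

Let mcons_preimage A : measurable A -> measurable (cons @^-1` A).
Proof. by move=> mA; rewrite -[X in measurable X]setTI; exact: mcons. Qed.

Let cons_measure0 : cons_measure set0 = 0%E.
Proof. by rewrite cons_measureE preimage_set0 measure0. Qed.

Let cons_measure_ge0 A : (0 <= cons_measure A)%E.
Proof. exact: measure_ge0. Qed.

Let cons_measure_sigma_additive : semi_sigma_additive cons_measure.
Proof.
move=> F mF tF mUF; rewrite cons_measureE preimage_bigcup.
apply: measure_semi_sigma_additive.
- by move=> i; exact: mcons_preimage.
- apply/trivIsetP => i j _ _ ij; rewrite -preimage_setI.
  by move/trivIsetP : tF => /(_ i j Logic.I Logic.I ij) ->; rewrite preimage_set0.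
- by rewrite -preimage_bigcup; exact: mcons_preimage.
Qed.

HB.instance Definition _ := isMeasure.Build _ _ R cons_measure
  cons_measure0 cons_measure_ge0 cons_measure_sigma_additive.

Let cons_measure_sigma_finite : sigma_finite setT cons_measure.
Proof.
have /sigma_finiteP[F [TF ndF Foo]] := sigma_finiteT mu.
have /sigma_finiteP[G [TG ndG Goo]] := sigma_finiteT nu.
pose split (x : n.+1.-tuple X) : X * n.-tuple X := (thead x, [tuple of behead x]).
have msplit : measurable_fun setT split.
  by apply: measurable_fun_pair;
    [exact: measurable_tnth|exact: measurable_behead].
exists (fun i => split @^-1` (F i `*` G i)).
  rewrite -preimage_bigcup; apply/seteqP; split => // x _ /=.
  have [k _ Fk] : (\bigcup_i F i) (split x).1 by rewrite -TF.
  have [l _ Gl] : (\bigcup_i G i) (split x).2 by rewrite -TG.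
  exists (maxn k l) => //; split.
    by move: Fk; exact/subsetPset/ndF/leq_maxl.
  by move: Gl; exact/subsetPset/ndG/leq_maxr.
move=> i; have [mFi Fioo] := Foo i; have [mGi Gioo] := Goo i; split.
  by rewrite -[X in measurable X]setTI; apply: msplit => //; exact: measurableX.
rewrite cons_measureE (_ : cons @^-1` _ = F i `*` G i).
  by rewrite product_measure1E// lte_mul_pinfty// ge0_fin_numE.
have splitK p : split (cons p) = p.
  case: p => y x; rewrite /split /cons /thead /= (tnth_nth y) /=.
  by congr (_, _); exact/val_inj.
rewrite -comp_preimage (_ : split \o cons = id) ?preimage_id//.
exact/funext/splitK.
Qed.

HB.instance Definition _ := Measure_isSigmaFinite.Build _ _ R cons_measure
  cons_measure_sigma_finite.

End tuple_cons_measure.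

Fixpoint tuple_measure d (X : measurableType d) (R : realType)
    (mu : {sigma_finite_measure set X -> \bar R}) (n : nat) :
    {sigma_finite_measure set (n.-tuple X) -> \bar R} :=
  if n is n'.+1 then cons_measure mu (tuple_measure mu n')
  else \d_[tuple].

Section dataset_measure.
Context d (X : measurableType d) (R : realType).
Variable mu : {sigma_finite_measure set X -> \bar R}.

(* the restriction to the datasets of size [n] is the product measure [mu^n] *)
Definition dataset_measure (A : set (dataset X)) : \bar R :=
  (\sum_(0 <= m <oo) tuple_measure mu m.+1 (existT _ m @^-1` A))%E.

Let slice m (A : set (dataset X)) : \bar R :=
  tuple_measure mu m.+1 (existT _ m @^-1` A).

Let existT_preimage m (A : set (dataset X)) : measurable A ->
  measurable (existT _ m @^-1` A : set (m.+1.-tuple X)).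
Proof. by move=> mA; exact: (mA m). Qed.

Let slice0 m : slice m set0 = 0%E.
Proof. by rewrite /slice preimage_set0 measure0. Qed.

Let slice_ge0 m A : (0 <= slice m A)%E.
Proof. exact: measure_ge0. Qed.

Let slice_sigma_additive m : semi_sigma_additive (slice m).
Proof.
move=> F mF tF mUF; rewrite /slice preimage_bigcup.
apply: measure_semi_sigma_additive.
- by move=> i; exact: existT_preimage.
- apply/trivIsetP => i j _ _ ij; rewrite -preimage_setI.
  by move/trivIsetP : tF => /(_ i j Logic.I Logic.I ij) ->; rewrite preimage_set0.
- by rewrite -preimage_bigcup; exact: existT_preimage.
Qed.

HB.instance Definition _ m := isMeasure.Build _ _ R (slice m)
  (slice0 m) (slice_ge0 m) (@slice_sigma_additive m).

Let dataset_measureE A :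
  dataset_measure A = mseries (slice : nat -> {measure set _ -> \bar R}) 0 A.
Proof. by []. Qed.

Let dataset_measure0 : dataset_measure set0 = 0%E.
Proof. by rewrite dataset_measureE measure0. Qed.

Let dataset_measure_ge0 A : (0 <= dataset_measure A)%E.
Proof. by rewrite dataset_measureE measure_ge0. Qed.

Let dataset_measure_sigma_additive : semi_sigma_additive dataset_measure.
Proof.
exact: (@measure_semi_sigma_additive _ _ _
  (mseries (slice : nat -> {measure set _ -> \bar R}) 0)).
Qed.

HB.instance Definition _ := isMeasure.Build _ _ R dataset_measure
  dataset_measure0 dataset_measure_ge0 dataset_measure_sigma_additive.

Let dataset_measure_sigma_finite : sigma_finite setT dataset_measure.
Proof.
have exF : forall m, exists F : (set (m.+1.-tuple X))^nat,
    [/\ setT = \bigcup_i F i, nondecreasing_seq F &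
    forall i, measurable (F i) /\ (tuple_measure mu m.+1 (F i) < +oo)%E].
  by move=> m; apply/sigma_finiteP; exact: sigma_finiteT.
pose F m := projT1 (cid (exF m)).
have FP m := projT2 (cid (exF m)).
pose C j : set (dataset X) :=
  [set x | (projT1 x <= j)%N /\ F (projT1 x) j (projT2 x)].
have CE j m : existT _ m @^-1` C j = if (m <= j)%N then F m j else set0.
  apply/seteqP; split => x /=; case: ifPn => //.
  - by move=> _ [].
  - by move=> /negP mj [].
exists C.
  apply/seteqP; split => // -[m x] _.
  have [UF ndF _] := FP m.
  have [k _ Fk] : (\bigcup_i F m i) x by rewrite /F -UF.
  exists (maxn m k) => //; split; first exact: leq_maxl.
  by move: Fk; exact/subsetPset/ndF/leq_maxr.
move=> j; split.
  suff : dataset_measurable (C j) by [].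
  move=> m; rewrite CE; case: ifPn => // _.
  by have [_ _ /(_ j)[]] := FP m.
rewrite /dataset_measure (nneseries_split 0 j.+1); last first.
  by move=> k _; exact: measure_ge0.
rewrite [X in (_ + X)%E]eseries0 ?adde0; last first.
  by move=> k + _; rewrite add0n CE ltnNge => /negbTE ->; rewrite measure0.
apply/lte_sum_pinfty => k _; rewrite CE; case: ifPn => _.
  by have [_ _ /(_ j)[]] := FP k.
by rewrite measure0.
Qed.

HB.instance Definition _ := Measure_isSigmaFinite.Build _ _ R dataset_measure
  dataset_measure_sigma_finite.

End dataset_measure.

Record dp_model (R : realType) (dT dX dS dD : measure_display)
    (Theta : measurableType dT) (X : measurableType dX) (S : measurableType dS)
    (D : measurableType dD) (V : nmodType) := DPModel {
  muTheta : {sigma_finite_measure set Theta -> \bar R} ;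
  muX : {sigma_finite_measure set X -> \bar R} ;
  muS : {sigma_finite_measure set S -> \bar R} ;
  muD : {sigma_finite_measure set D -> \bar R} ;
  ptheta : Theta -> R ;
  (* the sample size n ranges over {1, 2, ...}: the values of [pn] and [pdp]
     at 0 are never used *)
  pn : nat -> R ;
  px : Theta -> X -> R ;
  tsum : S -> X -> V ;
  gsum : S -> V -> R ;
  pdp : nat -> D -> R ;
  (* p(s | x_{1:n}) = g(s, sum_i t(s, x_i)) *)
  ps := fun (x : dataset X) (s : S) =>
    gsum s (\sum_(i < dsize x) tsum s (record_of i)) ;
  ptheta_density : is_density muTheta ptheta ;
  pn_ge0 : forall n, (0 < n)%N -> 0 <= pn n ;
  pn_sum1 : (\sum_(1 <= n <oo) (pn n)%:E = 1)%E ;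
  px_density : is_cond_density muX px ;
  ps_density : is_cond_density muS ps ;
  pdp_density : forall n, (0 < n)%N -> is_density muD (pdp n)
}.

Section rjmcmc.
Context (R : realType) (dT dX dS dD : measure_display)
  (Theta : measurableType dT) (X : measurableType dX) (S : measurableType dS)
  (D : measurableType dD) (V : nmodType).
Variables (M : dp_model R Theta X S D V) (s : S) (ndp : D).

(* the size [n] of the triple [(theta, x_{1:n}, n)] is [dsize z.2] *)
Definition state : Type := (Theta * dataset X)%type.

HB.instance Definition _ := Measurable.on state.

Implicit Types z : state.

Definition likelihood (theta : Theta) (x : dataset X) : R :=
  \prod_(i < dsize x) px M theta (record_of i).

Definition joint_density z : R :=
  ptheta M z.1 * pn M (dsize z.2) * likelihood z.1 z.2 * ps M z.2 s
    * pdp M (dsize z.2) ndp.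

Let ptheta_ge0 theta : 0 <= ptheta M theta.
Proof. by case: (ptheta_density M). Qed.

Let pn_dsize_ge0 (x : dataset X) : 0 <= pn M (dsize x).
Proof. exact: pn_ge0. Qed.

Let px_ge0 theta x : 0 <= px M theta x.
Proof. by case: ((px_density M).2 theta). Qed.

Let ps_ge0 x : 0 <= ps M x s.
Proof. by case: ((ps_density M).2 x). Qed.

Let pdp_dsize_ge0 (x : dataset X) : 0 <= pdp M (dsize x) ndp.
Proof. by case: (@pdp_density _ _ _ _ _ _ _ _ _ _ M (dsize x) isT). Qed.

Let likelihood_ge0 theta x : 0 <= likelihood theta x.
Proof. by apply: prodr_ge0 => i _. Qed.

Let joint_density_ge0 z : 0 <= joint_density z.
Proof. by rewrite /joint_density !mulr_ge0. Qed.

Let measurable_of_size (f : nat -> R) :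
  measurable_fun setT (fun x : dataset X => f (dsize x)).
Proof.
have mf : measurable_fun setT f by [].
exact: (measurableT_comp mf (@measurable_dsize _ X)).
Qed.

Let measurable_ps : measurable_fun setT (ps M ^~ s).
Proof. exact: (measurable_fun_pair1 s (ps_density M).1). Qed.

Let measurable_likelihood :
  measurable_fun setT (fun z => likelihood z.1 z.2).
Proof.
apply: measurable_dataset_pair => m.
rewrite -[X in measurable_fun _ X]/(fun p : Theta * m.+1.-tuple X =>
  \prod_(i < m.+1) px M p.1 (tnth p.2 i)).
apply: measurable_prod => i _ /=.
pose f (p : Theta * m.+1.-tuple X) := (p.1, tnth p.2 i).
have mf : measurable_fun setT f.
  apply: measurable_fun_pair => //.
  exact: (measurableT_comp (@measurable_tnth _ _ _ i) measurable_snd).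
exact: (measurableT_comp (px_density M).1 mf).
Qed.

Let measurable_ptheta : measurable_fun setT (ptheta M).
Proof. by case: (ptheta_density M). Qed.

Let measurable_joint_density : measurable_fun setT joint_density.
Proof.
apply: measurable_funM; last first.
  exact: (measurableT_comp (measurable_of_size (pdp M ^~ ndp)) measurable_snd).
apply: measurable_funM; last exact: (measurableT_comp measurable_ps measurable_snd).
apply: measurable_funM; last exact: measurable_likelihood.
apply: measurable_funM; first exact: (measurableT_comp measurable_ptheta).
exact: (measurableT_comp (measurable_of_size (pn M)) measurable_snd).
Qed.

Definition state_measure : {measure set state -> \bar R} :=
  (muTheta M \x dataset_measure (muX M))%E.

Definition joint : {measure set state -> \bar R} :=
  mdensity state_measure measurable_joint_density joint_density_ge0.

Definition posterior : probability state R := mnormalize joint point.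

Definition full_conditional_density z (theta : Theta) : R :=
  ptheta M theta * likelihood theta z.2.

Let measurable_full_conditional_density : measurable_fun setT
  (fun p : state * Theta => full_conditional_density p.1 p.2).
Proof.
apply: measurable_funM; first exact: (measurableT_comp measurable_ptheta).
have mf : measurable_fun setT (fun p : state * Theta => (p.2, p.1.2)).
  apply: measurable_fun_pair => //.
  exact: (measurableT_comp measurable_snd measurable_fst).
exact: (measurableT_comp measurable_likelihood mf).
Qed.

Let full_conditional_density_ge0 z theta : 0 <= full_conditional_density z theta.
Proof. exact: mulr_ge0. Qed.

(* p(theta | x_{1:n}); [point], that is, the Dirac measure at a default
   parameter, is used only where the integral of p(theta) prod_i p(x_i | theta)
   is 0 or +oo, and such datasets have posterior probability 0 *)
Definition full_conditional : R.-pker state ~> Theta :=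
  knormalize (kdensity (muTheta M) measurable_full_conditional_density
    full_conditional_density_ge0) point.

Let measurable_set_theta :
  measurable_fun setT (fun p : state * Theta => (p.2, p.1.2) : state).
Proof.
apply: measurable_fun_pair => //.
exact: (measurableT_comp measurable_snd measurable_fst).
Qed.

Definition theta_update : R.-pker state ~> state :=
  kbind full_conditional (kdirac measurable_set_theta).

Let px_state_density : is_cond_density (muX M) (fun z => px M z.1).
Proof.
split; last by move=> z; exact: (px_density M).2.
have mf : measurable_fun setT (fun p : state * X => (p.1.1, p.2)).
  apply: measurable_fun_pair => //.
  exact: (measurableT_comp measurable_fst measurable_fst).
exact: (measurableT_comp (px_density M).1 mf).
Qed.

Definition new_record : R.-pker state ~> X := ksample px_state_density.

Let measurable_set_record i : measurable_fun setT
  (fun p : state * X => (p.1.1, dreplace i p.1.2 p.2) : state).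
Proof.
apply: measurable_fun_pair.
  exact: (measurableT_comp measurable_fst measurable_fst).
have mf : measurable_fun setT (fun p : state * X => (p.2, p.1.2)).
  apply: measurable_fun_pair => //.
  exact: (measurableT_comp measurable_snd measurable_fst).
exact: (measurableT_comp (@measurable_dreplace _ X i) mf).
Qed.

Definition record_proposal i : R.-pker state ~> state :=
  kbind new_record (kdirac (measurable_set_record i)).

Definition record_ratio (p : state * state) : R :=
  ps M p.2.2 s / ps M p.1.2 s.

Let measurable_comp_fst (f : dataset X -> R) : measurable_fun setT f ->
  measurable_fun setT (fun p : state * state => f p.1.2).
Proof.
move=> mf; apply: (measurableT_comp mf).
exact: (measurableT_comp measurable_snd measurable_fst).
Qed.

Let measurable_comp_snd (f : dataset X -> R) : measurable_fun setT f ->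
  measurable_fun setT (fun p : state * state => f p.2.2).
Proof.
move=> mf; apply: (measurableT_comp mf).
exact: (measurableT_comp measurable_snd measurable_snd).
Qed.

Let measurable_record_ratio : measurable_fun setT record_ratio.
Proof.
apply: measurable_funM; first exact: (measurable_comp_snd measurable_ps).
exact: (measurableT_comp (@measurable_invr R) (measurable_comp_fst measurable_ps)).
Qed.

Let record_ratio_ge0 p : 0 <= record_ratio p.
Proof. exact: divr_ge0. Qed.

Definition record_update i : R.-pker state ~> state :=
  metropolis (record_proposal i) measurable_record_ratio record_ratio_ge0.

Fixpoint records_update (k : nat) : R.-pker state ~> state :=
  if k is k'.+1 then kthen (records_update k') (record_update k')
  else kdirac (@measurable_id _ state setT).

Definition sweep z : {measure set state -> \bar R} :=
  records_update (dsize z.2) z.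

Let measurable_sweep U : measurable U -> measurable_fun setT (sweep ^~ U).
Proof.
move=> mU; apply: measurable_dataset_pair => m.
have mf : measurable_fun setT
    (fun p : Theta * m.+1.-tuple X => (p.1, existT _ m p.2) : state).
  apply: measurable_fun_pair => //.
  exact: (measurable_existT_comp measurable_snd).
exact: (measurableT_comp (measurable_kernel (records_update m.+1) U mU) mf).
Qed.

HB.instance Definition _ := isKernel.Build _ _ _ _ R sweep measurable_sweep.

Let sweepT z : sweep z setT = 1%E.
Proof. exact: prob_kernel. Qed.

HB.instance Definition _ := Kernel_isProbability.Build _ _ _ _ R sweep sweepT.

(* [jump n n'] is q(n' | n) *)
Definition jump (n n' : nat) : R :=
  if n == 1%N then (n' == 2)%:R
  else if (1 < n)%N && ((n' == n.+1) || (n' == n.-1)) then 2^-1 else 0.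

Let jump_ge0 n n' : 0 <= jump n n'.
Proof. by rewrite /jump; do 2?case: ifPn => _; rewrite ?invr_ge0. Qed.

Let jump_sum1 z :
  jump (dsize z.2) (dsize z.2).+1 + jump (dsize z.2) (dsize z.2).-1 = 1.
Proof.
case: z => theta [[|m] x]; rewrite /jump /dsize /= ?addr0//.
by rewrite !eqxx orbT [RHS]splitr div1r.
Qed.

Let measurable_grow : measurable_fun setT
  (fun p : state * X => (p.1.1, dadd p.1.2 p.2) : state).
Proof.
apply: measurable_fun_pair.
  exact: (measurableT_comp measurable_fst measurable_fst).
have mf : measurable_fun setT (fun p : state * X => (p.2, p.1.2)).
  apply: measurable_fun_pair => //.
  exact: (measurableT_comp measurable_snd measurable_fst).
exact: (measurableT_comp (@measurable_dadd _ X) mf).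
Qed.

Let measurable_shrink :
  measurable_fun setT (fun z => (z.1, dremove z.2) : state).
Proof.
apply: measurable_fun_pair => //.
exact: (measurableT_comp (@measurable_dremove _ X) measurable_snd).
Qed.

Definition grow : R.-pker state ~> state :=
  kbind new_record (kdirac measurable_grow).

Definition shrink : R.-pker state ~> state := kdirac measurable_shrink.

Let measurable_jump (f : nat -> nat) :
  measurable_fun setT (fun z => jump (dsize z.2) (f (dsize z.2))).
Proof.
exact: (measurableT_comp (measurable_of_size (fun n => jump n (f n)))
  measurable_snd).
Qed.

Definition size_proposal : R.-pker state ~> state :=
  kmix grow shrink (measurable_jump succn) (measurable_jump predn) jump_sum1
    (fun z => jump_ge0 _ _) (fun z => jump_ge0 _ _).

Definition size_ratio (p : state * state) : R :=
  let n := dsize p.1.2 in let n' := dsize p.2.2 in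
  (pn M n' * ps M p.2.2 s * pdp M n' ndp * jump n' n) /
  (pn M n * ps M p.1.2 s * pdp M n ndp * jump n n').

Let size_ratio_ge0 p : 0 <= size_ratio p.
Proof. by rewrite /size_ratio divr_ge0// !mulr_ge0. Qed.

Let measurable_jump2 (x0 : state * state -> dataset X)
    (x1 : state * state -> dataset X) :
  measurable_fun setT x0 -> measurable_fun setT x1 ->
  measurable_fun setT (fun p => jump (dsize (x0 p)) (dsize (x1 p))).
Proof.
move=> mx0 mx1.
have mj : measurable_fun setT
    (fun y : dataset X * dataset X => jump (dsize y.1) (dsize y.2)).
  apply: measurable_dataset_pair => m /=.
  exact: (measurableT_comp (measurable_of_size (jump ^~ m.+1)) measurable_fst).
exact: (measurableT_comp mj (measurable_fun_pair mx0 mx1)).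
Qed.

Let measurable_size_ratio : measurable_fun setT size_ratio.
Proof.
have m1 : measurable_fun setT (fun p : state * state => p.1.2).
  exact: (measurableT_comp measurable_snd measurable_fst).
have m2 : measurable_fun setT (fun p : state * state => p.2.2).
  exact: (measurableT_comp measurable_snd measurable_snd).
apply: measurable_funM.
  apply: measurable_funM; last exact: measurable_jump2.
  apply: measurable_funM;
    last exact: (measurable_comp_snd (measurable_of_size (pdp M ^~ ndp))).
  apply: measurable_funM; last exact: (measurable_comp_snd measurable_ps).
  exact: (measurable_comp_snd (measurable_of_size (pn M))).
apply: (measurableT_comp (@measurable_invr R)).
apply: measurable_funM; last exact: measurable_jump2.
apply: measurable_funM;
  last exact: (measurable_comp_fst (measurable_of_size (pdp M ^~ ndp))).
apply: measurable_funM; last exact: (measurable_comp_fst measurable_ps).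
exact: (measurable_comp_fst (measurable_of_size (pn M))).
Qed.

Definition size_update : R.-pker state ~> state :=
  metropolis size_proposal measurable_size_ratio size_ratio_ge0.

Definition rjmcmc_step : R.-pker state ~> state :=
  kthen (kthen theta_update sweep) size_update.

End rjmcmc.

Section ergodicity.
Context d (Z : measurableType d) (R : realType).

Definition tv_distance (P Q : set Z -> \bar R) : \bar R :=
  ereal_sup [set `|P A - Q A|%E | A in measurable].

Definition converges_in_tv (k : R.-pker Z ~> Z) (z : Z)
    (Q : probability Z R) : Prop :=
  tv_distance (kiter k t z) Q @[t --> \oo] --> 0%E.

Definition ergodic (k : R.-pker Z ~> Z) (Q : probability Z R) : Prop :=
  {ae Q, forall z, converges_in_tv k z Q}.

End ergodicity.

Definition bounded_density (T : Type) (R : realType) (f : T -> R) : Prop :=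
  exists C, forall y, f y <= C.

(* Main.v *)
(* Each move of the algorithm is reversible for the unnormalized posterior [J],
   which is therefore invariant. An invariant kernel on a countably generated
   space is ergodic as soon as the laws started from any two good states are not
   mutually singular after some common number of steps: the limit [D (z, w)] of
   the total variation distances between the two laws is subharmonic for the product
   chain, hence, by invariance, constant along almost all independent moves, and
   the mass shared by the two laws forces [D (z, w) = 0].

   From a state of positive density, the first two moves charge everything that
   [J] charges in the current size, since all supports coincide, and the size
   move then charges everything that [J] charges in the adjacent sizes; by the
   interval condition every size of positive prior mass is reached. Aperiodicity
   comes from a size at which the size move is rejected with positive
   probability. Such a size exists, for otherwise the balance between [n] and
   [n + 1] would make [J] of the size [n] nondecreasing in [n], and [J] would be
   infinite. *)
From HB Require Import structures.
From mathcomp Require Import all_boot all_order all_algebra.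
From mathcomp Require Import all_classical all_reals all_analysis.
From mathcomp Require Import measurable_realfun.
From mathcomp Require Import ring lra.
Require Import Defs.

Set Implicit Arguments.
Unset Strict Implicit.
Unset Printing Implicit Defensive.

Import Order.TTheory GRing.Theory Num.Theory.
Import numFieldNormedType.Exports.

Local Open Scope classical_set_scope.
Local Open Scope ring_scope.

(** * Integration against kernels *)

(** Only null sets are compared, never minorizing constants: the criterion asks that two laws share
    some mass at a time that may depend on the pair of states, so no small set has to be produced.
    Countable generation makes the total variation distance between two kernels measurable, so that
    [D] can be integrated. That [D] is constant along moves comes from an L2 argument: for a bounded
    subharmonic function, the mean square increment is at most the increase of the mean square,
    which is zero under an invariant law. For the algorithm, the laws started from all good states
    must meet in one common measure. It is [J] restricted to a size [m0.+1] and weighted by the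
    probability [rejection] that the size move is refused. A refusal keeps the state, so this
    measure is charged again at every later step; this gives all large times at once, although an
    accepted size move always changes the parity of the size. *)

Section integral_mixture.
Local Open Scope ereal_scope.
Context d d' (X : measurableType d) (Z : measurableType d') (R : realType).
Variables (mu : {measure set X -> \bar R}) (k : X -> {measure set Z -> \bar R}).
Hypothesis mk : forall U : set Z, measurable U -> measurable_fun setT (k ^~ U).
Variable m : {measure set Z -> \bar R}.
Hypothesis mE : forall U : set Z, measurable U -> m U = \int[mu]_x k x U.
Import HBNNSimple.

Let integral_mixture_nnsfun (f : {nnsfun Z >-> R}) :
  \int[m]_z (f z)%:E = \int[mu]_x \int[k x]_z (f z)%:E.
Proof.
under [RHS]eq_integral do rewrite integralT_nnsfun sintegralE.
rewrite integralT_nnsfun sintegralE ge0_integral_fsum//; last 2 first.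
- by move=> r; apply: measurable_funeM; exact: mk.
- by move=> r x _; exact: nnsfun_mulemu_ge0.
apply: eq_fsbigr => r /set_mem [z _ <-].
by rewrite ge0_integralZl_EFin ?mE//; exact: mk.
Qed.

(** Simple functions, then monotone convergence. Densities (mixtures of scaled Dirac measures),
    image measures (mixtures of Dirac measures) and composed kernels are all instances, so this one
    argument serves for every change of variables below. *)
Lemma integral_mixture f : (forall z, 0 <= f z) -> measurable_fun setT f ->
  \int[m]_z f z = \int[mu]_x \int[k x]_z f z.
Proof.
move=> f0 mf; pose f_ := nnsfun_approx measurableT mf.
have lim_f (p : {measure set Z -> \bar R}) :
    \int[p]_z f z = limn (fun n => \int[p]_z (f_ n z)%:E).
  rewrite -monotone_convergence//.
  - by apply: eq_integral => z _; apply/esym/cvg_lim => //; exact: cvg_nnsfun_approx.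
  - by move=> n; exact/measurable_EFinP.
  - by move=> n z _; rewrite lee_fin.
  - by move=> z _ a b ab; rewrite lee_fin; exact/lefP/nd_nnsfun_approx.
rewrite lim_f; under eq_fun do rewrite integral_mixture_nnsfun.
rewrite -monotone_convergence//.
- by apply: eq_integral => x _; rewrite lim_f.
- move=> n; apply: measurable_fun_integral_kernel => //.
    by move=> z; rewrite lee_fin.
  exact/measurable_EFinP.
- by move=> n x _; apply: integral_ge0 => z _; rewrite lee_fin.
- move=> x _ a b ab; apply: ge0_le_integral => //.
  + by move=> z _; rewrite lee_fin.
  + exact/measurable_EFinP.
  + exact/measurable_EFinP.
  + by move=> z _; rewrite lee_fin; exact/lefP/nd_nnsfun_approx.
Qed.

End integral_mixture.

Section kernel_integrals.
Local Open Scope ereal_scope.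
Context d d' (X : measurableType d) (Y : measurableType d') (R : realType).

Lemma measurable_mscale_dirac (f : X -> R) (f0 : forall x, (0 <= f x)%R) :
  measurable_fun setT f -> forall U, measurable U ->
  measurable_fun setT (fun x => mscale (NngNum (f0 x)) \d_x U).
Proof.
move=> mf U mU; apply: emeasurable_funM; first exact/measurable_EFinP.
exact: measurable_fun_dirac.
Qed.

Lemma integral_mdensity (mu : {measure set X -> \bar R}) (f : X -> R)
    (mf : measurable_fun setT f) (f0 : forall x, (0 <= f x)%R) g :
  (forall x, 0 <= g x) -> measurable_fun setT g ->
  \int[mdensity mu mf f0]_x g x = \int[mu]_x ((f x)%:E * g x).
Proof.
move=> g0 mg.
rewrite [LHS](@integral_mixture _ _ _ _ _ mu
  (fun x => mscale (NngNum (f0 x)) \d_x : {measure set X -> \bar R}))//.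
- apply: eq_integral => x _; rewrite ge0_integral_mscale//.
  by rewrite integral_dirac// diracT mul1e.
- exact: measurable_mscale_dirac.
- move=> U mU; rewrite /= /mdensity integral_mkcond; apply: eq_integral => x _.
  rewrite patchE /mscale/= diracE; case: ifPn => xU; rewrite ?mule1 ?mule0//.
Qed.

Lemma integral_kdirac (f : X -> Y) (mf : measurable_fun setT f) g x :
  measurable_fun setT g -> \int[kdirac mf x : {measure set Y -> \bar R}]_y g y = g (f x).
Proof. by move=> mg; rewrite integral_dirac// diracT mul1e. Qed.

Lemma integral_kmix (a b : X -> R) (k l : R.-pker X ~> Y)
    (ma : measurable_fun setT a) (mb : measurable_fun setT b)
    (ab1 : forall x, (a x + b x = 1)%R) (a0 : forall x, (0 <= a x)%R)
    (b0 : forall x, (0 <= b x)%R) g x :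
  (forall y, 0 <= g y) -> measurable_fun setT g ->
  \int[kmix k l ma mb ab1 a0 b0 x]_y g y =
  (a x)%:E * \int[k x]_y g y + (b x)%:E * \int[l x]_y g y.
Proof.
move=> g0 mg; rewrite ge0_integral_measure_add//.
by rewrite !ge0_integral_mscale.
Qed.

End kernel_integrals.

Lemma integral_image d d' (X : measurableType d) (Y : measurableType d')
    (R : realType) (mu : {measure set X -> \bar R})
    (m : {measure set Y -> \bar R}) (f : X -> Y) g :
  measurable_fun setT f ->
  (forall U, measurable U -> m U = mu (f @^-1` U)) ->
  (forall y, 0 <= g y)%E -> measurable_fun setT g ->
  (\int[m]_y g y = \int[mu]_x g (f x))%E.
Proof.
move=> mf mE g0 mg.
rewrite (@integral_mixture _ _ _ _ _ mu
  (kdirac mf : X -> {measure set Y -> \bar R}) _ m)//.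
- by apply: eq_integral => x _; rewrite integral_kdirac.
- by move=> U mU; exact: measurable_kernel.
- move=> U mU; rewrite mE// -[in LHS](setIT (f @^-1` U)) -integral_indic//.
  by rewrite -[X in measurable X]setTI; exact: mf.
Qed.

Lemma integral_image_product d1 d2 d3 (T1 : measurableType d1)
    (T2 : measurableType d2) (T3 : measurableType d3) (R : realType)
    (m1 : {sigma_finite_measure set T1 -> \bar R})
    (m2 : {sigma_finite_measure set T2 -> \bar R})
    (m : {measure set T3 -> \bar R}) (f : T1 * T2 -> T3) g :
  measurable_fun setT f ->
  (forall U, measurable U -> m U = (m1 \x m2)%E (f @^-1` U)) ->
  (forall y, 0 <= g y)%E -> measurable_fun setT g ->
  (\int[m]_z g z = \int[m1]_x \int[m2]_y g (f (x, y)))%E.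
Proof.
move=> mf mE g0 mg.
pose m1' : {measure set T1 -> \bar R} := m1.
pose m12 : {measure set (T1 * T2) -> \bar R} := (m1' \x m2)%E.
rewrite (integral_image (mu := m12) mf)//.
apply: (@fubini_tonelli1 _ _ _ _ _ m1 m2 (g \o f)).
- exact: (measurableT_comp mg mf).
- by move=> x; exact: g0.
Qed.

Section kernel_composition_integrals.
Local Open Scope ereal_scope.
Context d d' d'' (X : measurableType d) (Y : measurableType d')
  (Z : measurableType d'') (R : realType).

Lemma measurable_integral_kernel (k : R.-ker X ~> Y) g :
  (forall z, 0 <= g z) -> measurable_fun setT g ->
  measurable_fun setT (fun x => \int[k x]_z g z).
Proof.
move=> g0 mg; apply: measurable_fun_integral_kernel => // U mU.
exact: measurable_kernel.
Qed.

Lemma integral_kthen (k : R.-pker X ~> Y) (l : R.-pker Y ~> Z) g x :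
  (forall z, 0 <= g z) -> measurable_fun setT g ->
  \int[kthen k l x]_z g z = \int[k x]_y \int[l y]_z g z.
Proof.
move=> g0 mg; apply: (integral_mixture (k := l)) => //.
by move=> U mU; exact: measurable_kernel.
Qed.

Lemma integral_kbind (k : R.-pker X ~> Y) (l : R.-pker (X * Y)%type ~> Z) g x :
  (forall z, 0 <= g z) -> measurable_fun setT g ->
  \int[kbind k l x]_z g z = \int[k x]_y \int[l (x, y)]_z g z.
Proof.
move=> g0 mg; apply: (integral_mixture (k := fun y => l (x, y))) => // U mU.
exact: measurableT_comp (measurable_kernel l U mU) (pair1_measurable x).
Qed.

End kernel_composition_integrals.

Section metropolis_integral.
Local Open Scope ereal_scope.
Context d (Z : measurableType d) (R : realType).
Variables (prop : R.-pker Z ~> Z) (ratio : Z * Z -> R).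
Hypothesis mratio : measurable_fun setT ratio.
Hypothesis ratio0 : forall p, (0 <= ratio p)%R.

Lemma integral_metropolis g z : (forall z, 0 <= g z) -> measurable_fun setT g ->
  \int[metropolis prop mratio ratio0 z]_w g w =
  \int[prop z]_w ((accept ratio (z, w))%:E * g w +
                  (1 - accept ratio (z, w))%:E * g z).
Proof.
move=> g0 mg; rewrite /metropolis integral_kbind//; apply: eq_integral => w _.
by rewrite integral_kmix// !integral_kdirac.
Qed.

End metropolis_integral.

(** * Total variation *)

Section countable_algebra.
Context (T : Type) (G : nat -> set T).

(** The ring generated by a sequence is enumerated through the terms that denote its elements:
    finite trees over [nat] form a countable type. Ill-formed trees denote [setT], which puts [setT]
    in the family. *)
Fixpoint set_of_tree (t : GenTree.tree nat) : set T :=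
  match t with
  | GenTree.Leaf n => G n
  | GenTree.Node 0 [:: a; b] => set_of_tree a `|` set_of_tree b
  | GenTree.Node 1 [:: a; b] => set_of_tree a `\` set_of_tree b
  | GenTree.Node _ _ => setT
  end.

Definition setring_seq (n : nat) : set T :=
  if unpickle n is Some t then set_of_tree t else setT.

Let setring_seqP t : range setring_seq (set_of_tree t).
Proof. by exists (pickle t) => //; rewrite /setring_seq pickleK. Qed.

Let setring_seq_tree n : exists t, setring_seq n = set_of_tree t.
Proof.
rewrite /setring_seq; case: (unpickle n) => [t|]; first by exists t.
by exists (GenTree.Node 2 [::]).
Qed.

Lemma sub_setring_seq : range G `<=` range setring_seq.
Proof. by move=> _ [n _ <-]; exact: (setring_seqP (GenTree.Leaf n)). Qed.

Lemma setring_seqT : range setring_seq setT.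
Proof. exact: (setring_seqP (GenTree.Node 2 [::])). Qed.

Lemma setring_setring_seq : setring (range setring_seq).
Proof.
have setD : setD_closed (range setring_seq).
  move=> _ _ [a _ <-] [b _ <-].
  have [[t ->] [u ->]] := (setring_seq_tree a, setring_seq_tree b).
  exact: (setring_seqP (GenTree.Node 1 [:: t; u])).
split=> //; first by rewrite -(setDv setT); apply: setD; exact: setring_seqT.
move=> _ _ [a _ <-] [b _ <-].
have [[t ->] [u ->]] := (setring_seq_tree a, setring_seq_tree b).
exact: (setring_seqP (GenTree.Node 0 [:: t; u])).
Qed.

End countable_algebra.

Lemma countably_generated_setring d (T : measurableType d) :
  countably_generated T -> exists F : nat -> set T,
    [/\ setring (range F), range F setT & @measurable d T = <<s range F >>].
Proof.
move=> [G [/countable_injP[f finj] mG]].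
(* An enumeration of [G] through the injection [f]; integers outside its image are sent to [setT],
   which is measurable. *)
pose g n := xget setT [set A | G A /\ f A = n].
have gG : G `<=` range g.
  move=> A GA; exists (f A) => //; rewrite /g.
  case: xgetP => [B _ [GB fBA]|/(_ A)]; last by case.
  by apply: finj; rewrite ?inE.
have mg n : measurable (g n).
  rewrite /g; case: xgetP => // B _ [GB _].
  by rewrite mG; exact: sub_sigma_algebra.
exists (setring_seq g); split.
- exact: setring_setring_seq.
- exact: setring_seqT.
- have mtree t : measurable (set_of_tree g t).
    move: t; fix ih 1 => -[n|[|[|k]] [|a [|b [|? ?]]]] //=.
    + by apply: measurableU.
    + by apply: measurableD.
  apply/seteqP; split.
  + rewrite mG; apply: sub_sigma_algebra2; apply: subset_trans gG _.
    exact: sub_setring_seq.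
  + apply: smallest_sub; first exact: sigma_algebra_measurable.
    move=> _ [n _ <-]; rewrite /setring_seq.
    by case: (unpickle n).
Qed.

Section total_variation.
Local Open Scope ereal_scope.
Context d (Z : measurableType d) (R : realType).
Implicit Types p q : {measure set Z -> \bar R}.

Let prob_fin p A : p setT = 1 -> measurable A -> p A \is a fin_num.
Proof.
move=> p1 mA; rewrite ge0_fin_numE//; apply: (@le_lt_trans _ _ 1).
  by rewrite -p1 le_measure// inE.
exact: ltry.
Qed.

Lemma tv_distance_ge (P Q : set Z -> \bar R) A :
  measurable A -> `|P A - Q A| <= tv_distance P Q.
Proof. by move=> mA; apply: ereal_sup_ubound; exists A. Qed.

Lemma tv_distance_ge0 (P Q : set Z -> \bar R) : 0 <= tv_distance P Q.
Proof.
by apply: le_trans (tv_distance_ge P Q measurable0); exact: abse_ge0.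
Qed.

Lemma le_tv_distance p q A : p setT = 1 -> q setT = 1 ->
  measurable A -> p A <= q A + tv_distance p q.
Proof.
move=> p1 q1 mA; rewrite -leeBlDl ?prob_fin//.
exact: le_trans (lee_abs _) (tv_distance_ge _ _ mA).
Qed.

(* Passing to complements gives the reverse inequality. *)
Lemma tv_distance_le p q x : p setT = 1 -> q setT = 1 ->
  (forall A, measurable A -> p A <= q A + x) -> tv_distance p q <= x.
Proof.
move=> p1 q1 pq; apply: ge_ereal_sup => _ [A mA <-].
have fp B : measurable B -> p B \is a fin_num by exact: prob_fin.
have fq B : measurable B -> q B \is a fin_num by exact: prob_fin.
have [pq0|/ltW qp0] := leP 0 (p A - q A).
  by rewrite gee0_abs// leeBlDl ?fq// pq.
rewrite lee0_abs// fin_num_oppeB ?fp ?fq// addeC leeBlDl ?fp//.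
have mAC := measurableC mA.
have pqT : p A + p (~` A) = q A + q (~` A).
  rewrite -measureU//; last by rewrite setICr.
  rewrite -[RHS]measureU//; last by rewrite setICr.
  rewrite setUCr.
  exact: etrans p1 (esym q1).
rewrite -(leeD2rE _ _ (fq _ mAC)) -pqT addeAC -addeA leeD2l// pq//.
Qed.

Lemma tv_distance_le1 p q : p setT = 1 -> q setT = 1 -> tv_distance p q <= 1.
Proof.
move=> p1 q1; apply: tv_distance_le => // A mA; rewrite -[leLHS]add0e leeD//.
by rewrite -p1 le_measure// inE.
Qed.

(* The inequality [`|p A - q A| <= c] passes to monotone limits of sets, so it
   extends from the ring to the sigma-algebra it generates. *)
Lemma tv_distance_setring (F : nat -> set Z) p q :
  setring (range F) -> range F setT -> @measurable d Z = <<s range F >> ->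
  p setT = 1 -> q setT = 1 ->
  tv_distance p q = ereal_sup (range (fun n => `|p (F n) - q (F n)|)).
Proof.
move=> rF FT mF p1 q1.
have mFn n : measurable (F n) by rewrite mF; apply: sub_sigma_algebra; exists n.
apply/eqP; rewrite eq_le; apply/andP; split; last first.
  by apply: ge_ereal_sup => _ [n _ <-]; exact: tv_distance_ge.
set c := ereal_sup _.
pose B := [set A | measurable A /\ `|p A - q A| <= c].
have cvgB (H : nat -> set Z) A : (forall n, B (H n)) -> measurable A ->
    p (H n) @[n --> \oo] --> p A -> q (H n) @[n --> \oo] --> q A -> B A.
  move=> BH mA pH qH; split=> //.
  have : `|p (H n) - q (H n)| @[n --> \oo] --> `|p A - q A|.
    by apply: cvg_abse; apply: cvgeB => //; rewrite fin_num_adde_defr// prob_fin.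
  by move=> /cvge_to_le; apply; apply: nearW => n; have [] := BH n.
have monoB : monotone B.
  split => H ndH BH.
  - have mH n : measurable (H n) by have [] := BH n.
    have mUH : measurable (\bigcup_n H n) by exact: bigcupT_measurable.
    by apply: (cvgB H) => //; exact: nondecreasing_cvg_mu.
  - have mH n : measurable (H n) by have [] := BH n.
    have mIH : measurable (\bigcap_n H n) by exact: bigcapT_measurable.
    by apply: (cvgB H) => //; apply: nonincreasing_cvg_mu => //;
      rewrite -ge0_fin_numE// prob_fin.
have FB : range F `<=` B.
  by move=> _ [n _ <-]; split=> //; apply: ereal_sup_ubound; exists n.
have sFB : <<sr range F >> `<=` B.
  by rewrite -g_monotone_g_sigma_ring//; exact: smallest_sub.
(* The ring contains [setT], so the generated sigma-ring is closed under complement and contains the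
   generated sigma-algebra. *)
have mB : @measurable d Z `<=` B.
  apply: subset_trans sFB; rewrite mF; apply: smallest_sub; last exact: sub_g_sigma_ring.
  have [sr0 srD srU] := smallest_sigma_ring (range F).
  by split=> // A sA; apply: srD => //; exact: sub_g_sigma_ring.
by apply: ge_ereal_sup => _ [A mA <-]; have [] := mB A mA.
Qed.

(** Countable generation enters here: a supremum over all measurable sets need not be measurable,
    but it equals a supremum over a countable ring. *)
Lemma measurable_tv_distance d1 (X : measurableType d1) (k l : X -> {measure set Z -> \bar R}) :
  countably_generated Z ->
  (forall U, measurable U -> measurable_fun setT (k ^~ U)) ->
  (forall U, measurable U -> measurable_fun setT (l ^~ U)) ->
  (forall x, k x setT = 1) -> (forall x, l x setT = 1) ->
  measurable_fun setT (fun x => tv_distance (k x) (l x)).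
Proof.
move=> /countably_generated_setring[F [rF FT mF]] mk ml k1 l1.
have mFn n : measurable (F n) by rewrite mF; apply: sub_sigma_algebra; exists n.
rewrite [X in measurable_fun _ X](_ : _ =
    (fun x => esups (fun n => `|k x (F n) - l x (F n)|) 0%N)); last first.
  apply/funext => x; rewrite (tv_distance_setring rF)// /esups/=.
  by congr ereal_sup; apply/seteqP; split => _ [n _ <-]; exists n.
apply: measurable_fun_esups => n; apply: measurableT_comp => //.
by apply: emeasurable_funB; [exact: mk|exact: ml].
Qed.

End total_variation.

Section jordan.
Local Open Scope ereal_scope.
Context d (Z : measurableType d) (R : realType).
Implicit Types p q : probability Z R.

(** The two parts of the Jordan decomposition of [p - q]. Domination by [p] and [q] makes null sets
    of the product of [p] and [q] null for the product of the parts, and the last clause bounds the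
    common mass by the total variation distance. *)
Lemma jordan_probability p q : exists Jp Jn : {finite_measure set Z -> \bar R},
  [/\ forall A, measurable A -> p A + Jn A = q A + Jp A,
      forall A, measurable A -> Jp A <= p A,
      forall A, measurable A -> Jn A <= q A,
      Jn setT = Jp setT &
      exists2 A, measurable A & Jp setT = p A - q A].
Proof.
pose nu := cadd (charge_of_finite_measure p)
  (cscale (-1) (charge_of_finite_measure q)).
have nuE A : nu A = p A - q A.
  by rewrite /nu/= /cadd/= cscaleN1.
have [P [N PN]] := Hahn_decomposition nu.
have [[mP posP] [mN negN] PUN PIN] := PN.
have fin (r : probability Z R) A : measurable A -> r A \is a fin_num.
  by move=> mA; exact: fin_num_measure.
have JpE A : measurable A -> jordan_pos PN A = p (A `&` P) - q (A `&` P).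
  move=> mA; rewrite jordan_posE cjordan_posE /crestr0 mem_set//.
  by rewrite -nuE.
have JnE A : measurable A -> jordan_neg PN A = q (A `&` N) - p (A `&` N).
  move=> mA; rewrite jordan_negE cjordan_negE /crestr0 mem_set//.
  rewrite [X in - X](_ : _ = p (A `&` N) - q (A `&` N)); last exact: nuE.
  by rewrite fin_num_oppeB ?fin//; [rewrite addeC|exact: measurableI].
have decomp A : measurable A -> p A + jordan_neg PN A = q A + jordan_pos PN A.
  move=> mA; have := jordan_decomp PN mA.
  rewrite [LHS]nuE /cadd/=.
  have -> : cscale (-1) (jordan_neg PN) A = - jordan_neg PN A by rewrite cscaleN1.
  have : jordan_pos PN A \is a fin_num by exact: fin_num_measure.
  have : jordan_neg PN A \is a fin_num by exact: fin_num_measure.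
  have := fin p A mA; have := fin q A mA.
  move: (p A) (q A) (jordan_pos PN A) (jordan_neg PN A).
  move=> [a| |] [b| |] [c| |] [e| |]//= _ _ _ _.
  by rewrite -!EFinB -!EFinD => -[abce]; congr (_%:E); lra.
exists (jordan_pos PN : {finite_measure set Z -> \bar R}).
exists (jordan_neg PN : {finite_measure set Z -> \bar R}); split => //=.
- move=> A mA; rewrite JpE//; apply: (@le_trans _ _ (p (A `&` P))).
    by rewrite leeBlDr ?fin ?leeDl//; exact: measurableI.
  by rewrite le_measure ?inE//; exact: measurableI.
- move=> A mA; rewrite JnE//; apply: (@le_trans _ _ (q (A `&` N))).
    by rewrite leeBlDr ?fin ?leeDl//; exact: measurableI.
  by rewrite le_measure ?inE//; exact: measurableI.
- have := decomp setT measurableT; rewrite !probability_setT.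
  move: (jordan_neg PN setT) (jordan_pos PN setT) => [a| |] [b| |]//=.
  by rewrite -!EFinD => -[/addrI ->].
- by exists P => //; rewrite JpE// setTI.
Qed.

End jordan.

Section coupling.
Local Open Scope ereal_scope.
Context d (Z : measurableType d) (R : realType).

(** The pointwise inequality is integrated against the product coupling. As [a] and [b] are not
    normalized, integrating out the idle coordinate leaves its total mass as a factor. *)
Lemma coupling_le (a b : {finite_measure set Z -> \bar R}) (h : Z -> \bar R)
    (c : Z * Z -> \bar R) :
  (forall z, 0 <= h z) -> measurable_fun setT h ->
  (forall zw, 0 <= c zw) -> measurable_fun setT c ->
  (forall z w, h z <= h w + c (z, w)) ->
  b setT * (\int[a]_z h z) <=
  a setT * (\int[b]_w h w) + \int[a \x b]_zw c zw.
Proof.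
move=> h0 mh c0 mc hc.
have m1 : measurable_fun setT (fun zw : Z * Z => h zw.1) by exact: measurableT_comp.
have m2 : measurable_fun setT (fun zw : Z * Z => h zw.2) by exact: measurableT_comp.
have -> : b setT * (\int[a]_z h z) = \int[a \x b]_zw h zw.1.
  rewrite fubini_tonelli1//= /fubini_F/=.
  under [RHS]eq_integral do rewrite integral_cst// muleC.
  by rewrite ge0_integralZl.
have -> : a setT * (\int[b]_w h w) = \int[a \x b]_zw h zw.2.
  by rewrite fubini_tonelli2//= /fubini_G/= ; under [RHS]eq_integral do
    rewrite integral_cst// muleC; rewrite ge0_integralZl.
rewrite -ge0_integralD//; apply: ge0_le_integral => //.
- by apply: emeasurable_funD.
- by move=> [z w] _ /=.
Qed.

End coupling.

(** * Iterates of a kernel *)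

Section kernel_prob.
Context d d' (X : measurableType d) (Y : measurableType d') (R : realType).

(** A named copy of [k x], to which the structure of a probability measure can be attached; [k x]
    itself is only known as a measure. *)
Definition kernel_prob (k : R.-pker X ~> Y) (x : X) : set Y -> \bar R := k x.

HB.instance Definition _ (k : R.-pker X ~> Y) x := Measure.on (kernel_prob k x).

HB.instance Definition _ (k : R.-pker X ~> Y) x :=
  Measure_isProbability.Build _ _ R (kernel_prob k x) (@prob_kernel _ _ _ _ _ k x).

End kernel_prob.

Section pairker.
Local Open Scope ereal_scope.
Context d (Z : measurableType d) (R : realType).
Variable k : R.-pker Z ~> Z.

Let m1 : measurable_fun setT (fun p : Z * Z => p.1).
Proof. exact: measurable_fst. Qed.

Let m2 : measurable_fun setT (fun p : (Z * Z) * Z => p.1.2).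
Proof. exact: measurableT_comp. Qed.

Let m3 : measurable_fun setT (fun p : ((Z * Z) * Z) * Z => (p.1.2, p.2)).
Proof. by apply: measurable_fun_pair => //; exact: measurableT_comp. Qed.

(** Two independent moves: [kdirac m1] and [kdirac m2] select the starting point of each copy, and
    [m3] keeps only the two new points. *)
Definition pairker : R.-pker (Z * Z)%type ~> (Z * Z)%type :=
  kbind (kthen (kdirac m1) k) (kbind (kthen (kdirac m2) k) (kdirac m3)).

Lemma measurable_pairker2 f : (forall zw, 0 <= f zw) -> measurable_fun setT f ->
  measurable_fun setT (fun p : (Z * Z) => \int[k p.2]_w f (p.1, w)).
Proof.
move=> f0 mf.
have mf' : measurable_fun setT (fun p : (Z * Z) * Z => f (p.1.1, p.2)).
  apply: measurableT_comp => //; apply: measurable_fun_pair => //.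
  exact: measurableT_comp.
have ms : measurable_fun setT (fun p : Z * Z => p.2) by exact: measurable_snd.
have := measurable_fun_integral_sfinite_kernel
  (fun p : (Z * Z) * Z => f (p.1.1, p.2)) (kthen (kdirac ms) k)
  (fun=> f0 _) mf'.
apply: eq_measurable_fun => p _; rewrite integral_kthen ?integral_kdirac//.
- apply: measurable_integral_kernel => //.
  exact: measurableT_comp (mf) (pair1_measurable _).
- exact: measurableT_comp (mf) (pair1_measurable _).
Qed.

Lemma integral_pairker f zw : (forall zw, 0 <= f zw) -> measurable_fun setT f ->
  \int[pairker zw]_zw' f zw' = \int[k zw.1]_z \int[k zw.2]_w f (z, w).
Proof.
move=> f0 mf; rewrite /pairker integral_kbind//.
have mfz z : measurable_fun setT (fun w => f (z, w)).
  exact: measurableT_comp (mf) (pair1_measurable _).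
transitivity (\int[kthen (kdirac m1) k zw]_z \int[k zw.2]_w f (z, w)).
  apply: eq_integral => z _; rewrite integral_kbind//.
  rewrite integral_kthen//; last 2 first.
  - by move=> w; exact: integral_ge0.
  - apply: (eq_measurable_fun (fun w => f (z, w))) => // w _.
    by rewrite integral_kdirac.
  rewrite integral_kdirac/=; last first.
    apply: measurable_integral_kernel; first by move=> w; exact: integral_ge0.
    apply: (eq_measurable_fun (fun w => f (z, w))) => // w _.
    by rewrite integral_kdirac.
  by apply: eq_integral => w _; rewrite integral_kdirac.
have mg : measurable_fun setT (fun z => \int[k zw.2]_w f (z, w)).
  exact: (measurableT_comp (measurable_pairker2 f0 mf) (pair2_measurable zw.2)).
rewrite integral_kthen//; last by move=> z; exact: integral_ge0.
by rewrite integral_kdirac//; apply: measurable_integral_kernel => // z; exact: integral_ge0.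
Qed.

End pairker.

Section iterates.
Local Open Scope ereal_scope.
Context d (Z : measurableType d) (R : realType).
Variable k : R.-pker Z ~> Z.

Lemma integral_kiterD s t z f : (forall z, 0 <= f z) -> measurable_fun setT f ->
  \int[kiter k (s + t) z]_y f y = \int[kiter k s z]_y \int[kiter k t y]_x f x.
Proof.
elim: t f => [|t ih] f f0 mf.
  by rewrite addn0; apply: eq_integral => y _; rewrite integral_kdirac.
rewrite addnS [kiter k (s + t).+1]/= integral_kthen// ih//.
- by apply: eq_integral => y _; rewrite [kiter k t.+1]/= integral_kthen.
- by move=> y; exact: integral_ge0.
- exact: measurable_integral_kernel.
Qed.

Lemma kiterD s t z A : measurable A ->
  kiter k (s + t) z A = \int[kiter k s z]_y kiter k t y A.
Proof.
move=> mA; rewrite -[in LHS](setIT A) -integral_indic// integral_kiterD//.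
- by apply: eq_integral => y _; rewrite integral_indic// setIT.
- exact/measurable_EFinP.
Qed.

(** After the common part of [p] and [q] is cancelled, the excess of [p' A] over [q' A] is at most
    the integral of [k z A <= 1] against the positive part [Jp], that is, at most the mass of
    [Jp]. *)
Lemma tv_distance_kernel (p q : probability Z R) (p' q' : {measure set Z -> \bar R}) :
  p' setT = 1 -> q' setT = 1 ->
  (forall A, measurable A -> p' A = \int[p]_z k z A) ->
  (forall A, measurable A -> q' A = \int[q]_z k z A) ->
  tv_distance p' q' <= tv_distance p q.
Proof.
move=> p'1 q'1 p'E q'E.
apply: tv_distance_le => // A mA; rewrite p'E// q'E//.
have [Jp [Jn [decomp _ _ _ [B mB JpT]]]] := jordan_probability p q.
have mk : measurable_fun setT (fun z => k z A) by exact: measurable_kernel.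
have k0 z : 0 <= k z A by [].
have : \int[p]_z k z A + \int[Jn]_z k z A = \int[q]_z k z A + \int[Jp]_z k z A.
  rewrite -!ge0_integral_measure_add//.
  apply: eq_measure_integral => B' mB' _.
  by have := decomp _ mB'; rewrite -!measure_addE.
move=> h; apply: (@le_trans _ _ (\int[q]_z k z A + \int[Jp]_z k z A)).
  by rewrite -h leeDl//; exact: integral_ge0.
rewrite leeD2l//; apply: (@le_trans _ _ (Jp setT)); last first.
  by rewrite JpT; exact: le_trans (lee_abs _) (tv_distance_ge _ _ mB).
rewrite -[leRHS]mul1e -integral_cst//; apply: ge0_le_integral => //.
by move=> z _; rewrite -(@prob_kernel _ _ _ _ _ k z) le_measure ?inE.
Qed.

End iterates.

(** * Ergodicity of overlapping iterates *)

(* [(f - c)^2 + 2 c f = f^2 + c^2], integrated *)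
Lemma integral_sqr_deviation_le d (T : measurableType d) (R : realType)
    (mu : {measure set T -> \bar R}) (f : T -> R) (c : R) :
  mu setT = 1%E -> measurable_fun setT f -> (forall x, 0 <= f x) -> 0 <= c ->
  (c%:E <= \int[mu]_x (f x)%:E)%E ->
  (\int[mu]_x ((f x - c) ^+ 2)%:E + (c ^+ 2)%:E <= \int[mu]_x (f x ^+ 2)%:E)%E.
Proof.
move=> mu1 mf f0 c0 cf.
have m2 : measurable_fun setT (fun x => (f x ^+ 2)%:E).
  exact/measurable_EFinP/measurable_funX.
have m1 : measurable_fun setT (fun x => (f x)%:E) by exact/measurable_EFinP.
have md : measurable_fun setT (fun x => ((f x - c) ^+ 2)%:E).
  by apply/measurable_EFinP/measurable_funX/measurable_funB.
have key : (\int[mu]_x ((f x - c) ^+ 2)%:E + (2 * c)%:E * \int[mu]_x (f x)%:E =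
    \int[mu]_x (f x ^+ 2)%:E + (c ^+ 2)%:E)%E.
  have cE : (\int[mu]_x (c ^+ 2)%:E = (c ^+ 2)%:E)%E.
    by rewrite integral_cst// mu1 mule1.
  rewrite -[in RHS]cE -ge0_integralZl_EFin//; last 2 first.
  - by move=> x _; rewrite lee_fin.
  - exact: mulr_ge0.
  rewrite -[LHS]ge0_integralD//; last 3 first.
  - by move=> x _; rewrite lee_fin sqr_ge0.
  - by move=> x _; rewrite mule_ge0 ?lee_fin ?mulr_ge0.
  - exact: measurable_funeM.
  rewrite -[RHS]ge0_integralD//; last 2 first.
  - by move=> x _; rewrite lee_fin sqr_ge0.
  - by move=> x _; rewrite lee_fin sqr_ge0.
  by apply: eq_integral => x _; rewrite -EFinM -!EFinD; congr EFin; ring.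
rewrite -(leeD2rE _ _ (_ : (c ^+ 2)%:E \is a fin_num))// -key.
rewrite -addeA leeD2l// -EFinD.
have -> : c ^+ 2 + c ^+ 2 = 2 * c * c by ring.
by rewrite EFinM lee_wpmul2l ?lee_fin ?mulr_ge0.
Qed.

Section ergodic_of_overlap.
Local Open Scope ereal_scope.
Context d (Z : measurableType d) (R : realType).
Variables (k : R.-pker Z ~> Z) (pi : probability Z R).
Hypothesis cgZ : countably_generated Z.
Hypothesis inv : forall A, measurable A -> \int[pi]_z k z A = pi A.

Local Notation K t z := (kernel_prob (kiter k t) z).
Local Notation Q t zw := (pairker (kiter k t) zw).

Let dist t (zw : Z * Z) := tv_distance (kiter k t zw.1) (kiter k t zw.2).

Let mdist t : measurable_fun setT (dist t).
Proof.
apply: measurable_tv_distance => //.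
- by move=> U mU; exact: measurableT_comp (measurable_kernel (kiter k t) U mU) measurable_fst.
- by move=> U mU; exact: measurableT_comp (measurable_kernel (kiter k t) U mU) measurable_snd.
- by move=> zw; exact: prob_kernel.
- by move=> zw; exact: prob_kernel.
Qed.

Let dist_ge0 t zw : 0 <= dist t zw. Proof. exact: tv_distance_ge0. Qed.

Let dist_le1 t zw : dist t zw <= 1.
Proof. by apply: tv_distance_le1; exact: prob_kernel. Qed.

Let distS t zw : dist t.+1 zw <= dist t zw.
Proof.
apply: (@tv_distance_kernel _ _ _ k (K t zw.1) (K t zw.2)) => //;
  exact: prob_kernel.
Qed.

Let D zw := ereal_inf (range (dist ^~ zw)).

Let cvgD zw : dist t zw @[t --> \oo] --> D zw.
Proof. by apply: ereal_nonincreasing_cvgn; apply/nonincreasing_seqP. Qed.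

Let mD : measurable_fun setT D.
Proof. by apply: (emeasurable_fun_cvg dist) => // zw _; exact: cvgD. Qed.

Let D_le t zw : D zw <= dist t zw.
Proof. by apply: ereal_inf_lbound; exists t. Qed.

Let D_ge0 zw : 0 <= D zw.
Proof. by apply: le_ereal_inf_tmp => _ [t _ <-]. Qed.

Let D_le1 zw : D zw <= 1.
Proof. exact: le_trans (D_le 0 zw) (dist_le1 0 zw). Qed.

Let D_fin zw : D zw \is a fin_num.
Proof. by rewrite ge0_fin_numE//; exact: le_lt_trans (D_le1 zw) (ltry _). Qed.

Let cvg_integral_dist d' (X : measurableType d') (mu : {measure set X -> \bar R})
    (u : X -> Z * Z) : mu setT < +oo -> measurable_fun setT u ->
  \int[mu]_x dist t (u x) @[t --> \oo] --> \int[mu]_x D (u x).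
Proof.
move=> muT mu_; have [] := @dominated_convergence _ _ _ mu setT measurableT
  (fun t x => dist t (u x)) (fun x => D (u x)) (cst 1) => //.
- by move=> t; exact: measurableT_comp.
- exact: measurableT_comp.
- by apply: aeW => x _; exact: cvgD.
- by apply/integrableP; split => //; under eq_integral do rewrite gee0_abs//;
    rewrite integral_cst// mul1e.
- by apply: aeW => x t _; rewrite gee0_abs.
Qed.

(** The coupling inequality for the independent laws at time [s], with [kiter k t y A] as the
    function and [dist t] as the cost. *)
Let distD s t zw : dist (s + t) zw <= \int[Q s zw]_u dist t u.
Proof.
apply: tv_distance_le; [exact: prob_kernel|exact: prob_kernel|] => A mA.
have mk : measurable_fun setT (fun y => kiter k t y A) by exact: measurable_kernel.
have := @coupling_le _ _ _ (K s zw.1) (K s zw.2) (fun y => kiter k t y A)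
  (dist t) (fun=> measure_ge0 _ _) mk (dist_ge0 t) (mdist t).
rewrite /= !probability_setT !mul1e kiterD// kiterD// integral_pairker//.
rewrite fubini_tonelli1//; apply => z w.
by apply: le_tv_distance => //; exact: prob_kernel.
Qed.

(** The limit of [distD] as [t] grows, by dominated convergence: [D] is subharmonic for the product
    chain. *)
Let D_sub s zw : D zw <= \int[Q s zw]_u D u.
Proof.
have := @cvg_integral_dist _ _ (pairker (kiter k s) zw) id.
rewrite prob_kernel => /(_ (ltry _) (@measurable_id _ _ _)).
move=> /cvge_to_ge; apply; apply: nearW => t.
exact: le_trans (D_le (s + t) zw) (distD s t zw).
Qed.

Let inv_kiter t A : measurable A -> \int[pi]_z kiter k t z A = pi A.
Proof.
move=> mA; elim: t => [|t ih].
  by rewrite -[in RHS](setIT A) -integral_indic.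
(* The additional step is moved to the front, where the invariance of [pi] absorbs it. *)
under eq_integral do rewrite -addn1 addnC kiterD//.
rewrite -[RHS]ih; apply/esym; apply: (@integral_mixture _ _ _ _ _ pi (kiter k 1) _ pi) => //.
- by move=> U mU; exact: measurable_kernel.
- move=> U mU; apply: etrans (esym (inv mU)) _; apply: eq_integral => z _.
  by rewrite /= /kthen/= /mkcomp_noparam/kcomp_noparam integral_kdirac//; exact: measurable_kernel.
- by exact: measurable_kernel.
Qed.

Let integral_kiter t f : (forall z, 0 <= f z) -> measurable_fun setT f ->
  \int[pi]_z \int[kiter k t z]_y f y = \int[pi]_z f z.
Proof.
move=> f0 mf; rewrite -(@integral_mixture _ _ _ _ _ pi (kiter k t) _ pi)//.
- by move=> U mU; exact: measurable_kernel.
- by move=> U mU; rewrite inv_kiter.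
Qed.

Let pipi : {measure set (Z * Z) -> \bar R} := (pi \x pi).

Let pipiT : pipi setT = 1.
Proof.
have : (pi \x pi) ([set: Z] `*` [set: Z]) = 1.
  by rewrite product_measure1E//= !probability_setT mule1.
by rewrite setXTT.
Qed.

(** Tonelli separates the two coordinates, and the invariance of [pi] is applied in each of them. *)
Let integral_pairkiter t f : (forall zw, 0 <= f zw) -> measurable_fun setT f ->
  \int[pipi]_zw \int[Q t zw]_u f u = \int[pipi]_zw f zw.
Proof.
move=> f0 mf.
have mfz z : measurable_fun setT (fun w => f (z, w)).
  exact: measurableT_comp (mf) (pair1_measurable _).
have mg : measurable_fun setT
    (fun p : Z * Z => \int[kiter k t p.2]_w f (p.1, w)).
  exact: measurable_pairker2.
have g0 (p : Z * Z) : 0 <= \int[kiter k t p.2]_w f (p.1, w) by exact: integral_ge0.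
rewrite [LHS]fubini_tonelli1//; last 2 first.
- exact: measurable_integral_kernel.
- by move=> zw; exact: integral_ge0.
rewrite [RHS](fubini_tonelli1 f mf f0) /fubini_F.
transitivity (\int[pi]_z \int[kiter k t z]_z' \int[pi]_w
    \int[kiter k t w]_w' f (z', w')).
  apply: eq_integral => z _.
  under eq_integral do rewrite integral_pairker//.
  apply: (@fubini_tonelli _ _ _ _ _ pi (K t z)
    (fun p : Z * Z => \int[kiter k t p.1]_w f (p.2, w))).
  - by have := measurableT_comp mg (@measurable_swap _ _ Z Z).
  - by move=> x; exact: integral_ge0.
apply: etrans (@integral_kiter t
  (fun z' => \int[pi]_w \int[kiter k t w]_w' f (z', w')) _ _) _.
- by move=> z; do 2 apply: integral_ge0 => ? _.
- by apply: (measurable_fun_fubini_tonelli_F _ mg).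
- by apply: eq_integral => z _; rewrite integral_kiter.
Qed.

Let r zw : R := fine (D zw).

Let rE zw : (r zw)%:E = D zw. Proof. exact: fineK. Qed.

Let mr : measurable_fun setT r.
Proof. by apply: measurableT_comp mD; exact: fine_measurable. Qed.

Let r_ge0 zw : (0 <= r zw)%R. Proof. by rewrite fine_ge0. Qed.

Let r_le1 zw : (r zw <= 1)%R. Proof. by rewrite -lee_fin rE. Qed.

(** The mean square increment of [D] along independent moves: it vanishes exactly when [D] is almost
    surely constant along them. *)
Let dev t zw := \int[Q t zw]_u ((r u - r zw) ^+ 2)%:E.

Let mdev t : measurable_fun setT (dev t).
Proof.
apply: (@measurable_fun_integral_sfinite_kernel _ _ _ _ _
  (fun p : (Z * Z) * (Z * Z) => ((r p.2 - r p.1) ^+ 2)%:E) (pairker (kiter k t))).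
  by move=> p; rewrite lee_fin sqr_ge0.
apply/measurable_EFinP/measurable_funX/measurable_funB.
- exact: measurableT_comp mr measurable_snd.
- exact: measurableT_comp mr measurable_fst.
Qed.

Let dev_ge0 t zw : 0 <= dev t zw.
Proof. by apply: integral_ge0 => u _; rewrite lee_fin sqr_ge0. Qed.

Let dev_le t zw :
  dev t zw + (r zw ^+ 2)%:E <= \int[Q t zw]_u (r u ^+ 2)%:E.
Proof.
apply: integral_sqr_deviation_le => //; first exact: prob_kernel.
by under eq_integral do rewrite rE; rewrite rE.
Qed.

(** When [dev_le] is integrated against the invariant law [pipi], both sides contain the integral of
    the square of [r]. It is finite because [r <= 1], so it cancels and leaves nothing for
    [dev t]. *)
Let dev0 t : {ae pipi, forall zw, dev t zw = 0}.
Proof.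
have m2 : measurable_fun setT (fun u => (r u ^+ 2)%:E).
  exact/measurable_EFinP/measurable_funX.
have rr u : 0 <= (r u ^+ 2)%:E by rewrite lee_fin sqr_ge0.
have fin : \int[pipi]_zw (r zw ^+ 2)%:E \is a fin_num.
  rewrite ge0_fin_numE ?integral_ge0//.
  apply: (@le_lt_trans _ _ (\int[pipi]_zw (cst 1) zw)).
    by apply: ge0_le_integral => // zw _; rewrite lee_fin expr_le1.
  by rewrite integral_cst// mul1e pipiT ltry.
have : \int[pipi]_zw dev t zw + \int[pipi]_zw (r zw ^+ 2)%:E <=
    \int[pipi]_zw (r zw ^+ 2)%:E.
  rewrite -ge0_integralD// -[leRHS](integral_pairkiter t)//.
  apply: ge0_le_integral => //.
  - by move=> zw _; rewrite adde_ge0.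
  - exact: emeasurable_funD.
  - exact: measurable_integral_kernel.
rewrite -[leRHS]add0e leeD2rE// => dev_le0.
have /ae_eq_integral_abs : \int[pipi]_zw `|dev t zw| = 0.
  under eq_integral do rewrite gee0_abs//.
  by apply/eqP; rewrite eq_le dev_le0 integral_ge0.
move=> /(_ measurableT (mdev t)).
by apply: filterS => zw /(_ Logic.I).
Qed.

Let overlap t zw := forall A, measurable A ->
  kiter k t zw.1 A = 0 -> kiter k t zw.2 (~` A) = 0 -> False.

(* A null deviation makes [D] constant, equal to [D zw], for almost every pair
   of independent moves from [zw], hence also under the product of the Jordan
   parts of the difference of the two laws. If they have mass [delta < 1], the
   coupling inequality then yields [D zw <= delta * D zw]. *)
Let dev0_overlap t zw : dev t zw = 0 -> overlap t zw -> D zw = 0.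
Proof.
move=> dev_eq0 ov.
have [Jp [Jn [decomp Jpp Jnq JnT [B mB JpT]]]] :=
  jordan_probability (K t zw.1) (K t zw.2).
have fin_measure (mu : {finite_measure set Z -> \bar R}) A :
  measurable A -> mu A \is a fin_num by move=> mA; exact: fin_num_measure.
pose delta := fine (Jp setT).
have deltaE : Jp setT = delta%:E by rewrite fineK// fin_measure.
have delta_ge0 : (0 <= delta)%R by rewrite fine_ge0.
(* Otherwise [B] has mass 1 for the first law and 0 for the second, and the complement of [B]
   contradicts the overlap. *)
have delta_lt1 : (delta < 1)%R.
  rewrite ltNge; apply/negP; rewrite -lee_fin -deltaE JpT => le1.
  have {}le1 : 1 <= kiter k t zw.1 B - kiter k t zw.2 B by [].
  have pB1 : kiter k t zw.1 B <= 1 by exact: (@probability_le1 _ _ _ (K t zw.1)).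
  have fq : kiter k t zw.2 B \is a fin_num by exact: (fin_measure (K t zw.2)).
  have qB0 : kiter k t zw.2 B = 0.
    apply/eqP; rewrite eq_le measure_ge0 andbT.
    by move: le1; rewrite leeBrDl// => /le_trans/(_ pB1); rewrite -[leRHS]add0e leeD2rE.
  have pB : kiter k t zw.1 B = 1.
    by apply/eqP; rewrite eq_le pB1; move: le1; rewrite qB0 sube0.
  apply: (ov (~` B)); first exact: measurableC.
  - apply: etrans (@probability_setC _ _ _ (K t zw.1) _ mB) _.
    by rewrite [X in 1 - X]pB subee.
  - by rewrite setCK.
(* With [delta] null the two laws coincide and [dist t zw] is already 0; the other case divides by
   [delta]. *)
have [delta0|delta_gt0] := leP delta 0%R.
  have J0 (J : {finite_measure set Z -> \bar R}) A : J setT = Jp setT -> measurable A ->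
      J A = 0.
    move=> JT mA; apply/eqP; rewrite eq_le measure_ge0 andbT.
    apply: (@le_trans _ _ (J setT)); first by rewrite le_measure ?inE.
    by rewrite JT deltaE lee_fin.
  apply/eqP; rewrite eq_le D_ge0 andbT; apply: le_trans (D_le t zw) _.
  apply: tv_distance_le; [exact: prob_kernel|exact: prob_kernel|] => A mA.
  have := decomp A mA; rewrite [X in _ = _ + X](J0 Jp A erefl mA) => dA.
  by rewrite -dA (J0 Jn A JnT mA) adde0.
have mJ : measurable [set u | r u != r zw].
  rewrite (_ : [set u | _] = r @^-1` [set~ r zw]).
    by rewrite -[X in measurable X]setTI; apply: mr => //; exact: measurableC.
  by apply/seteqP; split => u /= /eqP.
set N := [set u | r u != r zw] in mJ.
have QN : Q t zw N = 0.
  have : \int[Q t zw]_u `|((r u - r zw) ^+ 2)%:E| = 0.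
    rewrite -[RHS]dev_eq0; apply: eq_integral => u _.
    by rewrite gee0_abs// lee_fin sqr_ge0.
  move=> /ae_eq_integral_abs -/(_ measurableT) [].
    by apply/measurable_EFinP/measurable_funX/measurable_funB.
  move=> N' [mN' N'0 subN']; apply/eqP; rewrite eq_le measure_ge0 andbT -N'0.
  rewrite le_measure ?inE// => u /= ru; apply: subN' => /= /(_ Logic.I)[].
  by move=> /eqP; rewrite sqrf_eq0 subr_eq0; exact/negP.
have indN0 (zw' : Z * Z) : 0 <= (\1_N zw')%:E :> \bar R by rewrite lee_fin.
have mindN : measurable_fun setT (fun zw' => (\1_N zw')%:E : \bar R).
  by apply/measurable_EFinP.
(* [Jp] and [Jn] are below the two laws, so their product inherits the null sets of [Q t zw], one
   coordinate at a time. *)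
have JN : (Jp \x Jn) N = 0.
  apply/eqP; rewrite eq_le measure_ge0 andbT -QN.
  rewrite -[in leLHS](setIT N) -[in leRHS](setIT N) -!integral_indic//.
  rewrite integral_pairker// fubini_tonelli1// /fubini_F.
  apply: (@le_trans _ _ (\int[Jp]_z \int[K t zw.2]_w (\1_N (z, w))%:E)).
    apply: ge0_le_integral => //.
    - by move=> z _; exact: integral_ge0.
    - exact: (measurable_fun_fubini_tonelli_F (m2 := Jn) _ mindN indN0).
    - exact: (measurable_fun_fubini_tonelli_F (m2 := K t zw.2) _ mindN indN0).
    - move=> z _; apply: ge0_le_measure_integral => //.
      by apply: (measurableT_comp mindN (pair1_measurable _)).
  apply: ge0_le_measure_integral => //.
  - by move=> z; exact: integral_ge0.
  - by apply: (measurable_fun_fubini_tonelli_F (m2 := K t zw.2) _ mindN indN0).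
have JJT : (Jp \x Jn) setT = (delta * delta)%:E.
  have : (Jp \x Jn) ([set: Z] `*` [set: Z]) = (delta * delta)%:E.
    rewrite product_measure1E//= [X in _ * X]JnT.
    by rewrite deltaE -EFinM.
  by rewrite setXTT.
have JD : \int[Jp \x Jn]_u D u = (r zw * (delta * delta))%:E.
  transitivity (\int[Jp \x Jn]_u (cst (r zw)%:E) u).
    apply: ge0_ae_eq_integral => //.
      by move=> u _ /=; rewrite lee_fin.
    exists N; split => // u /= ru; apply/eqP => ruz; apply: ru => _.
    by rewrite -rE ruz.
  by rewrite integral_cst// [X in _ * X]JJT.
have X_ge0 s : 0 <= \int[Jp \x Jn]_u dist s u by exact: integral_ge0.
(* The shared part of the two laws cancels and only the Jordan parts are coupled. Both have mass
   [delta], so [coupling_le] carries this factor on both sides, and dividing by it bounds [D zw] by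
   the integral of [dist s] over [delta]. *)
have D_leX s : delta%:E * D zw <= \int[Jp \x Jn]_u dist s u.
  rewrite -lee_pdivlMl//; apply: le_trans (D_le (t + s) zw) _.
  apply: tv_distance_le; [exact: prob_kernel|exact: prob_kernel|] => A mA.
  have mk : measurable_fun setT (fun y => kiter k s y A) by exact: measurable_kernel.
  have := @coupling_le _ _ _ Jp Jn (fun y => kiter k s y A)
    (dist s) (fun=> measure_ge0 _ _) mk (dist_ge0 s) (mdist s).
  rewrite JnT deltaE -lee_pdivlMl// => couple.
  have {couple} : \int[Jp]_z kiter k s z A <=
      \int[Jn]_z kiter k s z A + (delta^-1)%:E * \int[Jp \x Jn]_u dist s u.
    apply: le_trans (couple _) _.
      by move=> z w; apply: le_tv_distance => //; exact: prob_kernel.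
    rewrite ge0_muleDr// ?mule_ge0 ?integral_ge0//.
    by rewrite muleA -EFinM mulVf ?gt_eqF// mul1e.
  have : \int[K t zw.1]_z kiter k s z A + \int[Jn]_z kiter k s z A =
      \int[K t zw.2]_z kiter k s z A + \int[Jp]_z kiter k s z A.
    rewrite -!ge0_integral_measure_add//.
    apply: eq_measure_integral => B' mB' _.
    by have := decomp _ mB'; rewrite -!measure_addE.
  have Jnfin : \int[Jn]_z kiter k s z A \is a fin_num.
    rewrite ge0_fin_numE ?integral_ge0//.
    apply: (@le_lt_trans _ _ (\int[Jn]_z (cst 1) z)).
      apply: ge0_le_integral => //.
      by move=> z _; rewrite -(@prob_kernel _ _ _ _ _ (kiter k s) z) le_measure ?inE.
    by rewrite integral_cst// mul1e [X in X < _]JnT deltaE ltry.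
  move=> h couple; rewrite kiterD// kiterD//.
  rewrite -(leeD2rE _ _ Jnfin); apply: (@le_trans _ _ (
    \int[K t zw.2]_z kiter k s z A + \int[Jp]_z kiter k s z A)).
    by rewrite -h.
  by rewrite -[leRHS]addeA; apply: leeD2l; rewrite [leRHS]addeC.
(* As [s] grows the integral tends to that of [D], which is the constant [r zw] on a product of mass
   [delta * delta]. *)
have : delta%:E * D zw <= (r zw * (delta * delta))%:E.
  rewrite -JD.
  have JJfin : (Jp \x Jn) setT < +oo by rewrite JJT ltry.
  have := @cvg_integral_dist _ _ (Jp \x Jn) id JJfin (@measurable_id _ _ _).
  move=> /cvge_to_ge; apply.
  exact: nearW.
rewrite -rE -EFinM lee_fin mulrCA ler_pM2l// => rle.
congr EFin; apply/eqP; rewrite eq_le r_ge0 andbT.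
rewrite -(@pmulr_lle0 _ (1 - delta)%R) ?subr_gt0// mulrBr mulr1 subr_le0//.
Qed.

(** By Tonelli, for almost every [z], [D (z, w)] vanishes for almost every [w]. The distance from
    the law started at [z] to [pi] is at most the mean over [w] of [dist t (z, w)], which tends to
    the mean of [D (z, w)]. *)
Lemma ergodic_of_overlap (N : set Z) : measurable N -> pi N = 0 ->
  (forall z w, ~ N z -> ~ N w -> exists t, forall A, measurable A ->
    kiter k t z A = 0 -> kiter k t w (~` A) = 0 -> False) ->
  ergodic k pi.
Proof.
move=> mN N0 ov.
have D0 : {ae pipi, forall zw, D zw = 0}.
  have N1 : (pi \x pi) (N `*` [set: Z]) = 0
    by rewrite product_measure1E// [X in X * _]N0 mul0e.
  have N2 : (pi \x pi) ([set: Z] `*` N) = 0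
    by rewrite product_measure1E// [X in _ * X]N0 mule0.
  have aeN : {ae pipi, forall zw, ~ N zw.1 /\ ~ N zw.2}.
    exists (N `*` setT `|` setT `*` N); split.
    - by apply: measurableU; exact: measurableX.
    - apply: null_set_setU => //; exact: measurableX.
    - move=> zw /= /not_andP[/contrapT|/contrapT]; by [left|right].
  (* The time of overlap depends on the pair, so the exceptional sets of all times are united
     first. *)
  have := ae_foralln dev0; apply: filterS2 aeN => zw [Nz Nw] dev_zw.
  have [t ovt] := ov _ _ Nz Nw.
  exact: (dev0_overlap (dev_zw t)).
have intD0 : {ae pi, forall z, \int[pi]_w D (z, w) = 0}.
  have mF : measurable_fun setT (fubini_F pi D).
    exact: measurable_fun_fubini_tonelli_F.
  have : \int[pi]_z `|fubini_F pi D z| = 0.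
    transitivity (\int[pi]_z fubini_F pi D z).
      by apply: eq_integral => z _; rewrite gee0_abs//; exact: integral_ge0.
    rewrite -(fubini_tonelli1 D mD D_ge0).
    rewrite (ge0_ae_eq_integral _ _ _ _ _ (_ : ae_eq pipi setT D (cst 0)))//.
      by rewrite integral0.
    by apply: filterS D0 => zw.
  move=> /ae_eq_integral_abs -/(_ measurableT mF).
  by apply: filterS => z /(_ Logic.I).
apply: filterS intD0 => z Dz0.
have mz : measurable_fun setT (fun w : Z => (z, w)) by exact: pair1_measurable.
have cvg0 : \int[pi]_w dist t (z, w) @[t --> \oo] --> 0.
  rewrite -Dz0; apply: (cvg_integral_dist _ mz).
  by rewrite [X in X < _](probability_setT pi) ltry.
apply: (squeeze_cvge _ (cvg_cst 0) cvg0); apply: nearW => t.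
rewrite tv_distance_ge0/=; apply: tv_distance_le.
- exact: prob_kernel.
- exact: probability_setT.
move=> A mA.
(* Invariance presents [pi] as the mixture of the laws at time [t] started from [w]. *)
rewrite [X in _ <= X + _](_ : _ = \int[pi]_w kiter k t w A); last first.
  exact: esym (inv_kiter t mA).
have mk : measurable_fun setT (fun w => kiter k t w A) by exact: measurable_kernel.
have md : measurable_fun setT (fun w => dist t (z, w)).
  exact: measurableT_comp (mdist t) mz.
rewrite -ge0_integralD//.
have <- : \int[pi]_w (cst (kiter k t z A)) w = kiter k t z A.
  by rewrite integral_cst// [X in _ * X](probability_setT pi) mule1.
apply: ge0_le_integral => //.
- exact: emeasurable_funD.
- by move=> w _; apply: le_tv_distance => //; exact: prob_kernel.
Qed.

End ergodic_of_overlap.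

Section uniqueness_of_limit.
Local Open Scope ereal_scope.
Context d (Z : measurableType d) (R : realType).

Lemma converges_in_tv_unique (k : R.-pker Z ~> Z) z (P Q : probability Z R) :
  converges_in_tv k z P -> converges_in_tv k z Q ->
  forall A, measurable A -> Q A = P A.
Proof.
move=> kP kQ A mA.
have cvgA (S : probability Z R) : converges_in_tv k z S ->
    kiter k t z A @[t --> \oo] --> S A.
  move=> kS; have SA : S A \is a fin_num by exact: fin_num_measure.
  suff : `|kiter k t z A - S A| @[t --> \oo] --> 0.
    by move=> /cvg_abse0P/sube_cvg0; apply.
  apply: (squeeze_cvge _ (cvg_cst 0) kS); apply: nearW => t.
  by rewrite abse_ge0/=; exact: tv_distance_ge.
exact: (cvg_unique _ (cvgA _ kQ) (cvgA _ kP)).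
Qed.

End uniqueness_of_limit.

(** * Integrals over datasets *)

Lemma measurable_section_integral d1 d2 (T1 : measurableType d1)
    (T2 : measurableType d2) (R : realType)
    (m2 : {sigma_finite_measure set T2 -> \bar R}) (f : T1 * T2 -> \bar R) :
  measurable_fun setT f -> (forall p, 0 <= f p)%E ->
  measurable_fun setT (fun x => \int[m2]_y f (x, y))%E.
Proof. by move=> mf f0; exact: measurable_fun_fubini_tonelli_F. Qed.

Section tuple_measure_integrals.
Local Open Scope ereal_scope.
Context d (X : measurableType d) (R : realType).
Variable mu : {sigma_finite_measure set X -> \bar R}.

Lemma measurable_tuple_cons2 n :
  measurable_fun setT (fun p : X * n.-tuple X => [tuple of p.1 :: p.2]).
Proof. exact: measurable_cons. Qed.

Lemma measurable_tuple_rcons2 n :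
  measurable_fun setT (fun p : n.-tuple X * X => [tuple of rcons p.1 p.2]).
Proof.
apply/measurable_fun_tnthP => j; have [jn|nj] := ltnP j n.
  apply: (eq_measurable_fun ((fun x => tnth x (Ordinal jn)) \o fst)).
    by move=> p _; rewrite /= !(tnth_nth point)/= nth_rcons size_tuple jn.
  by apply: measurableT_comp => //; exact: measurable_tnth.
apply: (eq_measurable_fun snd) => // p _; rewrite /=.
by rewrite (tnth_nth point)/= nth_rcons size_tuple ltnNge nj/= eqn_leq nj
  -ltnS ltn_ord.
Qed.

Lemma integral_tuple0 (g : 0.-tuple X -> \bar R) : measurable_fun setT g ->
  \int[tuple_measure mu 0]_x g x = g [tuple].
Proof.
move=> mg; have := integral_dirac [tuple] measurableT mg.
by rewrite diracT mul1e.
Qed.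

Lemma integral_tuple_cons n f :
  (forall x, 0 <= f x) -> measurable_fun setT f ->
  \int[tuple_measure mu n.+1]_x f x =
  \int[mu]_y \int[tuple_measure mu n]_x f [tuple of y :: x].
Proof.
move=> f0 mf.
exact: (integral_image_product (m1 := mu) (m2 := tuple_measure mu n)
  (m := tuple_measure mu n.+1) (@measurable_tuple_cons2 n)).
Qed.

(** [tuple_measure] adds records in front, while the size move adds them at the end. The head is
    peeled off, the induction hypothesis is applied to the tail, and the head is put back; the order
    of integration never changes. *)
Lemma integral_tuple_rcons n f :
  (forall x, 0 <= f x) -> measurable_fun setT f ->
  \int[tuple_measure mu n.+1]_x f x =
  \int[tuple_measure mu n]_x \int[mu]_y f [tuple of rcons x y].
Proof.
elim: n f => [|n ih] f f0 mf.
  rewrite integral_tuple_cons// [RHS]integral_tuple0; last first.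
    have mf2 := measurableT_comp mf (@measurable_tuple_rcons2 0).
    by apply: (measurable_section_integral mu mf2) => p; exact: f0.
  apply: eq_integral => y _; rewrite integral_tuple0.
    by congr f; exact: val_inj.
  apply: (measurableT_comp mf).
  exact: measurable_cons.
rewrite integral_tuple_cons//.
have mf1 y : measurable_fun setT (fun x : n.+1.-tuple X => f [tuple of y :: x]).
  apply: (measurableT_comp mf).
  exact: measurable_cons.
transitivity (\int[mu]_y \int[tuple_measure mu n]_x \int[mu]_z
    f [tuple of y :: [tuple of rcons x z]]).
  apply: eq_integral => y _.
  exact: (ih (fun x : n.+1.-tuple X => f [tuple of y :: x])).
apply/esym; apply: etrans
  (@integral_tuple_cons n (fun x => \int[mu]_z f [tuple of rcons x z]) _ _) _.
- by move=> x; apply: integral_ge0 => z _; exact: f0.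
- have mf2 := measurableT_comp mf (@measurable_tuple_rcons2 n.+1).
  by apply: (measurable_section_integral mu mf2) => p; exact: f0.
apply: eq_integral => y _.
apply: eq_integral => x _.
apply: eq_integral => z _.
by congr f; exact: val_inj.
Qed.

Definition tuple_set n (i : nat) (x : n.-tuple X) (y : X) : n.-tuple X :=
  [tuple if val j == i then y else tnth x j | j < n].

Lemma measurable_tuple_set n i :
  measurable_fun setT (fun p : n.-tuple X * X => tuple_set i p.1 p.2).
Proof.
apply/measurable_fun_tnthP => j; have [ji|ji] := eqVneq (val j) i.
  by apply: (eq_measurable_fun snd) => // p _; rewrite /= tnth_mktuple ji eqxx.
apply: (eq_measurable_fun ((fun x => tnth x j) \o fst)).
  by move=> p _; rewrite /= tnth_mktuple (negbTE ji).
by apply: measurableT_comp => //; exact: measurable_tnth.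
Qed.

Lemma tuple_set_cons0 n y (x : n.-tuple X) z :
  tuple_set 0 [tuple of y :: x] z = [tuple of z :: x].
Proof.
apply: eq_from_tnth => j; rewrite tnth_mktuple !(tnth_nth y)/=.
by case: j => -[|j] jn.
Qed.

Lemma tuple_set_consS n i y (x : n.-tuple X) z :
  tuple_set i.+1 [tuple of y :: x] z = [tuple of y :: tuple_set i x z].
Proof.
apply: eq_from_tnth; case=> -[|j] jn; rewrite tnth_mktuple !(tnth_nth y)//=.
rewrite eqSS (nth_map (Ordinal (jn : (j < n)%N))) ?size_enum_ord//.
by rewrite nth_enum_ord// (tnth_nth y) nth_enum_ord.
Qed.

(** Exchanging one coordinate with a fresh independent one preserves the product measure. This is
    the change of variables that reverses a record move. *)
Lemma integral_tuple_set n (i : 'I_n) (f : n.-tuple X * X -> \bar R) :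
  (forall p, 0 <= f p) -> measurable_fun setT f ->
  \int[tuple_measure mu n]_x \int[mu]_y f (tuple_set i x y, tnth x i) =
  \int[tuple_measure mu n]_x \int[mu]_y f (x, y).
Proof.
elim: n i f => [|n ih] i f f0 mf; first by case: i.
have mfS j : measurable_fun setT (fun p : n.+1.-tuple X * X =>
    f (tuple_set j p.1 p.2, tnth p.1 i)).
  apply: (measurableT_comp mf); apply: measurable_fun_pair.
    exact: measurable_tuple_set.
  exact: (measurableT_comp (@measurable_tnth _ _ _ i) measurable_fst).
have mfc : measurable_fun setT (fun p : (X * n.-tuple X) * X =>
    f ([tuple of p.1.1 :: p.1.2], p.2)).
  apply: (measurableT_comp mf); apply: measurable_fun_pair => //.
  apply: measurable_cons; first exact: (measurableT_comp measurable_fst measurable_fst).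
  exact: (measurableT_comp measurable_snd measurable_fst).
rewrite integral_tuple_cons; last 2 first.
- by move=> x; apply: integral_ge0 => z _; exact: f0.
- by apply: (measurable_section_integral mu (mfS i)) => p; exact: f0.
rewrite [RHS]integral_tuple_cons; last 2 first.
- by move=> x; apply: integral_ge0 => z _; exact: f0.
- by apply: (measurable_section_integral mu mf) => p; exact: f0.
(* For the head record, Tonelli first brings the old and the fresh record outside the integral over
   the tail; for the others, the induction hypothesis applies under the integral over the head. *)
have [i0|i_gt0] := posnP i.
  pose g (p : X * X) := \int[tuple_measure mu n]_x f ([tuple of p.1 :: x], p.2).
  have mg0 : measurable_fun setT (fun p : (X * X) * n.-tuple X =>
      f ([tuple of p.1.1 :: p.2], p.1.2)).
    apply: (measurableT_comp mf); apply: measurable_fun_pair; last first.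
      exact: (measurableT_comp measurable_snd measurable_fst).
    apply: measurable_cons => //.
    exact: (measurableT_comp measurable_fst measurable_fst).
  have mg : measurable_fun setT g.
    by apply: (measurable_section_integral (tuple_measure mu n) mg0) => p; exact: f0.
  have g0 p : 0 <= g p by exact: integral_ge0.
  transitivity (\int[mu]_y \int[mu]_z g (z, y)).
    apply: eq_integral => y _.
    transitivity (\int[tuple_measure mu n]_x \int[mu]_z
        f ([tuple of z :: x], y)).
      apply: eq_integral => x _; apply: eq_integral => z _.
      rewrite i0 tuple_set_cons0; congr (f (_, _)).
      by rewrite (tnth_nth y) i0.
    apply/esym; apply: (@fubini_tonelli _ _ _ _ _ mu (tuple_measure mu n)
      (fun p : X * n.-tuple X => f ([tuple of p.1 :: p.2], y))).
    - exact: (measurableT_comp mfc (pair2_measurable y)).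
    - by move=> p; exact: f0.
  transitivity (\int[mu]_z \int[mu]_y g (z, y)).
    apply: (@fubini_tonelli _ _ _ _ _ mu mu (fun p => g (p.2, p.1))).
    - by have := measurableT_comp mg (@measurable_swap _ _ X X).
    - by move=> p; exact: g0.
  apply: eq_integral => z _.
  apply: (@fubini_tonelli _ _ _ _ _ mu (tuple_measure mu n)
    (fun p : X * n.-tuple X => f ([tuple of z :: p.2], p.1))).
  - apply: (measurableT_comp mf); apply: measurable_fun_pair => //.
    exact: measurable_cons.
  - by move=> p; exact: f0.
apply: eq_integral => y _.
have ltin : (i.-1 < n)%N by rewrite -ltnS prednK// ltn_ord.
apply: etrans (ih (Ordinal ltin) (fun p => f ([tuple of y :: p.1], p.2)) _ _).
- apply: eq_integral => x _; apply: eq_integral => z _.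
  rewrite -{1}(prednK i_gt0) tuple_set_consS; congr (f (_, _)).
  by rewrite !(tnth_nth y)/= -{1}(prednK i_gt0).
- by move=> p; exact: f0.
- apply: (measurableT_comp mf); apply: measurable_fun_pair => //.
  exact: measurable_cons.
Qed.

End tuple_measure_integrals.

Section dataset_measure_integrals.
Local Open Scope ereal_scope.
Context d (X : measurableType d) (R : realType).
Variable mu : {sigma_finite_measure set X -> \bar R}.

(** A named [existT], to which the structure of a measurable function is attached, as the
    pushforwards below require. *)
Definition dataset_of m : m.+1.-tuple X -> dataset X := existT _ m.

HB.instance Definition _ m :=
  isMeasurableFun.Build _ _ _ _ (@dataset_of m) (@measurable_existT _ X m).

Lemma integral_dataset (f : dataset X -> \bar R) :
  (forall x, 0 <= f x) -> measurable_fun setT f ->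
  \int[dataset_measure mu]_x f x =
  \sum_(0 <= m <oo) \int[tuple_measure mu m.+1]_x f (existT _ m x).
Proof.
move=> f0 mf.
rewrite (eq_measure_integral (mseries (fun m =>
  pushforward (tuple_measure mu m.+1) (@dataset_of m)) 0))//.
rewrite ge0_integral_measure_series//; apply: eq_eseriesr => m _.
rewrite (integral_image (mu := tuple_measure mu m.+1) (@measurable_existT _ X m))//.
Qed.

End dataset_measure_integrals.

(** * Invariance of the posterior *)

Section metropolis_invariance.
Local Open Scope ereal_scope.
Context d (Z : measurableType d) (R : realType).
Variables (mu : {measure set Z -> \bar R}) (prop : R.-pker Z ~> Z).
Variable ratio : Z * Z -> R.
Hypothesis mratio : measurable_fun setT ratio.
Hypothesis ratio0 : forall p, (0 <= ratio p)%R.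

Local Notation alpha := (accept ratio).

Lemma accept_ge0 p : (0 <= alpha p)%R.
Proof. by rewrite /accept le_min ler01 ratio0. Qed.

Lemma accept_le1 p : (alpha p <= 1)%R.
Proof. by rewrite /accept ge_min lexx. Qed.

Lemma measurable_accept : measurable_fun setT alpha.
Proof. exact: measurable_minr. Qed.

(** Symmetry of the accepted flow from [z] to [w], tested on functions of the pair. Rejected moves
    live on the diagonal, where symmetry is automatic. *)
Definition detailed_balance := forall G : Z * Z -> \bar R,
  (forall p, 0 <= G p) -> measurable_fun setT G ->
  \int[mu]_z \int[prop z]_w ((alpha (z, w))%:E * G (z, w)) =
  \int[mu]_z \int[prop z]_w ((alpha (z, w))%:E * G (w, z)).

Lemma metropolis_invariant : detailed_balance ->
  forall g, (forall z, 0 <= g z) -> measurable_fun setT g ->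
  \int[mu]_z \int[metropolis prop mratio ratio0 z]_w g w = \int[mu]_z g z.
Proof.
move=> db g g0 mg.
have a0 p : 0 <= (alpha p)%:E by rewrite lee_fin accept_ge0.
have b0 p : 0 <= (1 - alpha p)%:E by rewrite lee_fin subr_ge0 accept_le1.
have ma : measurable_fun setT (fun p => (alpha p)%:E).
  by apply/measurable_EFinP; exact: measurable_accept.
have mb : measurable_fun setT (fun p => (1 - alpha p)%:E).
  by apply/measurable_EFinP; apply: measurable_funB => //; exact: measurable_accept.
have mg1 : measurable_fun setT (fun p : Z * Z => g p.1) by exact: measurableT_comp.
have mg2 : measurable_fun setT (fun p : Z * Z => g p.2) by exact: measurableT_comp.
have mag1 : measurable_fun setT (fun p => (alpha p)%:E * g p.1) by exact: emeasurable_funM.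
have mag2 : measurable_fun setT (fun p => (alpha p)%:E * g p.2) by exact: emeasurable_funM.
have mbg1 : measurable_fun setT (fun p => (1 - alpha p)%:E * g p.1) by exact: emeasurable_funM.
have mprop (h : Z * Z -> \bar R) : measurable_fun setT h -> (forall p, 0 <= h p) ->
    measurable_fun setT (fun z => \int[prop z]_w h (z, w)).
  by move=> mh h0; exact: measurable_fun_integral_sfinite_kernel.
have msec (h : Z * Z -> \bar R) z : measurable_fun setT h ->
    measurable_fun setT (fun w => h (z, w)).
  by move=> mh; exact: measurableT_comp (mh) (pair1_measurable z).
under eq_integral => z _.
  rewrite integral_metropolis// ge0_integralD//; first over.
  - by move=> w _; rewrite mule_ge0.
  - exact: (msec _ z mag2).
  - by move=> w _; rewrite mule_ge0.
  - exact: (msec _ z mbg1).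
rewrite ge0_integralD//; last 4 first.
- by move=> z _; apply: integral_ge0 => w _; rewrite mule_ge0.
- by apply: (mprop _ mag2) => p; rewrite mule_ge0.
- by move=> z _; apply: integral_ge0 => w _; rewrite mule_ge0.
- by apply: (mprop _ mbg1) => p; rewrite mule_ge0.
(* Balance turns [g w] into [g z] in the accepted part; together with the rejected part this is
   [g z] times the proposal mass 1. *)
rewrite (db (fun p => g p.2))// -ge0_integralD//; last 4 first.
- by move=> z _; apply: integral_ge0 => w _; rewrite mule_ge0.
- by apply: (mprop _ mag1) => p; rewrite mule_ge0.
- by move=> z _; apply: integral_ge0 => w _; rewrite mule_ge0.
- by apply: (mprop _ mbg1) => p; rewrite mule_ge0.
apply: eq_integral => z _; rewrite -ge0_integralD//; last 4 first.
- by move=> w _; rewrite mule_ge0.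
- exact: (msec _ z mag1).
- by move=> w _; rewrite mule_ge0.
- exact: (msec _ z mbg1).
transitivity (\int[prop z]_w cst (g z) w).
  apply: eq_integral => w _; rewrite -ge0_muleDl// -EFinD addrC subrK mul1e//.
by rewrite integral_cst// prob_kernel mule1.
Qed.

End metropolis_invariance.

Section model.
Local Open Scope ereal_scope.
Context (R : realType) (dT dX dS dD : measure_display)
  (Theta : measurableType dT) (X : measurableType dX) (S : measurableType dS)
  (D : measurableType dD) (V : nmodType).
Variables (M : dp_model R Theta X S D V) (s : S) (ndp : D).

Local Notation state := (state Theta X).
Implicit Types (z : state) (g : state -> \bar R).

Lemma ptheta_ge0 theta : (0 <= ptheta M theta)%R.
Proof. by case: (ptheta_density M). Qed.

Lemma px_ge0 theta x : (0 <= px M theta x)%R.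
Proof. by case: ((px_density M).2 theta). Qed.

Lemma ps_ge0 x : (0 <= ps M x s)%R.
Proof. by case: ((ps_density M).2 x). Qed.

Lemma pdp_ge0 (x : dataset X) : (0 <= pdp M (dsize x) ndp)%R.
Proof. by case: (@pdp_density _ _ _ _ _ _ _ _ _ _ M (dsize x) isT). Qed.

Lemma pn_dsize_ge0 (x : dataset X) : (0 <= pn M (dsize x))%R.
Proof. exact: pn_ge0. Qed.

Lemma likelihood_ge0 theta x : (0 <= likelihood M theta x)%R.
Proof. by apply: prodr_ge0 => i _; exact: px_ge0. Qed.

(** The factors of the joint density that do not involve the parameter. The acceptance ratio of the
    size move compares just these, times the jump probabilities. *)
Definition weight (x : dataset X) : R :=
  (pn M (dsize x) * ps M x s * pdp M (dsize x) ndp)%R.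

Lemma weight_ge0 x : (0 <= weight x)%R.
Proof. by rewrite !mulr_ge0 ?pn_dsize_ge0 ?ps_ge0 ?pdp_ge0. Qed.

Lemma joint_densityE z : joint_density M s ndp z =
  (ptheta M z.1 * (likelihood M z.1 z.2 * weight z.2))%R.
Proof. by rewrite /joint_density /weight; ring. Qed.

Lemma joint_density_ge0 z : (0 <= joint_density M s ndp z)%R.
Proof.
rewrite joint_densityE mulr_ge0 ?ptheta_ge0//.
exact: mulr_ge0 (likelihood_ge0 _ _) (weight_ge0 _).
Qed.

Lemma measurable_ptheta : measurable_fun setT (ptheta M).
Proof. by case: (ptheta_density M). Qed.

Lemma measurable_px : measurable_fun setT (fun p : Theta * X => px M p.1 p.2).
Proof. by case: (px_density M). Qed.

Lemma measurable_px1 theta : measurable_fun setT (px M theta).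
Proof. by case: ((px_density M).2 theta). Qed.

Lemma measurable_of_dsize (f : nat -> R) :
  measurable_fun setT (fun x : dataset X => f (dsize x)).
Proof.
have mf : measurable_fun setT f by [].
exact: (measurableT_comp mf (@measurable_dsize _ X)).
Qed.

Lemma measurable_ps : measurable_fun setT (ps M ^~ s).
Proof. exact: (measurable_fun_pair1 s (ps_density M).1). Qed.

Lemma measurable_weight : measurable_fun setT weight.
Proof.
apply: measurable_funM; last exact: (measurable_of_dsize (pdp M ^~ ndp)).
by apply: measurable_funM; [exact: (measurable_of_dsize (pn M))|exact: measurable_ps].
Qed.

Definition tuple_likelihood n theta (x : n.-tuple X) : R :=
  (\prod_(i < n) px M theta (tnth x i))%R.

Lemma measurable_tuple_likelihood n : measurable_fun setT
  (fun p : Theta * n.-tuple X => tuple_likelihood p.1 p.2).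
Proof.
apply: measurable_prod => i _ /=.
have mf : measurable_fun setT (fun p : Theta * n.-tuple X => (p.1, tnth p.2 i)).
  apply: measurable_fun_pair => //.
  exact: (measurableT_comp (@measurable_tnth _ _ _ i) measurable_snd).
exact: (measurableT_comp measurable_px mf).
Qed.

Lemma measurable_tuple_likelihood1 n theta :
  measurable_fun setT (fun x : n.-tuple X => tuple_likelihood theta x).
Proof.
exact: (measurableT_comp (@measurable_tuple_likelihood n) (pair1_measurable theta)).
Qed.

Lemma tuple_likelihood_ge0 n theta (x : n.-tuple X) : (0 <= tuple_likelihood theta x)%R.
Proof. by apply: prodr_ge0 => i _; exact: px_ge0. Qed.

Lemma measurable_likelihood :
  measurable_fun setT (fun z => likelihood M z.1 z.2).
Proof. by apply: measurable_dataset_pair => m; exact: measurable_tuple_likelihood. Qed.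

Lemma measurable_joint_density : measurable_fun setT (joint_density M s ndp).
Proof.
rewrite (_ : joint_density M s ndp = fun z =>
  (ptheta M z.1 * (likelihood M z.1 z.2 * weight z.2))%R); last first.
  by apply/funext => z; exact: joint_densityE.
apply: measurable_funM; first exact: (measurableT_comp measurable_ptheta).
apply: measurable_funM; first exact: measurable_likelihood.
exact: (measurableT_comp measurable_weight measurable_snd).
Qed.

Lemma tuple_likelihood_rcons n theta (x : n.-tuple X) y :
  tuple_likelihood theta [tuple of rcons x y] =
  (tuple_likelihood theta x * px M theta y)%R.
Proof.
rewrite /tuple_likelihood big_ord_recr/=; congr (_ * px M theta _)%R.
- apply: eq_bigr => i _; congr (px M theta _).
  by rewrite !(tnth_nth point)/= nth_rcons size_tuple ltn_ord.
- by rewrite (tnth_nth point)/= nth_rcons size_tuple ltnn eqxx.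
Qed.

Lemma tuple_likelihood_set n theta (x : n.-tuple X) (i : 'I_n) y :
  (tuple_likelihood theta (tuple_set i x y) * px M theta (tnth x i) =
   tuple_likelihood theta x * px M theta y)%R.
Proof.
rewrite /tuple_likelihood (bigD1 i)//= [in RHS](bigD1 i)//= tnth_mktuple eqxx.
rewrite (eq_bigr (fun j => px M theta (tnth x j))); first by ring.
by move=> j ji; rewrite tnth_mktuple ifN.
Qed.

Lemma integral_joint g : (forall z, 0 <= g z) -> measurable_fun setT g ->
  \int[joint M s ndp]_z g z = \int[muTheta M]_theta \sum_(0 <= m <oo)
    \int[tuple_measure (muX M) m.+1]_x
      ((joint_density M s ndp (theta, existT _ m x))%:E * g (theta, existT _ m x)).
Proof.
move=> g0 mg.
pose f z := (joint_density M s ndp z)%:E * g z.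
have f0 z : 0 <= f z by rewrite mule_ge0// lee_fin joint_density_ge0.
have mf : measurable_fun setT f.
  by apply: emeasurable_funM => //; apply/measurable_EFinP; exact: measurable_joint_density.
rewrite /joint integral_mdensity// (fubini_tonelli1 f mf f0).
apply: eq_integral => theta _.
apply: (integral_dataset (muX M) (f := fun x => f (theta, x))) => //.
exact: measurableT_comp (mf) (pair1_measurable theta).
Qed.

End model.

(** The symmetric form of a Metropolis acceptance. When [a] is 0 both sides vanish, whatever the
    quotient by 0 is. *)
Lemma mul_min1_div (R : realType) (a b : R) : 0 <= a -> 0 <= b ->
  a * Num.min 1 (b / a) = Num.min a b.
Proof.
move=> a0 b0; have [->|a_neq0] := eqVneq a 0; first by rewrite mul0r min_l.
by rewrite minr_pMr// mulr1 mulrC divfK.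
Qed.

Section record_balance.
Local Open Scope ereal_scope.
Context (R : realType) (dT dX dS dD : measure_display)
  (Theta : measurableType dT) (X : measurableType dX) (S : measurableType dS)
  (D : measurableType dD) (V : nmodType).
Variables (M : dp_model R Theta X S D V) (s : S) (ndp : D).

Local Notation state := (state Theta X).

Lemma integral_new_record (z : state) (h : X -> \bar R) :
  (forall y, 0 <= h y) -> measurable_fun setT h ->
  \int[new_record M z]_y h y = \int[muX M]_y ((px M z.1 y)%:E * h y).
Proof. by move=> h0 mh; exact: integral_mdensity. Qed.

Lemma measurable_set_record i : measurable_fun setT
  (fun p : state * X => (p.1.1, dreplace i p.1.2 p.2) : state).
Proof.
apply: measurable_fun_pair.
  exact: (measurableT_comp measurable_fst measurable_fst).
have mf : measurable_fun setT (fun p : state * X => (p.2, p.1.2)).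
  apply: measurable_fun_pair => //.
  exact: (measurableT_comp measurable_snd measurable_fst).
exact: (measurableT_comp (@measurable_dreplace _ X i) mf).
Qed.

Lemma integral_record_proposal i (z : state) (g : state -> \bar R) :
  (forall w, 0 <= g w) -> measurable_fun setT g ->
  \int[record_proposal M i z]_w g w =
  \int[muX M]_y ((px M z.1 y)%:E * g (z.1, dreplace i z.2 y)).
Proof.
move=> g0 mg; rewrite /record_proposal integral_kbind//.
have mg1 : measurable_fun setT (fun y => g (z.1, dreplace i z.2 y)).
  have := measurableT_comp mg (@measurable_set_record i).
  by move=> mg2; exact: (measurableT_comp mg2 (pair1_measurable z)).
rewrite -integral_new_record//.
by apply: eq_integral => y _; rewrite integral_kdirac.
Qed.

Lemma measurable_record_ratio : measurable_fun setT (record_ratio M s (Theta := Theta)).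
Proof.
have mps := measurable_ps M s.
apply: measurable_funM.
  apply: (measurableT_comp mps).
  exact: (measurableT_comp measurable_snd measurable_snd).
apply: (measurableT_comp (@measurable_invr R)); apply: (measurableT_comp mps).
exact: (measurableT_comp measurable_snd measurable_fst).
Qed.

Lemma tuple_set_set n (i : 'I_n) (x : n.-tuple X) y :
  tuple_set i (tuple_set i x y) (tnth x i) = x.
Proof.
apply: eq_from_tnth => j; rewrite !tnth_mktuple.
by case: eqP => [/val_inj ->|].
Qed.

Lemma tuple_set_out n i (x : n.-tuple X) y : (n <= i)%N -> tuple_set i x y = x.
Proof.
move=> ni; apply: eq_from_tnth => j; rewrite tnth_mktuple ltn_eqF//.
exact: leq_trans (ltn_ord j) ni.
Qed.

(** Both flows are written as integrals over the dataset and the proposed record, and exchanging the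
    old record with the proposed one maps one integrand to the other. *)
Lemma record_balance i :
  detailed_balance (joint M s ndp) (record_proposal M i) (record_ratio M s).
Proof.
move=> G G0 mG.
have ratio0 p : (0 <= record_ratio M s p)%R by rewrite divr_ge0 ?ps_ge0.
have ma : measurable_fun setT (fun p => (accept (record_ratio M s) p)%:E).
  apply/measurable_EFinP; apply: measurable_accept.
  exact: measurable_record_ratio.
have a0 p : 0 <= (accept (record_ratio M s) p)%:E by rewrite lee_fin accept_ge0.
pose Gt (p : state * state) := G (p.2, p.1).
have mGt : measurable_fun setT Gt.
  by have := measurableT_comp mG (@measurable_swap _ _ state state).
have key (H : state * state -> \bar R) : (forall p, 0 <= H p) -> measurable_fun setT H ->
  \int[joint M s ndp]_z \int[record_proposal M i z]_w
    ((accept (record_ratio M s) (z, w))%:E * H (z, w)) =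
  \int[muTheta M]_theta \sum_(0 <= m <oo)
    \int[tuple_measure (muX M) m.+1]_x \int[muX M]_y
      ((joint_density M s ndp (theta, existT _ m x) * px M theta y *
        accept (record_ratio M s)
          ((theta, existT _ m x), (theta, existT _ m (tuple_set i x y))))%:E *
       H ((theta, existT _ m x), (theta, existT _ m (tuple_set i x y)))).
  move=> H0 mH.
  have mH1 : measurable_fun setT (fun p => (accept (record_ratio M s) p)%:E * H p).
    exact: emeasurable_funM.
  rewrite integral_joint; last 2 first.
  - by move=> z; apply: integral_ge0 => w _; rewrite mule_ge0.
  - apply: (measurable_fun_integral_sfinite_kernel
      (fun p => (accept (record_ratio M s) p)%:E * H p)) => // p.
    by rewrite mule_ge0.
  apply: eq_integral => theta _; apply: eq_eseriesr => m _.
  apply: eq_integral => x _.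
  rewrite integral_record_proposal; last 2 first.
  - by move=> w; rewrite mule_ge0.
  - exact: (measurableT_comp mH1 (pair1_measurable _)).
  rewrite -ge0_integralZl_EFin//=; last 3 first.
  - by move=> y _; rewrite !mule_ge0// lee_fin px_ge0.
  - apply: emeasurable_funM.
      by apply/measurable_EFinP; exact: measurable_px1.
    have := measurableT_comp mH1 (pair1_measurable (theta, existT _ m x : dataset X)).
    move=> mH2; apply: (measurableT_comp mH2).
    exact: (measurableT_comp (@measurable_set_record i)
      (pair1_measurable (theta, existT _ m x : dataset X))).
  - exact: joint_density_ge0.
  by apply: eq_integral => y _; rewrite !EFinM -!muleA.
apply: etrans (key G G0 mG) _.
apply: etrans _ (esym (key Gt (fun p => G0 _) mGt)).
apply: eq_integral => theta _; apply: eq_eseriesr => m _.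
(* A move of index beyond the last record proposes the current dataset, so the two sides are
   identical. *)
have [im|mi] := ltnP i m.+1; last first.
  by apply: eq_integral => x _; apply: eq_integral => y _; rewrite /Gt/= tuple_set_out.
pose i' := Ordinal im.
pose move_ (p : m.+1.-tuple X * X) : state * state :=
  ((theta, existT _ m p.1), (theta, existT _ m (tuple_set i p.1 p.2))).
have mmove : measurable_fun setT move_.
  apply: measurable_fun_pair; apply: measurable_fun_pair => //.
    exact: (measurableT_comp (@measurable_existT _ X m) measurable_fst).
  exact: (measurableT_comp (@measurable_existT _ X m) (@measurable_tuple_set _ X m.+1 i)).
pose F (p : m.+1.-tuple X * X) := (joint_density M s ndp (theta, existT _ m p.1) *
  px M theta p.2 * accept (record_ratio M s) (move_ p))%:E * G (move_ p).
have F0 p : 0 <= F p.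
  rewrite mule_ge0// lee_fin mulr_ge0 ?accept_ge0//.
  exact: mulr_ge0 (joint_density_ge0 _ _ _ _) (px_ge0 _ _ _).
have mF : measurable_fun setT F.
  apply: emeasurable_funM; last exact: (measurableT_comp mG mmove).
  apply/measurable_EFinP; apply: measurable_funM; last first.
    have mae : measurable_fun setT (accept (record_ratio M s (Theta := Theta))).
      by apply: measurable_accept; exact: measurable_record_ratio.
    exact: (measurableT_comp mae mmove).
  apply: measurable_funM; last first.
    exact: (measurableT_comp (measurable_px1 M theta) measurable_snd).
  apply: (measurableT_comp (measurable_joint_density M s ndp)).
  apply: measurable_fun_pair => //.
  exact: (measurableT_comp (@measurable_existT _ X m) measurable_fst).
(* After the exchange, the likelihood factors agree by [like_set] and the acceptance factors by the
   symmetry of [Num.min]. *)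
rewrite -(integral_tuple_set (muX M) i' F0 mF).
apply: eq_integral => x _; apply: eq_integral => y _.
rewrite /F /Gt /move_/=.
have -> : tuple_set i (tuple_set i x y) (tnth x i') = x by exact: (tuple_set_set i').
congr (_%:E * _).
have like_set := tuple_likelihood_set M theta x i' y.
pose c := (ptheta M theta * pn M m.+1 * pdp M m.+1 ndp)%R.
pose a := ps M (existT _ m x) s; pose b := ps M (existT _ m (tuple_set i x y)) s.
have jdE x' : joint_density M s ndp (theta, existT _ m x') =
    (ptheta M theta * pn M m.+1 * tuple_likelihood M theta x' *
     ps M (existT _ m x') s * pdp M m.+1 ndp)%R by [].
transitivity (c * (tuple_likelihood M theta (tuple_set i x y) * px M theta (tnth x i')) *
    (b * Num.min 1 (a / b)))%R.
  by rewrite jdE -/b [accept _ _](_ : _ = Num.min 1 (a / b))%R// /c; ring.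
rewrite like_set mul_min1_div ?ps_ge0// minC -mul_min1_div ?ps_ge0//.
by rewrite jdE -/a [accept _ _](_ : _ = Num.min 1 (b / a))%R// /c; ring.
Qed.

End record_balance.

Section sweep_invariance.
Local Open Scope ereal_scope.
Context (R : realType) (dT dX dS dD : measure_display)
  (Theta : measurableType dT) (X : measurableType dX) (S : measurableType dS)
  (D : measurableType dD) (V : nmodType).
Variables (M : dp_model R Theta X S D V) (s : S) (ndp : D).

Local Notation state := (state Theta X).
Local Notation J := (joint M s ndp).
Implicit Types (z : state) (g : state -> \bar R).

Definition size_set n : set state := [set z | dsize z.2 = n].

Lemma measurable_size_set n : measurable (size_set n).
Proof.
have mds : measurable_fun setT (fun z : state => dsize z.2).
  exact: (measurableT_comp (@measurable_dsize _ X) measurable_snd).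
by rewrite -[size_set n]setTI; exact: (mds measurableT [set n]).
Qed.

Lemma bigcup_size_set : \bigcup_m size_set m.+1 = setT.
Proof. by apply/seteqP; split => // -[theta [m x]] _; exists m. Qed.

Lemma trivIset_size_set : trivIset setT (fun m => size_set m.+1).
Proof.
apply/trivIsetP => i j _ _ ij; apply/seteqP; split => // z [].
by rewrite /size_set/= => -> [/eqP]; rewrite (negbTE ij).
Qed.

Lemma integral_size_set (mu : {measure set state -> \bar R}) g :
  (forall z, 0 <= g z) -> measurable_fun setT g ->
  \int[mu]_z g z = \sum_(0 <= m <oo) \int[mu]_(z in size_set m.+1) g z.
Proof.
move=> g0 mg; rewrite -bigcup_size_set ge0_integral_bigcup//.
- by move=> m; exact: measurable_size_set.
- by rewrite bigcup_size_set.
- exact: trivIset_size_set.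
Qed.

(** Replacing a record keeps the size, so the values of the integrand at other sizes are never
    seen. *)
Lemma integral_record_update_eq k z g1 g2 :
  (forall w, 0 <= g1 w) -> measurable_fun setT g1 ->
  (forall w, 0 <= g2 w) -> measurable_fun setT g2 ->
  (forall w, dsize w.2 = dsize z.2 -> g1 w = g2 w) ->
  \int[record_update M s k z]_w g1 w = \int[record_update M s k z]_w g2 w.
Proof.
move=> g10 mg1 g20 mg2 g12.
have int_record g : (forall w, 0 <= g w) -> measurable_fun setT g ->
  \int[record_update M s k z]_w g w = \int[muX M]_y ((px M z.1 y)%:E *
    ((accept (record_ratio M s) (z, (z.1, dreplace k z.2 y)))%:E *
      g (z.1, dreplace k z.2 y) +
     (1 - accept (record_ratio M s) (z, (z.1, dreplace k z.2 y)))%:E * g z)).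
  move=> g0 mg; rewrite /record_update integral_metropolis//.
  have ratio0 p : (0 <= record_ratio M s p)%R by rewrite divr_ge0 ?ps_ge0.
  have ma : measurable_fun setT (fun w => accept (record_ratio M s) (z, w)).
    have := measurable_accept (measurable_record_ratio M s).
    by move=> /measurableT_comp; apply; exact: pair1_measurable.
  rewrite integral_record_proposal//.
  - move=> w; rewrite adde_ge0// mule_ge0// lee_fin ?accept_ge0//.
    by rewrite subr_ge0 accept_le1.
  - apply: emeasurable_funD; apply: emeasurable_funM => //.
      exact/measurable_EFinP.
    by apply/measurable_EFinP; exact: measurable_funB.
rewrite !int_record//; apply: eq_integral => y _.
by rewrite (g12 z)// (g12 (_, dreplace _ _ _)).
Qed.

Lemma integral_records_update_eq k z g1 g2 :
  (forall w, 0 <= g1 w) -> measurable_fun setT g1 ->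
  (forall w, 0 <= g2 w) -> measurable_fun setT g2 ->
  (forall w, dsize w.2 = dsize z.2 -> g1 w = g2 w) ->
  \int[records_update M s k z]_w g1 w = \int[records_update M s k z]_w g2 w.
Proof.
elim: k g1 g2 => [|k ih] g1 g2 g10 mg1 g20 mg2 g12.
  by rewrite !integral_kdirac//; exact: g12.
rewrite [records_update M s k.+1]/= !integral_kthen//; apply: ih.
- by move=> w; exact: integral_ge0.
- exact: measurable_integral_kernel.
- by move=> w; exact: integral_ge0.
- exact: measurable_integral_kernel.
- move=> w wz; apply: integral_record_update_eq => // w' w'w.
  by apply: g12; rewrite w'w.
Qed.

Lemma records_update_invariant k g : (forall z, 0 <= g z) -> measurable_fun setT g ->
  \int[J]_z \int[records_update M s k z]_w g w = \int[J]_z g z.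
Proof.
elim: k g => [|k ih] g g0 mg.
  by apply: eq_integral => z _; rewrite integral_kdirac.
rewrite [records_update M s k.+1]/=.
under eq_integral do rewrite integral_kthen//.
rewrite ih.
- exact: (metropolis_invariant _ _ (record_balance M s ndp k) g0 mg).
- by move=> w; exact: integral_ge0.
- exact: measurable_integral_kernel.
Qed.

(** The number of record moves depends on the state, so the sweep is not a composition of fixed
    kernels. On size [m.+1] it is [records_update m.+1], which leaves [J] invariant on the whole
    space and keeps the size; restricting the integrand to one size at a time and summing gives the
    result. *)
Lemma sweep_invariant g : (forall z, 0 <= g z) -> measurable_fun setT g ->
  \int[J]_z \int[sweep M s z]_w g w = \int[J]_z g z.
Proof.
move=> g0 mg; rewrite integral_size_set//; last 2 first.
- by move=> z; exact: integral_ge0.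
- exact: measurable_integral_kernel.
rewrite [RHS]integral_size_set//; apply: eq_eseriesr => m _.
have g0' z : 0 <= (g \_ (size_set m.+1)) z by rewrite erestrict_ge0.
have mg' : measurable_fun setT (g \_ (size_set m.+1)).
  apply/(measurable_restrictT _ (measurable_size_set m.+1)).
  exact: measurable_funS mg.
rewrite [RHS]integral_mkcond.
apply: etrans _ (records_update_invariant m.+1 g0' mg').
rewrite [LHS]integral_mkcond; apply: eq_integral => z _; rewrite patchE.
case: ifPn => [/set_mem zm|/negP zm].
  rewrite /sweep zm; apply: integral_records_update_eq => // w wz.
  by rewrite patchE ifT// inE /size_set/= wz.
transitivity (\int[records_update M s m.+1 z]_w cst 0 w).
  by rewrite integral0.
apply: integral_records_update_eq => // w wz.
rewrite patchE ifF//; apply/negP => /set_mem; rewrite /size_set/= wz => zm'.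
by apply: zm; rewrite inE.
Qed.

End sweep_invariance.

Section theta_invariance.
Local Open Scope ereal_scope.
Context (R : realType) (dT dX dS dD : measure_display)
  (Theta : measurableType dT) (X : measurableType dX) (S : measurableType dS)
  (D : measurableType dD) (V : nmodType).
Variables (M : dp_model R Theta X S D V) (s : S) (ndp : D).
Hypothesis px_bounded : bounded_density (fun p : Theta * X => px M p.1 p.2).

Local Notation state := (state Theta X).
Local Notation J := (joint M s ndp).
Implicit Types (z : state) (g : state -> \bar R).

(** The marginal density of the records given their number, which is the normalizing constant of the
    full conditional. *)
Definition evidence (x : dataset X) : \bar R :=
  \int[muTheta M]_theta (ptheta M theta * likelihood M theta x)%:E.

Lemma measurable_full_conditional_density x :
  measurable_fun setT (fun theta => ptheta M theta * likelihood M theta x)%R.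
Proof.
apply: measurable_funM; first exact: measurable_ptheta.
exact: (measurableT_comp (measurable_likelihood M) (pair2_measurable x)).
Qed.

Lemma full_conditional_density_ge0 x theta :
  (0 <= ptheta M theta * likelihood M theta x)%R.
Proof. exact: mulr_ge0 (ptheta_ge0 _ _) (likelihood_ge0 _ _ _). Qed.

Lemma evidence_ge0 x : 0 <= evidence x.
Proof.
by apply: integral_ge0 => theta _; rewrite lee_fin full_conditional_density_ge0.
Qed.

(** A bound [C] on [px] bounds the likelihood of [n] records by [C ^+ n], and the prior integrates
    to 1. Hence the normalization never meets an infinite mass. *)
Lemma evidence_lty x : evidence x < +oo.
Proof.
have [C Cpx] := px_bounded.
have C0 : (0 <= C)%R.
  exact: le_trans (px_ge0 M point point) (Cpx (point, point)).
apply: (@le_lt_trans _ _ (\int[muTheta M]_theta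
    ((C ^+ dsize x)%:E * (ptheta M theta)%:E))).
  apply: ge0_le_integral => //.
  - by move=> theta _; rewrite lee_fin full_conditional_density_ge0.
  - by apply/measurable_EFinP; exact: measurable_full_conditional_density.
  - by apply: measurable_funeM; apply/measurable_EFinP; exact: measurable_ptheta.
  - move=> theta _; rewrite -EFinM lee_fin mulrC ler_wpM2r ?ptheta_ge0//.
    rewrite /likelihood -[X in (_ <= _ ^+ X)%R]card_ord -prodr_const.
    by apply: ler_prod => i _; rewrite px_ge0 (Cpx (theta, _)).
rewrite ge0_integralZl_EFin//.
- by case: (ptheta_density M) => _ _ ->; rewrite mule1 ltry.
- by move=> theta _; rewrite lee_fin ptheta_ge0.
- by apply/measurable_EFinP; exact: measurable_ptheta.
- exact: exprn_ge0.
Qed.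

(** The product form covers datasets of zero evidence as well: there [full_conditional] is the
    default Dirac measure, but both sides are 0. *)
Lemma evidence_full_conditional z (h : Theta -> \bar R) :
  (forall theta, 0 <= h theta) -> measurable_fun setT h ->
  evidence z.2 * \int[full_conditional M z]_theta h theta =
  \int[muTheta M]_theta ((ptheta M theta * likelihood M theta z.2)%:E * h theta).
Proof.
move=> h0 mh.
pose nu : {measure set Theta -> \bar R} := mdensity (muTheta M)
  (measurable_full_conditional_density z.2) (full_conditional_density_ge0 z.2).
have nuT : nu setT = evidence z.2 by [].
rewrite -[RHS](integral_mdensity _ (measurable_full_conditional_density z.2)
  (full_conditional_density_ge0 z.2))//.
have [ev0|ev_neq0] := eqVneq (evidence z.2) 0.
  rewrite ev0 mul0e; apply/esym/eqP; rewrite eq_le integral_ge0// andbT.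
  rewrite (eq_measure_integral mzero) ?integral_measure_zero// => A mA _.
  apply/eqP; rewrite eq_le measure_ge0 andbT -[leRHS]ev0 -nuT.
  by rewrite le_measure ?inE.
have ev_gt0 : 0 < evidence z.2 by rewrite lt_neqAle eq_sym ev_neq0 evidence_ge0.
have evE : evidence z.2 = (fine (evidence z.2))%:E.
  by rewrite fineK// ge0_fin_numE ?evidence_ge0 ?evidence_lty.
have fev_gt0 : (0 < fine (evidence z.2))%R by rewrite -lte_fin -evE.
have c0 : (0 <= (fine (evidence z.2))^-1)%R by rewrite invr_ge0 ltW.
rewrite (eq_measure_integral (mscale (NngNum c0) nu)); last first.
  move=> A mA _.
  have -> : full_conditional M z A = mnormalize nu point A by [].
  rewrite /mnormalize /mscale/= nuT (negbTE ev_neq0) (lt_eqF (evidence_lty _))/=.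
  by rewrite muleC.
rewrite ge0_integral_mscale//= muleA [X in X * _](_ : _ = 1) ?mul1e//.
by rewrite {1}evE -EFinM divff// gt_eqF.
Qed.

Lemma integral_theta_update z g : (forall z, 0 <= g z) -> measurable_fun setT g ->
  \int[theta_update M z]_w g w = \int[full_conditional M z]_theta g (theta, z.2).
Proof.
move=> g0 mg; rewrite /theta_update integral_kbind//.
by apply: eq_integral => theta _; rewrite integral_kdirac.
Qed.

Lemma theta_update_invariant g : (forall z, 0 <= g z) -> measurable_fun setT g ->
  \int[J]_z \int[theta_update M z]_w g w = \int[J]_z g z.
Proof.
move=> g0 mg.
have mjd := measurable_joint_density M s ndp.
pose h z := \int[theta_update M z]_w g w.
have h0 z : 0 <= h z by exact: integral_ge0.
have mh : measurable_fun setT h by exact: measurable_integral_kernel.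
have evh z : evidence z.2 * h z = \int[muTheta M]_theta
    ((ptheta M theta * likelihood M theta z.2)%:E * g (theta, z.2)).
  rewrite /h integral_theta_update// evidence_full_conditional//.
  exact: measurableT_comp mg (pair2_measurable _).
have intJ f : (forall z, 0 <= f z) -> measurable_fun setT f ->
    \int[J]_z f z = \int[dataset_measure (muX M)]_x \int[muTheta M]_theta
      ((joint_density M s ndp (theta, x))%:E * f (theta, x)).
  move=> f0 mf; rewrite /joint integral_mdensity//.
  apply: (fubini_tonelli2 (fun z => (joint_density M s ndp z)%:E * f z)).
    by apply: emeasurable_funM => //; exact/measurable_EFinP.
  by move=> z; rewrite mule_ge0// lee_fin joint_density_ge0.
apply: etrans (intJ h h0 mh) _; apply: etrans _ (esym (intJ g g0 mg)).
apply: eq_integral => x _.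
(* The update forgets the old parameter, so [h] leaves the integral over [theta]; [point] stands for
   any parameter. *)
have hx theta : h (theta, x) = h (point, x).
  by rewrite /h !integral_theta_update.
have mF := measurable_full_conditional_density x.
have fact f : measurable_fun setT f -> (forall z, 0 <= f z) ->
  \int[muTheta M]_theta ((joint_density M s ndp (theta, x))%:E * f (theta, x)) =
  (weight M s ndp x)%:E * \int[muTheta M]_theta
    ((ptheta M theta * likelihood M theta x)%:E * f (theta, x)).
  move=> mf f0; rewrite -ge0_integralZl_EFin ?weight_ge0//; last 2 first.
  - by move=> theta _; rewrite mule_ge0// lee_fin full_conditional_density_ge0.
  - apply: emeasurable_funM; first exact/measurable_EFinP.
    exact: measurableT_comp mf (pair2_measurable _).
  apply: eq_integral => theta _; rewrite joint_densityE muleA -EFinM.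
  by congr (_%:E * _); rewrite /=; ring.
rewrite (fact h mh h0) (fact g mg g0); congr (_ * _).
apply: etrans _ (evh (point, x)).
under eq_integral do rewrite hx muleC.
rewrite ge0_integralZl//; last 2 first.
- exact/measurable_EFinP.
- by move=> theta _; rewrite lee_fin full_conditional_density_ge0.
by rewrite muleC.
Qed.

End theta_invariance.

Section size_balance.
Local Open Scope ereal_scope.
Context (R : realType) (dT dX dS dD : measure_display)
  (Theta : measurableType dT) (X : measurableType dX) (S : measurableType dS)
  (D : measurableType dD) (V : nmodType).
Variables (M : dp_model R Theta X S D V) (s : S) (ndp : D).

Local Notation state := (state Theta X).
Local Notation J := (joint M s ndp).
Local Notation jump := (@jump R).
Implicit Types (z : state) (g : state -> \bar R).

Lemma jump_ge0 n n' : (0 <= jump n n')%R.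
Proof. by rewrite /jump; do 2?case: ifPn => _; rewrite ?invr_ge0. Qed.

Lemma jump_up_ge m : (2^-1 <= jump m.+1 m.+2)%R.
Proof.
rewrite /jump; case: ifPn => [/eqP[->]|m0]; first by rewrite eqxx invf_le1// ler1n.
by rewrite eqxx/= andbT ltnS lt0n ifT.
Qed.

Lemma jump_down m : jump m.+2 m.+1 = 2^-1%R.
Proof. by rewrite /jump/= eqxx orbT. Qed.

Lemma jump_down1 : jump 1 0 = 0%R. Proof. by rewrite /jump. Qed.

Lemma measurable_jump2 d (T : measurableType d) (x0 x1 : T -> dataset X) :
  measurable_fun setT x0 -> measurable_fun setT x1 ->
  measurable_fun setT (fun p => jump (dsize (x0 p)) (dsize (x1 p))).
Proof.
move=> mx0 mx1.
have mj : measurable_fun setT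
    (fun y : dataset X * dataset X => jump (dsize y.1) (dsize y.2)).
  apply: measurable_dataset_pair => m /=.
  exact: (measurableT_comp (measurable_of_dsize (jump ^~ m.+1)) measurable_fst).
exact: (measurableT_comp mj (measurable_fun_pair mx0 mx1)).
Qed.

Lemma measurable_grow : measurable_fun setT
  (fun p : state * X => (p.1.1, dadd p.1.2 p.2) : state).
Proof.
apply: measurable_fun_pair.
  exact: (measurableT_comp measurable_fst measurable_fst).
have mf : measurable_fun setT (fun p : state * X => (p.2, p.1.2)).
  apply: measurable_fun_pair => //.
  exact: (measurableT_comp measurable_snd measurable_fst).
exact: (measurableT_comp (@measurable_dadd _ X) mf).
Qed.

Lemma measurable_shrink : measurable_fun setT (fun z => (z.1, dremove z.2) : state).
Proof.
apply: measurable_fun_pair => //.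
exact: (measurableT_comp (@measurable_dremove _ X) measurable_snd).
Qed.

Lemma integral_size_proposal z g : (forall w, 0 <= g w) -> measurable_fun setT g ->
  \int[size_proposal M z]_w g w =
  (jump (dsize z.2) (dsize z.2).+1)%:E *
    \int[muX M]_y ((px M z.1 y)%:E * g (z.1, dadd z.2 y)) +
  (jump (dsize z.2) (dsize z.2).-1)%:E * g (z.1, dremove z.2).
Proof.
move=> g0 mg; rewrite /size_proposal integral_kmix//; congr (_ * _ + _ * _).
  have mg1 : measurable_fun setT (fun y => g (z.1, dadd z.2 y)).
    have mg2 := measurableT_comp mg measurable_grow.
    exact: (measurableT_comp mg2 (pair1_measurable z)).
  rewrite /grow integral_kbind// -integral_new_record//.
  by apply: eq_integral => y _; rewrite integral_kdirac.
by rewrite /shrink integral_kdirac.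
Qed.

Lemma size_ratioE (p : state * state) : size_ratio M s ndp p =
  ((weight M s ndp p.2.2 * jump (dsize p.2.2) (dsize p.1.2)) /
   (weight M s ndp p.1.2 * jump (dsize p.1.2) (dsize p.2.2)))%R.
Proof. by []. Qed.

Lemma size_ratio_ge0 (p : state * state) : (0 <= size_ratio M s ndp p)%R.
Proof. by rewrite size_ratioE divr_ge0// mulr_ge0 ?weight_ge0 ?jump_ge0. Qed.

Lemma measurable_size_ratio :
  measurable_fun setT (size_ratio M s ndp : state * state -> R).
Proof.
have m1 : measurable_fun setT (fun p : state * state => p.1.2).
  exact: (measurableT_comp measurable_snd measurable_fst).
have m2 : measurable_fun setT (fun p : state * state => p.2.2).
  exact: (measurableT_comp measurable_snd measurable_snd).
have mw := measurable_weight M s ndp.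
apply: measurable_funM.
  apply: measurable_funM; last exact: measurable_jump2.
  exact: (measurableT_comp mw m2).
apply: (measurableT_comp (@measurable_invr R)).
apply: measurable_funM; last exact: measurable_jump2.
exact: (measurableT_comp mw m1).
Qed.

Local Notation alpha := (accept (size_ratio M s ndp)).

Lemma measurable_size_accept :
  measurable_fun setT (fun p : state * state => alpha p).
Proof. by apply: measurable_accept; exact: measurable_size_ratio. Qed.

Lemma size_accept_ge0 (p : state * state) : (0 <= alpha p)%R.
Proof. by apply: accept_ge0; exact: size_ratio_ge0. Qed.

Lemma weight_accept (z w : state) :
  (weight M s ndp z.2 * jump (dsize z.2) (dsize w.2) * alpha (z, w) =
   weight M s ndp w.2 * jump (dsize w.2) (dsize z.2) * alpha (w, z))%R.
Proof.
have w0 (x y : dataset X) : (0 <= weight M s ndp x * jump (dsize x) (dsize y))%R.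
  by rewrite mulr_ge0 ?weight_ge0 ?jump_ge0.
by rewrite /accept !size_ratioE !mul_min1_div ?w0// minC.
Qed.

Lemma dremove_rcons m (x : m.+1.-tuple X) y :
  dremove (existT _ m.+1 [tuple of rcons x y] : dataset X) = existT _ m x.
Proof.
rewrite /dremove/=; congr existT; apply: eq_from_tnth => i; rewrite tnth_mktuple.
by rewrite !(tnth_nth point)/= nth_rcons size_tuple ltn_ord.
Qed.

Lemma measurable_state theta m :
  measurable_fun setT (fun x : m.+1.-tuple X => (theta, existT _ m x) : state).
Proof. by apply: measurable_fun_pair => //; exact: measurable_existT. Qed.

Let up_rate theta m (x : m.+1.-tuple X) (y : X) : R :=
  (joint_density M s ndp (theta, existT _ m x) * jump m.+1 m.+2 * px M theta y *
   alpha ((theta, existT _ m x), (theta, existT _ m.+1 [tuple of rcons x y])))%R.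

Let down_rate theta m (x : m.+1.-tuple X) : R :=
  (joint_density M s ndp (theta, existT _ m x) * jump m.+1 m *
   alpha ((theta, existT _ m x), (theta, dremove (existT _ m x))))%R.

Let up_rate_ge0 theta m (x : m.+1.-tuple X) y : (0 <= up_rate theta x y)%R.
Proof.
apply: mulr_ge0 (size_accept_ge0 _); apply: mulr_ge0 (px_ge0 _ _ _).
exact: mulr_ge0 (joint_density_ge0 _ _ _ _) (jump_ge0 _ _).
Qed.

Let down_rate_ge0 theta m (x : m.+1.-tuple X) : (0 <= down_rate theta x)%R.
Proof.
apply: mulr_ge0 (size_accept_ge0 _).
exact: mulr_ge0 (joint_density_ge0 _ _ _ _) (jump_ge0 _ _).
Qed.

(** The density of the proposed record is exactly the likelihood factor gained by the larger
    dataset, so what remains to be balanced is [weight] times [jump]. *)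
Let down_up_rate theta m (x : m.+1.-tuple X) y :
  down_rate theta [tuple of rcons x y] = up_rate theta x y.
Proof.
rewrite /down_rate /up_rate dremove_rcons !joint_densityE/=.
rewrite [likelihood _ _ (existT _ m.+1 _)](_ : _ =
  (tuple_likelihood M theta x * px M theta y)%R); last first.
  exact: tuple_likelihood_rcons.
rewrite [likelihood _ _ (existT _ m _)](_ : _ = tuple_likelihood M theta x)//.
have := weight_accept (theta, existT _ m.+1 [tuple of rcons x y]) (theta, existT _ m x).
rewrite /= => wa.
transitivity (ptheta M theta * tuple_likelihood M theta x * px M theta y *
  (weight M s ndp (existT _ m.+1 [tuple of rcons x y]) * jump m.+2 m.+1 *
   alpha ((theta, existT _ m.+1 [tuple of rcons x y]), (theta, existT _ m x))))%R.
  by ring.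
by rewrite wa; ring.
Qed.

Let up_flow theta m (H : state * state -> \bar R) :=
  \int[tuple_measure (muX M) m.+1]_x \int[muX M]_y ((up_rate theta x y)%:E *
    H ((theta, existT _ m x), (theta, existT _ m.+1 [tuple of rcons x y]))).

Let down_flow theta m (H : state * state -> \bar R) :=
  \int[tuple_measure (muX M) m.+1]_x ((down_rate theta x)%:E *
    H ((theta, existT _ m x), (theta, dremove (existT _ m x)))).

Let mup theta m (H : state * state -> \bar R) : measurable_fun setT H ->
  measurable_fun setT (fun p : m.+1.-tuple X * X => (up_rate theta p.1 p.2)%:E *
    H ((theta, existT _ m p.1), (theta, existT _ m.+1 [tuple of rcons p.1 p.2]))).
Proof.
move=> mH.
have mst1 : measurable_fun setT
    (fun p : m.+1.-tuple X * X => (theta, existT _ m p.1) : state).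
  apply: measurable_fun_pair => //.
  exact: (measurableT_comp (@measurable_existT _ X m) measurable_fst).
have mst2 : measurable_fun setT (fun p : m.+1.-tuple X * X =>
    (theta, existT _ m.+1 [tuple of rcons p.1 p.2]) : state).
  apply: measurable_fun_pair => //.
  exact: (measurableT_comp (@measurable_existT _ X m.+1)
    (@measurable_tuple_rcons2 _ X m.+1)).
have mst := measurable_fun_pair mst1 mst2.
apply: emeasurable_funM; last exact: (measurableT_comp mH mst).
apply/measurable_EFinP; apply: measurable_funM; last first.
  exact: (measurableT_comp measurable_size_accept mst).
apply: measurable_funM; last first.
  exact: (measurableT_comp (measurable_px1 M theta) measurable_snd).
apply: measurable_funM => //.
exact: (measurableT_comp (measurable_joint_density M s ndp) mst1).
Qed.

Let mdown theta m (H : state * state -> \bar R) : measurable_fun setT H ->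
  measurable_fun setT (fun x : m.+1.-tuple X => (down_rate theta x)%:E *
    H ((theta, existT _ m x), (theta, dremove (existT _ m x)))).
Proof.
move=> mH; have mst1 := @measurable_state theta m.
have mst2 := measurableT_comp measurable_shrink mst1.
have mst := measurable_fun_pair mst1 mst2.
apply: emeasurable_funM; last exact: (measurableT_comp mH mst).
apply/measurable_EFinP; apply: measurable_funM; last first.
  exact: (measurableT_comp measurable_size_accept mst).
apply: measurable_funM => //.
exact: (measurableT_comp (measurable_joint_density M s ndp) mst1).
Qed.

(* the moves from size [m.+2] down to [m.+1] are the reverses of the moves up
   from [m.+1] *)
Let down_flowS theta m H : (forall p, 0 <= H p) -> measurable_fun setT H ->
  down_flow theta m.+1 H = up_flow theta m (fun p => H (p.2, p.1)).
Proof.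
move=> H0 mH; rewrite /down_flow integral_tuple_rcons; last 2 first.
- by move=> x; rewrite mule_ge0// lee_fin.
- exact: mdown.
apply: eq_integral => x _; apply: eq_integral => y _.
by rewrite down_up_rate dremove_rcons.
Qed.

Let down_flow0 theta H : down_flow theta 0 H = 0.
Proof.
by apply: integral0_eq => x _; rewrite /down_rate jump_down1 mulr0 mul0r mul0e.
Qed.

(** The right-hand side only changes the order of its two summands when [H] and [Ht] are exchanged,
    which is detailed balance. [Ht] is given by a pointwise equation so that the lemma applies in
    both directions. *)
Let integral_flow H Ht : (forall p, Ht p = H (p.2, p.1)) ->
  (forall p, 0 <= H p) -> measurable_fun setT H ->
  \int[J]_z \int[size_proposal M z]_w ((alpha (z, w))%:E * H (z, w)) =
  \int[muTheta M]_theta (\sum_(0 <= m <oo) up_flow theta m H +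
                         \sum_(0 <= m <oo) up_flow theta m Ht).
Proof.
move=> HtE H0 mH; have {HtE} -> : Ht = fun p => H (p.2, p.1) by exact/funext.
have mH1 : measurable_fun setT (fun p : state * state => (alpha p)%:E * H p).
  by apply: emeasurable_funM => //; apply/measurable_EFinP; exact: measurable_size_accept.
have H10 p : 0 <= (alpha p)%:E * H p by rewrite mule_ge0// lee_fin size_accept_ge0.
rewrite integral_joint; last 2 first.
- by move=> z; apply: integral_ge0 => w _.
- exact: (measurable_fun_integral_sfinite_kernel (fun p => (alpha p)%:E * H p)).
have up0 theta m : 0 <= up_flow theta m H.
  by apply: integral_ge0 => x _; apply: integral_ge0 => y _; rewrite mule_ge0// lee_fin.
have down0 theta m : 0 <= down_flow theta m H.
  by apply: integral_ge0 => x _; rewrite mule_ge0// lee_fin.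
apply: eq_integral => theta _.
transitivity (\sum_(0 <= m <oo) (up_flow theta m H + down_flow theta m H)); last first.
  rewrite nneseriesD//; congr (_ + _).
  (* Size 1 has no downward flow, so the downward sum starts one index later and then matches the
     upward flows term by term. This also disposes of [dremove] being the identity on size 1. *)
  rewrite nneseries_recl// down_flow0 add0e.
  rewrite -(@nneseries_addn _ _ 1%N)//.
  by apply: eq_eseriesr => m _; rewrite addn1 down_flowS.
apply: eq_eseriesr => m _.
rewrite /up_flow /down_flow -ge0_integralD//; last 4 first.
- by move=> x _; apply: integral_ge0 => y _; rewrite mule_ge0// lee_fin.
- apply: (measurable_section_integral (muX M) (@mup theta m _ mH)).
  by move=> p; rewrite mule_ge0// lee_fin.
- by move=> x _; rewrite mule_ge0// lee_fin.
- exact: mdown.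
apply: eq_integral => x _.
rewrite integral_size_proposal//; last first.
  exact: (measurableT_comp mH1 (pair1_measurable _)).
have msec : measurable_fun setT (fun y => (px M theta y)%:E *
    ((alpha ((theta, existT _ m x), (theta, existT _ m.+1 [tuple of rcons x y])))%:E *
     H ((theta, existT _ m x), (theta, existT _ m.+1 [tuple of rcons x y])))).
  apply: emeasurable_funM; first by apply/measurable_EFinP; exact: measurable_px1.
  apply: (measurableT_comp mH1); apply: measurable_fun_pair => //.
  apply: measurable_fun_pair => //.
  apply: (measurableT_comp (@measurable_existT _ X m.+1)).
  exact: (measurableT_comp (@measurable_tuple_rcons2 _ X m.+1) (pair1_measurable x)).
have sec0 y : 0 <= (px M theta y)%:E *
    ((alpha ((theta, existT _ m x), (theta, existT _ m.+1 [tuple of rcons x y])))%:E *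
     H ((theta, existT _ m x), (theta, existT _ m.+1 [tuple of rcons x y]))).
  by rewrite mule_ge0// lee_fin px_ge0.
have jd0 : 0 <= (joint_density M s ndp (theta, existT _ m x))%:E.
  by rewrite lee_fin joint_density_ge0.
rewrite ge0_muleDr; last 2 first.
- by rewrite mule_ge0 ?lee_fin ?jump_ge0//; apply: integral_ge0 => y _; exact: sec0.
- by rewrite mule_ge0 ?lee_fin ?jump_ge0.
congr (_ + _); last first.
  by rewrite !muleA -!EFinM.
rewrite muleA -EFinM -ge0_integralZl_EFin//; last first.
  exact: mulr_ge0 (joint_density_ge0 _ _ _ _) (jump_ge0 _ _).
by apply: eq_integral => y _; rewrite !muleA -!EFinM.
Qed.

Lemma size_balance : detailed_balance J (size_proposal M) (size_ratio M s ndp).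
Proof.
move=> G G0 mG.
pose Gt (p : state * state) := G (p.2, p.1).
have mGt : measurable_fun setT Gt.
  by have := measurableT_comp mG (@measurable_swap _ _ state state).
have GtK p : G p = Gt (p.2, p.1) by case: p.
apply: etrans (@integral_flow G Gt (fun=> erefl) G0 mG) _.
apply: etrans _ (esym (integral_flow GtK (fun p => G0 _) mGt)).
apply: eq_integral => theta _; exact: addeC.
Qed.

End size_balance.

(** * Null sets of the algorithm *)

(** Absolute continuity is handled in this form throughout: a vanishing integral makes [f] vanish
    almost everywhere, and then so does [g]. *)
Lemma integral_null_transfer d (T : measurableType d) (R : realType)
    (mu : {measure set T -> \bar R}) (f g : T -> \bar R) :
  (forall x, 0 <= f x)%E -> measurable_fun setT f ->
  (forall x, 0 <= g x)%E -> measurable_fun setT g ->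
  (forall x, f x = 0 -> g x = 0)%E ->
  (\int[mu]_x f x = 0 -> \int[mu]_x g x = 0)%E.
Proof.
move=> f0 mf g0 mg fg intf.
have /(ae_eq_integral_abs mu measurableT mf) aef : (\int[mu]_x `|f x| = 0)%E.
  by rewrite -[RHS]intf; apply: eq_integral => x _; rewrite gee0_abs.
have /(ae_eq_integral_abs mu measurableT mg) : ae_eq mu setT g (cst 0%E).
  by apply: filterS aef => x fx _; apply: fg; exact: fx.
by move=> intg; rewrite -[RHS]intg; apply: eq_integral => x _; rewrite gee0_abs.
Qed.

Section sweep_overlap.
Local Open Scope ereal_scope.
Context (R : realType) (dT dX dS dD : measure_display)
  (Theta : measurableType dT) (X : measurableType dX) (S : measurableType dS)
  (D : measurableType dD) (V : nmodType).
Variables (M : dp_model R Theta X S D V) (s : S) (ndp : D).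
Hypothesis ps_gt0 : forall x, (0 < ps M x s)%R.

Local Notation state := (state Theta X).
Local Notation J := (joint M s ndp).
Implicit Types (z : state) (g : state -> \bar R).

(** The dataset in the course of a sweep from [x], once the first [k] records have been replaced by
    [y]. *)
Definition overwrite m k (x : m.-tuple X) (y : k.-tuple X) : m.-tuple X :=
  [tuple nth (tnth x i) y i | i < m].

Lemma overwrite0 m (x : m.-tuple X) (y : 0.-tuple X) : overwrite x y = x.
Proof.
by apply: eq_from_tnth => i; rewrite tnth_mktuple nth_default// size_tuple.
Qed.

Lemma overwrite_full m (x y : m.-tuple X) : overwrite x y = y.
Proof. by apply: eq_from_tnth => i; rewrite tnth_mktuple -tnth_nth. Qed.

Lemma dreplace_overwrite m k (x : m.+1.-tuple X) (y : k.-tuple X) t :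
  dreplace k (existT _ m (overwrite x y)) t =
  existT _ m (overwrite x [tuple of rcons y t]).
Proof.
rewrite /dreplace/=; congr existT; apply: eq_from_tnth => i.
rewrite !tnth_mktuple /record_of/= tnth_mktuple nth_rcons size_tuple.
have [->|ik] := eqVneq (val i) k; first by rewrite ltnn.
by case: ltnP => // ki; rewrite nth_default// size_tuple.
Qed.

Lemma measurable_overwrite m k (x : m.-tuple X) :
  measurable_fun setT (@overwrite m k x).
Proof.
apply/measurable_fun_tnthP => i.
have [ik|ki] := ltnP i k.
  apply: (eq_measurable_fun (fun y => tnth y (Ordinal ik))).
    by move=> y _; rewrite /= tnth_mktuple (tnth_nth (tnth x i)).
  exact: measurable_tnth.
apply: (eq_measurable_fun (cst (tnth x i))) => // y _.
by rewrite /= tnth_mktuple nth_default// size_tuple.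
Qed.

Let measurable_overwrite_state theta m k (x : m.+1.-tuple X) :
  measurable_fun setT (fun y : k.-tuple X => (theta, existT _ m (overwrite x y)) : state).
Proof.
apply: measurable_fun_pair => //.
exact: (measurableT_comp (@measurable_existT _ X m) (@measurable_overwrite _ _ x)).
Qed.

(** As [ps] is positive at [s], every proposal is accepted with positive probability, so what the
    move does not charge, the bare proposal does not charge either. *)
Lemma record_update_null k z g : (forall w, 0 <= g w) -> measurable_fun setT g ->
  \int[record_update M s k z]_w g w = 0 ->
  \int[muX M]_y ((px M z.1 y)%:E * g (z.1, dreplace k z.2 y)) = 0.
Proof.
move=> g0 mg.
have ratio0 p : (0 <= record_ratio M s p)%R by rewrite divr_ge0 ?ps_ge0.
have acc_gt0 p : (0 < accept (record_ratio M s) p)%R.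
  by rewrite /accept lt_min ltr01 divr_gt0.
have ma : measurable_fun setT (fun w => accept (record_ratio M s) (z, w)).
  have := measurable_accept (measurable_record_ratio M s).
  by move=> /measurableT_comp; apply; exact: pair1_measurable.
pose h w := (accept (record_ratio M s) (z, w))%:E * g w +
            (1 - accept (record_ratio M s) (z, w))%:E * g z.
have b0 w : 0 <= (1 - accept (record_ratio M s) (z, w))%:E * g z.
  by rewrite mule_ge0// lee_fin subr_ge0 accept_le1.
have h0 w : 0 <= h w by rewrite adde_ge0// mule_ge0// lee_fin ltW.
have mh : measurable_fun setT h.
  apply: emeasurable_funD; apply: emeasurable_funM => //.
    exact/measurable_EFinP.
  by apply/measurable_EFinP; exact: measurable_funB.
have hg w : h w = 0 -> g w = 0.
  move=> hw; have /eqP : (accept (record_ratio M s) (z, w))%:E * g w = 0.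
    apply/eqP; rewrite eq_le -[X in _ <= X]hw leeDl//=.
    by rewrite mule_ge0// lee_fin ltW.
  by rewrite mule_eq0 eqe gt_eqF//= => /eqP.
have mset f : measurable_fun setT f ->
    measurable_fun setT (fun y => (px M z.1 y)%:E * f (z.1, dreplace k z.2 y)).
  move=> mf; apply: emeasurable_funM.
    by apply/measurable_EFinP; exact: measurable_px1.
  have mf1 := measurableT_comp mf (@measurable_set_record _ _ Theta X k).
  exact: (measurableT_comp mf1 (pair1_measurable z)).
rewrite /record_update integral_metropolis// integral_record_proposal//.
apply: integral_null_transfer.
- by move=> y; apply: mule_ge0 (h0 _); rewrite lee_fin px_ge0.
- exact: (mset h mh).
- by move=> y; rewrite mule_ge0// lee_fin px_ge0.
- exact: mset.
- move=> y /eqP; rewrite mule_eq0 => /orP[/eqP ->|/eqP/hg ->].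
    by rewrite mul0e.
  by rewrite mule0.
Qed.

(** Dropping the acceptance probabilities one record at a time leaves [k] independent draws from
    [px M theta]. For [k] equal to the size, the initial dataset is forgotten. *)
Lemma records_update_null theta m (x : m.+1.-tuple X) k g :
  (forall w, 0 <= g w) -> measurable_fun setT g ->
  \int[records_update M s k (theta, existT _ m x)]_w g w = 0 ->
  \int[tuple_measure (muX M) k]_y
    ((tuple_likelihood M theta y)%:E * g (theta, existT _ m (overwrite x y))) = 0.
Proof.
elim: k g => [|k ih] g g0 mg.
  rewrite integral_kdirac// integral_tuple0 => [gx|].
    by rewrite overwrite0 gx mule0.
  apply: emeasurable_funM; first by apply/measurable_EFinP; exact: measurable_tuple_likelihood1.
  exact: (measurableT_comp mg (@measurable_overwrite_state theta m _ x)).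
rewrite [records_update M s k.+1]/= integral_kthen// => /ih.
have h0 w : 0 <= \int[record_update M s k w]_v g v by exact: integral_ge0.
have mh := measurable_integral_kernel (record_update M s k) g0 mg.
move=> /(_ h0 mh).
have mf : measurable_fun setT (fun y : k.+1.-tuple X =>
    (tuple_likelihood M theta y)%:E * g (theta, existT _ m (overwrite x y))).
  apply: emeasurable_funM; first by apply/measurable_EFinP; exact: measurable_tuple_likelihood1.
  exact: (measurableT_comp mg (@measurable_overwrite_state theta m _ x)).
have f0 (y : k.+1.-tuple X) : 0 <=
    (tuple_likelihood M theta y)%:E * g (theta, existT _ m (overwrite x y)).
  by rewrite mule_ge0// lee_fin tuple_likelihood_ge0.
rewrite integral_tuple_rcons//.
have mf2 := measurableT_comp mf (@measurable_tuple_rcons2 _ X k).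
apply: integral_null_transfer.
- by move=> y; rewrite mule_ge0// lee_fin tuple_likelihood_ge0.
- apply: emeasurable_funM; first by apply/measurable_EFinP; exact: measurable_tuple_likelihood1.
  exact: (measurableT_comp mh (@measurable_overwrite_state theta m _ x)).
- by move=> y; exact: integral_ge0.
- exact: (measurable_section_integral (muX M) mf2 (fun=> f0 _)).
move=> y /eqP; rewrite mule_eq0 => /orP[/eqP ly|/eqP/record_update_null -/(_ g0 mg) gy].
  by apply: integral0_eq => t _; rewrite tuple_likelihood_rcons EFinM ly !mul0e.
transitivity (\int[muX M]_t ((tuple_likelihood M theta y)%:E * ((px M theta t)%:E *
    g (theta, dreplace k (existT _ m (overwrite x y)) t)))).
  apply: eq_integral => t _.
  by rewrite dreplace_overwrite tuple_likelihood_rcons EFinM muleA.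
rewrite ge0_integralZl_EFin ?tuple_likelihood_ge0//.
- by rewrite [X in _ * X]gy mule0.
- by move=> t _; rewrite mule_ge0// lee_fin px_ge0.
- apply: emeasurable_funM; first by apply/measurable_EFinP; exact: measurable_px1.
  have mg1 := measurableT_comp mg (@measurable_set_record _ _ Theta X k).
  exact: (measurableT_comp mg1
    (pair1_measurable (theta, existT _ m (overwrite x y) : dataset X))).
Qed.

Lemma sweep_null theta m (x : m.+1.-tuple X) g :
  (forall w, 0 <= g w) -> measurable_fun setT g ->
  \int[sweep M s (theta, existT _ m x)]_w g w = 0 ->
  \int[tuple_measure (muX M) m.+1]_y
    ((tuple_likelihood M theta y)%:E * g (theta, existT _ m y)) = 0.
Proof.
move=> g0 mg; rewrite /sweep => /(records_update_null g0 mg).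
by under eq_integral do rewrite overwrite_full.
Qed.

End sweep_overlap.

Section size_classes.
Local Open Scope ereal_scope.
Context (R : realType) (dT dX dS dD : measure_display)
  (Theta : measurableType dT) (X : measurableType dX) (S : measurableType dS)
  (D : measurableType dD) (V : nmodType).
Variables (M : dp_model R Theta X S D V) (s : S) (ndp : D).

Local Notation state := (state Theta X).
Local Notation J := (joint M s ndp).
Implicit Types (z : state) (g : state -> \bar R).

Lemma integral_joint_size m g : (forall z, 0 <= g z) -> measurable_fun setT g ->
  \int[J]_(z in size_set m.+1) g z =
  \int[muTheta M]_theta \int[tuple_measure (muX M) m.+1]_x
    ((joint_density M s ndp (theta, existT _ m x))%:E * g (theta, existT _ m x)).
Proof.
move=> g0 mg; rewrite integral_mkcond.
have g0' z : 0 <= (g \_ (size_set m.+1)) z by rewrite erestrict_ge0.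
have mg' : measurable_fun setT (g \_ (size_set m.+1)).
  apply/(measurable_restrictT _ (measurable_size_set m.+1)).
  exact: measurable_funS mg.
rewrite integral_joint//; apply: eq_integral => theta _.
have term0 k : 0 <= \int[tuple_measure (muX M) k.+1]_x
    ((joint_density M s ndp (theta, existT _ k x))%:E *
     (g \_ (size_set m.+1)) (theta, existT _ k x)).
  by apply: integral_ge0 => x _; apply: mule_ge0 (g0' _); rewrite lee_fin joint_density_ge0.
rewrite (nneseriesD1 (n := m))// eseries0 ?adde0.
  by apply: eq_integral => x _; rewrite patchE ifT// inE.
move=> k _ /= km; apply: integral0_eq => x _.
rewrite patchE ifF ?mule0//; apply/negP => /set_mem; rewrite /size_set/= => -[].
by move/eqP; rewrite (negbTE km).
Qed.

Lemma integral_tuple_likelihood n theta :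
  \int[tuple_measure (muX M) n]_x (tuple_likelihood M theta x)%:E = 1.
Proof.
have mL k : measurable_fun setT (fun x : k.-tuple X => (tuple_likelihood M theta x)%:E).
  apply/measurable_EFinP.
  exact: measurable_tuple_likelihood1.
elim: n => [|n ih].
  by rewrite integral_tuple0// /tuple_likelihood big_ord0.
have L0 k (x : k.-tuple X) : 0 <= (tuple_likelihood M theta x)%:E.
  by rewrite lee_fin tuple_likelihood_ge0.
rewrite integral_tuple_rcons//; last exact: mL.
rewrite -[RHS]ih; apply: eq_integral => x _.
under eq_integral do rewrite tuple_likelihood_rcons EFinM.
rewrite ge0_integralZl_EFin ?tuple_likelihood_ge0//.
- by case: ((px_density M).2 theta) => _ _ ->; rewrite mule1.
- by move=> y _; rewrite lee_fin px_ge0.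
- by apply/measurable_EFinP; exact: measurable_px1.
Qed.

Hypothesis ps_gt0 : forall x, (0 < ps M x s)%R.
Hypothesis pdp_gt0 : forall n, (0 < n)%N -> (0 < pdp M n ndp)%R.

Lemma weight_gt0 x : (0 < weight M s ndp x)%R = (0 < pn M (dsize x))%R.
Proof. by rewrite /weight pmulr_lgt0 ?pdp_gt0// pmulr_lgt0. Qed.

Lemma joint_density_gt0_pn z :
  (0 < joint_density M s ndp z)%R -> (0 < pn M (dsize z.2))%R.
Proof.
rewrite joint_densityE lt0r 2!mulf_eq0 !negb_or => /andP[/and3P[_ _ w0] _].
by rewrite -weight_gt0 lt0r w0 weight_ge0.
Qed.

Lemma joint_density_gt0_likelihood z :
  (0 < joint_density M s ndp z)%R -> (0 < likelihood M z.1 z.2)%R.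
Proof.
rewrite joint_densityE lt0r 2!mulf_eq0 !negb_or => /andP[/and3P[_ l0 _] _].
by rewrite lt0r l0 likelihood_ge0.
Qed.

Lemma measurable_joint_density_tuple m : measurable_fun setT
  (fun p : Theta * m.+1.-tuple X => joint_density M s ndp (p.1, existT _ m p.2)).
Proof.
have mst : measurable_fun setT
    (fun p : Theta * m.+1.-tuple X => (p.1, existT _ m p.2) : state).
  apply: measurable_fun_pair => //.
  exact: (measurableT_comp (@measurable_existT _ X m) measurable_snd).
exact: (measurableT_comp (measurable_joint_density M s ndp) mst).
Qed.

(** For each [theta] the likelihood integrates to 1 and [weight] is positive, so a null size would
    force the prior of [theta] to integrate to 0. *)
Lemma joint_size_gt0 m : (0 < pn M m.+1)%R -> 0 < J (size_set m.+1).
Proof.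
move=> pn0; rewrite lt_neqAle measure_ge0 andbT eq_sym; apply/negP => /eqP Jm0.
have mjd := @measurable_joint_density_tuple m.
have ptheta0 : \int[muTheta M]_theta (ptheta M theta)%:E = 0.
  move: Jm0; rewrite -[J _]mul1e -integral_cst; last exact: measurable_size_set.
  rewrite (@integral_joint_size m (cst 1))//.
  apply: integral_null_transfer.
  - move=> theta; apply: integral_ge0 => x _.
    by rewrite mule_ge0// lee_fin joint_density_ge0.
  - have mjd1 : measurable_fun setT (fun p : Theta * m.+1.-tuple X =>
        (joint_density M s ndp (p.1, existT _ m p.2))%:E * 1).
      by apply: emeasurable_funM => //; exact/measurable_EFinP.
    apply: (measurable_section_integral (tuple_measure (muX M) m.+1) mjd1) => p.
    by rewrite mule_ge0// lee_fin joint_density_ge0.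
  - by move=> theta; rewrite lee_fin ptheta_ge0.
  - by apply/measurable_EFinP; exact: measurable_ptheta.
  move=> theta intjd.
  have mL : measurable_fun setT
      (fun x : m.+1.-tuple X => (tuple_likelihood M theta x)%:E).
    apply/measurable_EFinP.
    exact: measurable_tuple_likelihood1.
  have : \int[tuple_measure (muX M) m.+1]_x
      ((ptheta M theta)%:E * (tuple_likelihood M theta x)%:E) = 0.
    move: intjd; apply: integral_null_transfer.
    - by move=> x; rewrite mule_ge0// lee_fin joint_density_ge0.
    - apply: emeasurable_funM => //; apply/measurable_EFinP.
      exact: (measurableT_comp mjd (pair1_measurable theta)).
    - by move=> x; rewrite mule_ge0// lee_fin ?ptheta_ge0 ?tuple_likelihood_ge0.
    - exact: emeasurable_funM.
    move=> x; rewrite mule1 joint_densityE => -[] /eqP.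
    rewrite mulrA mulf_eq0 [X in _ || X]gt_eqF; last by rewrite weight_gt0.
    by rewrite orbF => /eqP tl0; rewrite -EFinM [X in X%:E]tl0.
  rewrite ge0_integralZl_EFin ?ptheta_ge0// ?integral_tuple_likelihood ?mule1//.
  by move=> x _; rewrite lee_fin tuple_likelihood_ge0.
have := ptheta_density M; case=> _ _; rewrite ptheta0 => /eqP.
by rewrite eq_sym onee_eq0.
Qed.

Hypothesis px_bounded : bounded_density (fun p : Theta * X => px M p.1 p.2).
Hypothesis px_support : forall theta theta',
  density_support (px M theta) = density_support (px M theta').

Lemma likelihood_gt0 theta theta' x :
  (0 < likelihood M theta x)%R -> (0 < likelihood M theta' x)%R.
Proof.
rewrite lt0r => /andP[/prodf_neq0 l0 _]; apply: prodr_gt0 => i _.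
have : density_support (px M theta) (record_of i).
  by rewrite /density_support/= lt0r l0// px_ge0.
by rewrite (px_support theta theta').
Qed.

(** The first two moves forget everything about [z] but its size: its records have positive
    likelihood under every parameter, so the new parameter is charged wherever the prior is, and the
    sweep redraws all records. If the whole step avoids [A], the size move must therefore avoid [A]
    from [J]-almost every state of that size. *)
Lemma step_null z A : (0 < joint_density M s ndp z)%R -> measurable A ->
  rjmcmc_step M s ndp z A = 0 ->
  \int[J]_(v in size_set (dsize z.2)) size_update M s ndp v A = 0.
Proof.
move=> jd0 mA; pose f v := size_update M s ndp v A.
have f0 v : 0 <= f v by exact: measure_ge0.
have mf : measurable_fun setT f by exact: measurable_kernel.
have -> : rjmcmc_step M s ndp z A = \int[kthen (theta_update M) (sweep M s) z]_v f v.
  by [].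
rewrite integral_kthen//.
have h0 w : 0 <= \int[sweep M s w]_v f v by exact: integral_ge0.
have mh := measurable_integral_kernel (sweep M s) f0 mf.
rewrite integral_theta_update// => fc0.
(* Multiplication by the evidence replaces the full conditional by its unnormalized density, without
   any division. *)
have ptheta_null : \int[muTheta M]_theta ((ptheta M theta * likelihood M theta z.2)%:E *
    \int[sweep M s (theta, z.2)]_v f v) = 0.
  rewrite -(evidence_full_conditional px_bounded z (h := fun theta =>
    \int[sweep M s (theta, z.2)]_v f v))//.
    by rewrite fc0 mule0.
  exact: (measurableT_comp mh (pair2_measurable z.2)).
case: z jd0 {fc0} ptheta_null => theta0 [m x] jd0 /=.
rewrite [dsize _]/= integral_joint_size//.
have mst : measurable_fun setT
    (fun p : Theta * m.+1.-tuple X => (p.1, existT _ m p.2) : state).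
  apply: measurable_fun_pair => //.
  exact: (measurableT_comp (@measurable_existT _ X m) measurable_snd).
have mjf : measurable_fun setT (fun p : Theta * m.+1.-tuple X =>
    (joint_density M s ndp (p.1, existT _ m p.2))%:E * f (p.1, existT _ m p.2)).
  apply: emeasurable_funM; last exact: (measurableT_comp mf mst).
  by apply/measurable_EFinP; exact: measurable_joint_density_tuple.
have jf0 (p : Theta * m.+1.-tuple X) : 0 <=
    (joint_density M s ndp (p.1, existT _ m p.2))%:E * f (p.1, existT _ m p.2).
  by apply: mule_ge0 (f0 _); rewrite lee_fin joint_density_ge0.
apply: integral_null_transfer.
- by move=> theta; apply: mule_ge0 (h0 _); rewrite lee_fin full_conditional_density_ge0.
- apply: emeasurable_funM.
    by apply/measurable_EFinP; exact: measurable_full_conditional_density.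
  exact: (measurableT_comp mh (pair2_measurable (existT _ m x : dataset X))).
- by move=> theta; apply: integral_ge0 => y _; exact: (jf0 (theta, y)).
- exact: (measurable_section_integral (tuple_measure (muX M) m.+1) mjf jf0).
(* The likelihood of [x] is positive at [theta0], hence at every [theta]; only the prior or the
   sweep integral can vanish. *)
move=> theta /eqP; rewrite mule_eq0 eqe mulf_eq0 [X in _ || X || _]gt_eqF; last first.
  exact: likelihood_gt0 (joint_density_gt0_likelihood jd0).
rewrite orbF => /orP[/eqP pt0|/eqP/(sweep_null ps_gt0 f0 mf)].
  by apply: integral0_eq => y _; rewrite joint_densityE/= pt0 mul0r mul0e.
apply: integral_null_transfer.
- by move=> y; apply: mule_ge0 (f0 _); rewrite lee_fin tuple_likelihood_ge0.
- apply: emeasurable_funM.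
    apply/measurable_EFinP.
    exact: measurable_tuple_likelihood1.
  exact: (measurableT_comp mf (@measurable_state _ _ Theta X theta m)).
- by move=> y; exact: (jf0 (theta, y)).
- exact: (measurableT_comp mjf (pair1_measurable theta)).
move=> y /eqP; rewrite mule_eq0 => /orP[/eqP[tl0]|/eqP fy]; last by rewrite [X in _ * X]fy mule0.
rewrite joint_densityE/= [likelihood _ _ _](_ : _ = tuple_likelihood M theta y)//.
by rewrite tl0 mul0r mulr0 mul0e.
Qed.

End size_classes.

(** * Flows and rejections of the size move *)

Section size_overlap.
Local Open Scope ereal_scope.
Context (R : realType) (dT dX dS dD : measure_display)
  (Theta : measurableType dT) (X : measurableType dX) (S : measurableType dS)
  (D : measurableType dD) (V : nmodType).
Variables (M : dp_model R Theta X S D V) (s : S) (ndp : D).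
Hypothesis ps_gt0 : forall x, (0 < ps M x s)%R.
Hypothesis pdp_gt0 : forall n, (0 < n)%N -> (0 < pdp M n ndp)%R.

Local Notation state := (state Theta X).
Local Notation J := (joint M s ndp).
Local Notation jump := (@jump R).
Local Notation alpha := (accept (size_ratio M s ndp)).
Implicit Types (v w z : state) (A B : set state) (g : state -> \bar R).

(** The arguments are indices of [dataset]: the sizes are [m.+1] and [n.+1]. *)
Definition adjacent (m n : nat) := (n == m.+1) || (m == n.+1).

Lemma adjacentC m n : adjacent m n = adjacent n m.
Proof. by rewrite /adjacent orbC. Qed.

Lemma jump_gt0 m n : adjacent m n -> (0 < jump m.+1 n.+1)%R.
Proof.
case/orP => /eqP ->; first by apply: lt_le_trans (jump_up_ge _ _); rewrite invr_gt0.
by rewrite jump_down invr_gt0.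
Qed.

Lemma size_accept_gt0 m n v w : adjacent m n ->
  dsize v.2 = m.+1 -> dsize w.2 = n.+1 -> (0 < pn M m.+1)%R -> (0 < pn M n.+1)%R ->
  (0 < alpha (v, w))%R.
Proof.
move=> mn vm wn pm pn'; rewrite /accept lt_min ltr01/= size_ratioE/=.
have nm : adjacent n m by rewrite adjacentC.
by apply: divr_gt0; apply: mulr_gt0; rewrite ?weight_gt0 ?vm ?wn// jump_gt0.
Qed.

Let malpha : measurable_fun setT (fun p : state * state => (alpha p)%:E).
Proof. by apply/measurable_EFinP; exact: measurable_size_accept. Qed.

Let alpha0 (p : state * state) : 0 <= (alpha p)%:E.
Proof. by rewrite lee_fin size_accept_ge0. Qed.

Let reject0 (p : state * state) : 0 <= (1 - alpha p)%:E.
Proof. by rewrite lee_fin subr_ge0 accept_le1. Qed.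

Let mreject : measurable_fun setT (fun p : state * state => (1 - alpha p)%:E).
Proof.
by apply/measurable_EFinP; apply: measurable_funB => //; exact: measurable_size_accept.
Qed.

Let ind A z : \bar R := (\1_A z)%:E.

Let ind0 A z : 0 <= ind A z. Proof. by rewrite lee_fin. Qed.

Let mind A : measurable A -> measurable_fun setT (ind A).
Proof. by move=> mA; apply/measurable_EFinP; exact: measurable_indic. Qed.

Let indT A z : A z -> ind A z = 1. Proof. by move=> Az; rewrite /ind indicE mem_set. Qed.

Let indF A z : ~ A z -> ind A z = 0. Proof. by move=> Az; rewrite /ind indicE memNset. Qed.

Let msection (H : state * state -> \bar R) v : measurable_fun setT H ->
  measurable_fun setT (fun w => H (v, w)).
Proof. by move=> mH; exact: measurableT_comp mH (pair1_measurable v). Qed.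

Definition rejection v : \bar R := \int[size_proposal M v]_w (1 - alpha (v, w))%:E.

Lemma rejection_ge0 v : 0 <= rejection v.
Proof. by apply: integral_ge0. Qed.

Lemma measurable_rejection : measurable_fun setT rejection.
Proof.
exact: (measurable_fun_integral_sfinite_kernel
  (fun p : state * state => (1 - alpha p)%:E)).
Qed.

Let size_updateE v A : measurable A -> size_update M s ndp v A =
  \int[size_proposal M v]_w ((alpha (v, w))%:E * ind A w) + rejection v * ind A v.
Proof.
move=> mA; rewrite -[in LHS](setIT A) -integral_indic//.
rewrite /size_update integral_metropolis//; last exact: mind.
have mB : measurable_fun setT (fun w => (1 - alpha (v, w))%:E).
  exact: (msection v mreject).
rewrite ge0_integralD//; last 4 first.
- by move=> w _; exact: mule_ge0.
- by apply: emeasurable_funM; [exact: (msection v malpha)|exact: mind].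
- by move=> w _; exact: mule_ge0.
- exact: emeasurable_funM.
by congr (_ + _); rewrite ge0_integralZr// /ind lee_fin.
Qed.

Let size_proposal_accept_gt0 m n v : adjacent m n -> dsize v.2 = m.+1 ->
  (0 < pn M m.+1)%R -> (0 < pn M n.+1)%R ->
  \int[size_proposal M v]_w ((alpha (v, w))%:E * ind (size_set n.+1) w) != 0.
Proof.
move=> mn vm pm pn'; apply/eqP.
have mi := mind (@measurable_size_set _ _ Theta X n.+1).
have mai : measurable_fun setT
    (fun w => (alpha (v, w))%:E * ind (size_set n.+1) w).
  by apply: emeasurable_funM => //; exact: (msection v malpha).
have ai0 w : 0 <= (alpha (v, w))%:E * ind (size_set n.+1) w by exact: mule_ge0.
have a_gt0 w : dsize w.2 = n.+1 -> (0 < alpha (v, w))%R.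
  by move=> wn; exact: size_accept_gt0 mn vm wn pm pn'.
have mgrow : measurable_fun setT (fun y => (px M v.1 y)%:E *
    ((alpha (v, (v.1, dadd v.2 y)))%:E * ind (size_set n.+1) (v.1, dadd v.2 y))).
  apply: emeasurable_funM; first by apply/measurable_EFinP; exact: measurable_px1.
  have mg2 := measurableT_comp mai (@measurable_grow _ _ Theta X).
  exact: (measurableT_comp mg2 (pair1_measurable v)).
have grow0 y : 0 <= (px M v.1 y)%:E *
    ((alpha (v, (v.1, dadd v.2 y)))%:E * ind (size_set n.+1) (v.1, dadd v.2 y)).
  by apply: mule_ge0 (ai0 _); rewrite lee_fin px_ge0.
rewrite integral_size_proposal// vm => /eqP; rewrite padde_eq0; last 2 first.
- by rewrite mule_ge0 ?lee_fin ?jump_ge0//; apply: integral_ge0 => y _; exact: grow0.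
- by apply: mule_ge0 (ai0 _); rewrite lee_fin jump_ge0.
rewrite !mule_eq0 => /andP[].
have := jump_gt0 mn; case/orP: mn => /eqP mn; rewrite {}mn in a_gt0 vm mgrow grow0 *.
  move=> j0; rewrite eqe gt_eqF//= => /eqP px0 _.
  have : \int[muX M]_y (px M v.1 y)%:E = 0.
    move: px0; apply: (integral_null_transfer grow0 mgrow).
    - by move=> y; rewrite lee_fin px_ge0.
    - by apply/measurable_EFinP; exact: measurable_px1.
    have szg y : dsize (dadd v.2 y) = m.+2 by move: vm; rewrite /dsize/= => ->.
    move=> y /eqP; rewrite indT//; last exact: szg.
    by rewrite mule1 mule_eq0 => /orP[/eqP //|]; rewrite eqe gt_eqF// a_gt0//= szg.
  by case: ((px_density M).2 v.1) => _ _ -> /eqP; rewrite onee_eq0.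
move=> j0 _; rewrite eqe gt_eqF//=.
have szs : dsize (dremove v.2) = n.+1.
  by move: vm; case: (v) => t [[|k] x] vm; move: vm; rewrite /dsize/= => -[] // ->.
by rewrite eqe gt_eqF ?a_gt0//= indT// onee_eq0.
Qed.

Let integral_ind A g : (forall z, 0 <= g z) ->
  \int[J]_(z in A) g z = \int[J]_z (ind A z * g z).
Proof.
move=> g0; rewrite integral_mkcond; apply: eq_integral => z _; rewrite patchE.
by case: ifPn => [/set_mem Az|/negP Az];
  [rewrite indT// mul1e|rewrite indF ?mul0e// => Az'; apply: Az; rewrite inE].
Qed.

Let flow B z := \int[size_proposal M z]_w ((alpha (z, w))%:E * ind B w).

Let flow0 B z : 0 <= flow B z.
Proof. by apply: integral_ge0 => w _; exact: mule_ge0. Qed.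

Let mflow B : measurable B -> measurable_fun setT (flow B).
Proof.
move=> mB.
apply: (measurable_fun_integral_sfinite_kernel
  (fun p : state * state => (alpha p)%:E * ind B p.2)).
- by move=> p; exact: mule_ge0.
- apply: emeasurable_funM => //; exact: (measurableT_comp (mind mB) measurable_snd).
Qed.

(** Detailed balance tested on the indicator of a rectangle. Both the passage between sizes and the
    comparison of their masses rest on it. *)
Lemma flow_symmetric A B : measurable A -> measurable B ->
  \int[J]_(z in A) \int[size_proposal M z]_w ((alpha (z, w))%:E * (\1_B w)%:E) =
  \int[J]_(z in B) \int[size_proposal M z]_w ((alpha (z, w))%:E * (\1_A w)%:E).
Proof.
move=> mA mB.
have indZ (C E : set state) z : measurable E ->
  ind C z * flow E z = \int[size_proposal M z]_w ((alpha (z, w))%:E * (ind C z * ind E w)).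
  move=> mE; rewrite /flow -ge0_integralZl//.
  - by apply: eq_integral => w _; rewrite muleCA.
  - by apply: emeasurable_funM; [exact: (msection z malpha)|exact: mind].
  - by move=> w _; exact: mule_ge0.
apply: etrans (@integral_ind A (flow B) (flow0 B)) _.
apply: etrans _ (esym (@integral_ind B (flow A) (flow0 A))).
under eq_integral do rewrite indZ//.
under [RHS]eq_integral do rewrite indZ//.
apply: etrans (@size_balance _ _ _ _ _ _ _ _ _ _ M s ndp
  (fun p => ind A p.1 * ind B p.2) _ _) _.
- by move=> p; exact: mule_ge0.
- apply: emeasurable_funM; first exact: (measurableT_comp (mind mA) measurable_fst).
  exact: (measurableT_comp (mind mB) measurable_snd).
- by apply: eq_integral => z _; apply: eq_integral => w _; rewrite [ind A _ * _]muleC.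
Qed.

(** The flow from size [m.+1] into the part of [A] of size [n.+1] is null, hence by symmetry so is
    the reverse flow. Every state of that part moves back to size [m.+1] with positive probability,
    so the part itself is null. *)
Lemma size_move_null m n A : adjacent m n -> (0 < pn M m.+1)%R -> (0 < pn M n.+1)%R ->
  measurable A -> \int[J]_(v in size_set m.+1) size_update M s ndp v A = 0 ->
  J (A `&` size_set n.+1) = 0.
Proof.
move=> mn pm pn' mA; pose B := A `&` @size_set _ _ Theta X n.+1.
have mB : measurable B by apply: measurableI => //; exact: measurable_size_set.
have mS := @measurable_size_set _ _ Theta X m.+1.
have mu : measurable_fun setT (fun v => size_update M s ndp v A).
  exact: measurable_kernel.
rewrite integral_ind// => su0.
have : \int[J]_(z in size_set m.+1) flow B z = 0.
  rewrite (integral_ind _ (flow0 B)); move: su0; apply: integral_null_transfer.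
  - by move=> z; exact: mule_ge0.
  - by apply: emeasurable_funM => //; exact: mind.
  - by move=> z; exact: mule_ge0.
  - by apply: emeasurable_funM; [exact: mind|exact: mflow].
  move=> z /eqP; rewrite mule_eq0 => /orP[/eqP -> |]; first by rewrite mul0e.
  rewrite size_updateE// padde_eq0 => [/andP[/eqP fA _]| |].
  - suff -> : flow B z = 0 by rewrite mule0.
    apply/eqP; rewrite eq_le flow0 andbT -fA; apply: ge0_le_integral => //.
    + by move=> w _; exact: mule_ge0.
    + by apply: emeasurable_funM; [exact: (msection z malpha)|exact: mind].
    + by apply: emeasurable_funM; [exact: (msection z malpha)|exact: mind].
    + move=> w _; apply: lee_wpmul2l => //.
      by rewrite lee_fin !indicE in_setI ler_nat; case: (w \in A) => //=; exact: leq_b1.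
  - exact: flow0.
  - exact: mule_ge0 (rejection_ge0 _) _.
move=> fl0; have {fl0} := etrans (esym (flow_symmetric mS mB)) fl0.
rewrite (integral_ind _ (flow0 (size_set m.+1))).
rewrite -[J (_ `&` _)]mul1e -(integral_cst _ mB) (integral_ind _ (g := cst 1))//.
apply: integral_null_transfer.
- by move=> z; apply: mule_ge0 (flow0 _ _).
- by apply: emeasurable_funM; [exact: mind|exact: mflow].
- by move=> z; exact: mule_ge0.
- by apply: emeasurable_funM => //; exact: mind.
move=> z /eqP; have [Bz|Bz] := pselect (B z); last by rewrite !indF// !mul0e.
have nm : adjacent n m by rewrite adjacentC.
by rewrite [ind B z]indT// mul1e (negbTE (size_proposal_accept_gt0 nm Bz.2 pn' pm)).
Qed.

(** A rejected move stays where it is, so the law of the size move from [v] gives the point [v] at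
    least the mass [rejection v]. *)
Lemma rejection_null m A : measurable A ->
  \int[J]_(v in size_set m) size_update M s ndp v A = 0 ->
  \int[J]_(v in A `&` size_set m) rejection v = 0.
Proof.
move=> mA; have mS := @measurable_size_set _ _ Theta X m.
have mr := measurable_rejection; have r0 := rejection_ge0.
have mu : measurable_fun setT (fun v => size_update M s ndp v A).
  exact: measurable_kernel.
have u0 v : 0 <= size_update M s ndp v A by exact: measure_ge0.
rewrite (integral_ind _ r0) (integral_ind _ u0).
apply: integral_null_transfer.
- by move=> z; exact: mule_ge0.
- by apply: emeasurable_funM => //; exact: mind.
- by move=> z; exact: mule_ge0.
- by apply: emeasurable_funM => //; apply: mind; exact: measurableI.
move=> z /eqP; have [[Az Sz]|ASz] := pselect ((A `&` size_set m) z); last first.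
  by rewrite [ind (_ `&` _) _]indF// mul0e.
rewrite [ind (size_set m) _]indT// mul1e size_updateE//.
rewrite padde_eq0 => [/andP[_ /eqP]| |].
- by rewrite !indT// mule1 mul1e.
- exact: flow0.
- exact: mule_ge0.
Qed.

Let integral_size_proposal_up m v : dsize v.2 = m.+1 ->
  \int[size_proposal M v]_w ind (size_set m.+2) w = (jump m.+1 m.+2)%:E.
Proof.
move=> vm; have mS := @measurable_size_set _ _ Theta X m.+2.
rewrite integral_size_proposal//; last exact: mind.
rewrite vm [X in _ + _ * X]indF ?mule0 ?adde0; last first.
  have : (dsize (dremove v.2) <= m.+1)%N.
    by rewrite -vm; case: (v) => t [[|k] x].
  by rewrite /size_set/= => + vS; rewrite vS ltnn.
rewrite (eq_integral (fun y => (px M v.1 y)%:E)) => [|y _].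
  by case: ((px_density M).2 v.1) => _ _ ->; rewrite mule1.
by rewrite indT ?mule1//; move: vm; rewrite /size_set/dsize/= => ->.
Qed.

Let flow_down_le m v : dsize v.2 = m.+2 -> flow (size_set m.+1) v <= (2^-1)%:E.
Proof.
move=> vm; have mS := @measurable_size_set _ _ Theta X m.+1.
apply: (@le_trans _ _ (\int[size_proposal M v]_w ind (size_set m.+1) w)).
  apply: ge0_le_integral => //.
  - by move=> w _; exact: mule_ge0.
  - by apply: emeasurable_funM; [exact: (msection v malpha)|exact: mind].
  - exact: mind.
  - move=> w _; rewrite -[leRHS]mul1e; apply: lee_wpmul2r => //.
    by rewrite lee_fin accept_le1.
rewrite integral_size_proposal//; last exact: mind.
rewrite vm [X in _ * X + _](_ : _ = 0) ?mule0 ?add0e.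
  by rewrite jump_down -[leRHS]mule1 lee_wpmul2l// lee_fin indicE lern1 leq_b1.
apply: integral0_eq => y _; rewrite indF ?mule0//.
by move: vm; rewrite /size_set/dsize/= => -> [] /eqP; rewrite (gtn_eqF (leqnSn _)).
Qed.

(** Without rejection, the upward flow from size [m.+1] is at least half of its mass, as upward
    jumps have probability at least 1/2. It equals the downward flow from [m.+2], which is at most
    half of the mass there. *)
Let J_size_le m : \int[J]_(v in size_set m.+1) rejection v = 0 ->
  J (size_set m.+1) <= J (size_set m.+2).
Proof.
move=> rej0; have mS k := @measurable_size_set _ _ Theta X k.
have half0 : (0 < 2^-1 :> R)%R by rewrite invr_gt0.
rewrite -(@lee_pmul2l _ (2^-1)%:E)//.
have -> : (2^-1)%:E * J (size_set m.+1) = \int[J]_(v in size_set m.+1) (2^-1)%:E.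
  by rewrite integral_cst.
have -> : (2^-1)%:E * J (size_set m.+2) = \int[J]_(v in size_set m.+2) (2^-1)%:E.
  by rewrite integral_cst.
apply: (@le_trans _ _ (\int[J]_(v in size_set m.+2) flow (size_set m.+1) v)); last first.
  apply: ge0_le_integral => //.
  - by apply: measurable_funS (mflow _).
  - by move=> v; exact: flow_down_le.
have <- := @flow_symmetric (size_set m.+1) (size_set m.+2) (mS _) (mS _).
(* Adding the null integral of [rejection] makes up for the upward proposals that are refused. *)
rewrite -[leRHS]adde0 -{}rej0 -ge0_integralD//; last 4 first.
- by move=> v _; exact: flow0.
- by apply: measurable_funS (mflow _).
- by move=> v _; exact: rejection_ge0.
- by apply: measurable_funS measurable_rejection.
apply: ge0_le_integral => //.
- apply: emeasurable_funD; first by apply: measurable_funS (mflow _).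
  by apply: measurable_funS measurable_rejection.
move=> v vm; apply: le_trans (_ : (jump m.+1 m.+2)%:E <= _).
  by rewrite lee_fin jump_up_ge.
rewrite -(integral_size_proposal_up vm) -ge0_integralD//; last 3 first.
- by move=> w _; exact: mule_ge0.
- by apply: emeasurable_funM; [exact: (msection v malpha)|exact: mind].
- exact: (msection v mreject).
apply: ge0_le_integral => //.
- exact: mind.
- apply: emeasurable_funD; last exact: (msection v mreject).
  by apply: emeasurable_funM; [exact: (msection v malpha)|exact: mind].
move=> w _; rewrite /ind indicE; case: (w \in _) => /=.
  by rewrite mule1 -EFinD addrC subrK.
by rewrite mule0 add0e.
Qed.

(* otherwise the masses of the sizes would be nondecreasing *)
Lemma exists_rejection : J setT < +oo ->
  exists m, \int[J]_(v in size_set m.+1) rejection v != 0.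
Proof.
move=> Joo; apply: contrapT => norej.
have J_le m : J (size_set m.+1) <= J (size_set m.+2).
  apply: J_size_le; apply/eqP; apply/negPn/negP => rej.
  by apply: norej; exists m.
have [m pm] : exists m, (0 < pn M m.+1)%R.
  apply: contrapT => nopn; have := pn_sum1 M.
  rewrite eseries0 => [/eqP|[//|k] _ _]; first by rewrite eq_sym onee_eq0.
  apply/eqP; rewrite eqe eq_le pn_ge0// andbT leNgt; apply/negP => pk.
  by apply: nopn; exists k.
have a0 := joint_size_gt0 ps_gt0 pdp_gt0 pm.
have a_le k : J (size_set m.+1) <= J (size_set (m + k).+1).
  elim: k => [|k ih]; first by rewrite addn0.
  by rewrite addnS; exact: le_trans ih (J_le _).
have JT : J setT = \sum_(0 <= k <oo) J (size_set k.+1).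
  rewrite -[J setT]mul1e -integral_cst//.
  apply: etrans (integral_size_set J (g := cst 1) (fun=> lee01) (measurable_cst 1)) _.
  by apply: eq_eseriesr => k _; rewrite integral_cst ?mul1e//; exact: measurable_size_set.
(* The sizes from [m.+1] to [m + n] contribute [n] terms, each at least the positive mass of [m.+1];
   for large [n] they exceed the finite total mass. *)
have sum_ge n : n%:R%:E * J (size_set m.+1) <= \sum_(0 <= k < m + n) J (size_set k.+1).
  elim: n => [|n ih]; first by rewrite mul0e; apply: sume_ge0 => k _.
  rewrite addnS big_nat_recr// -natr1 EFinD ge0_muleDl ?lee_fin// mul1e.
  exact: leeD ih (a_le n).
have afin : J (size_set m.+1) \is a fin_num.
  rewrite ge0_fin_numE//; apply: le_lt_trans Joo; apply: le_measure; rewrite ?inE//.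
  exact: measurable_size_set.
have Jfin : J setT \is a fin_num by rewrite ge0_fin_numE.
have fa0 : (0 < fine (J (size_set m.+1)))%R by rewrite -lte_fin fineK.
have le_JT k : (k%:R * fine (J (size_set m.+1)) <= fine (J setT))%R.
  rewrite -lee_fin EFinM !fineK//; apply: le_trans (sum_ge k) _.
  by rewrite JT; apply: nneseries_lim_ge.
have := archi_boundP (divr_ge0 (fine_ge0 (measure_ge0 J setT)) (ltW fa0)).
by rewrite ltr_pdivrMr// ltNge le_JT.
Qed.

End size_overlap.

Lemma kiter1 d (Z : measurableType d) (R : realType) (k : R.-pker Z ~> Z) z A :
  measurable A -> kiter k 1 z A = k z A.
Proof.
move=> mA; transitivity (\int[kdirac (@measurable_id _ Z setT) z]_y k y A)%E => //.
by rewrite integral_kdirac//; exact: measurable_kernel.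
Qed.

(** This peels off the first step: a state from which the remaining [t] steps still charge [A] must
    not be charged by [k z]. *)
Lemma kiter_null d (Z : measurableType d) (R : realType) (k : R.-pker Z ~> Z) t z A :
  measurable A -> kiter k t.+1 z A = 0%E ->
  k z [set v | kiter k t v A != 0%E] = 0%E /\
  measurable [set v | kiter k t v A != 0%E].
Proof.
move=> mA; have mf : measurable_fun setT (fun v => kiter k t v A).
  exact: measurable_kernel.
have mC : measurable [set v | kiter k t v A != 0%E].
  have -> : [set v | kiter k t v A != 0%E] =
      ~` ((fun v => kiter k t v A) @^-1` [set 0%E]).
    by apply/seteqP; split => v /= /eqP.
  by apply: measurableC; rewrite -[X in measurable X]setTI; exact: mf.
move=> kz; split => //.
have kf0 : (\int[k z]_v kiter k t v A = 0)%E.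
  rewrite -[RHS]kz -add1n kiterD//; apply/esym/eq_measure_integral => B mB _.
  exact: kiter1.
rewrite -[X in k z X]setIT -integral_indic//; move: kf0.
apply: integral_null_transfer => //.
- exact/measurable_EFinP.
- move=> v kv; rewrite indicE memNset//= => /eqP; exact.
Qed.

(** * Walk between the sizes *)

Section walk.
Local Open Scope ereal_scope.
Context (R : realType) (dT dX dS dD : measure_display)
  (Theta : measurableType dT) (X : measurableType dX) (S : measurableType dS)
  (D : measurableType dD) (V : nmodType).
Variables (M : dp_model R Theta X S D V) (s : S) (ndp : D).
Hypothesis ps_gt0 : forall x, (0 < ps M x s)%R.
Hypothesis pdp_gt0 : forall n, (0 < n)%N -> (0 < pdp M n ndp)%R.
Hypothesis px_bounded : bounded_density (fun p : Theta * X => px M p.1 p.2).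
Hypothesis px_support : forall theta theta',
  density_support (px M theta) = density_support (px M theta').
Hypothesis pn_support_interval : forall i j k : nat,
  (0 < i)%N -> (i < j)%N -> (j < k)%N ->
  (0 < pn M i -> 0 < pn M k -> 0 < pn M j)%R.

Local Notation state := (state Theta X).
Local Notation J := (joint M s ndp).
Local Notation step := (rjmcmc_step M s ndp).
Implicit Types (v w z : state) (A B : set state) (g : state -> \bar R).

Definition joint_null : set state := [set z | ~ (0 < joint_density M s ndp z)%R].

Lemma measurable_joint_null : measurable joint_null.
Proof.
have -> : joint_null = joint_density M s ndp @^-1` [set` `]-oo, 0%R]].
  by apply/seteqP; split => z; rewrite /joint_null/= in_itv/= leNgt => /negP.
rewrite -[X in measurable X]setTI; exact: (measurable_joint_density M s ndp).
Qed.

Lemma joint_joint_null : J joint_null = 0.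
Proof.
have mN := measurable_joint_null.
apply: etrans (_ : \int[state_measure M]_(z in joint_null) (joint_density M s ndp z)%:E = 0) => //.
apply: integral0_eq => z /negP; rewrite -leNgt => jd0.
by congr EFin; apply/eqP; rewrite eq_le jd0 joint_density_ge0.
Qed.

Lemma exists_joint_density_gt0 A : measurable A -> J A != 0 ->
  exists2 v, A v & (0 < joint_density M s ndp v)%R.
Proof.
move=> mA /eqP JA; apply: contrapT => noA; apply: JA.
apply: (subset_measure0 (B := joint_null)) => //.
- exact: measurable_joint_null.
- by move=> v Av jd0; apply: noA; exists v.
- exact: joint_joint_null.
Qed.

Section loop.
Variable m0 : nat.
Hypothesis rej0 : \int[J]_(v in size_set m0.+1) rejection M s ndp v != 0.

Let mS n := @measurable_size_set _ _ Theta X n.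

(** The law after [t] steps dominates, in the sense of null sets, the measure [J] weighted by
    [rejection] on size [m0.+1]. This measure is nonzero and the same for all starting states. *)
Definition reaches t m := forall z A, (0 < joint_density M s ndp z)%R ->
  dsize z.2 = m.+1 -> measurable A -> kiter step t z A = 0 ->
  \int[J]_(v in A `&` size_set m0.+1) rejection M s ndp v = 0.

Let rejection_null_measure A : measurable A -> J A = 0 ->
  \int[J]_(v in A) rejection M s ndp v = 0.
Proof.
move=> mA JA; apply: null_set_integral => //.
by apply: measurable_funS (measurable_rejection M s ndp).
Qed.

Lemma rejection_split A : measurable A ->
  \int[J]_(v in A `&` size_set m0.+1) rejection M s ndp v = 0 ->
  \int[J]_(v in ~` A `&` size_set m0.+1) rejection M s ndp v != 0.
Proof.
move=> mA A0; apply/eqP => cA0; move/eqP: rej0; apply.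
have mCA := measurableC mA.
rewrite -[size_set _]setTI -(setUv A) setIUl ge0_integral_setU.
- by rewrite A0 cA0 adde0.
- exact: measurableI.
- exact: measurableI.
- by apply: measurable_funS (measurable_rejection M s ndp).
- by move=> v _; exact: rejection_ge0.
- apply/disj_setPS => v [[Av _] [cAv _]]; exact: cAv.
Qed.

(** From size [m0.+1], a first step ending in a rejection already charges the reference measure, and
    further steps charge it again. *)
Lemma reaches_loop t : reaches t.+1 m0.
Proof.
elim: t => [|t ih] z A jd0 zm mA.
  move=> kz; have stepA := etrans (esym (kiter1 step z mA)) kz.
  have := step_null ps_gt0 px_bounded px_support jd0 mA stepA.
  by rewrite zm; exact: rejection_null.
move=> /(kiter_null mA)[stepC mC].
have := step_null ps_gt0 px_bounded px_support jd0 mC stepC.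
rewrite zm => /(rejection_null mC)/(rejection_split mC) rejC.
(* A single good state of this size that avoids [A] later on suffices, since the conclusion of
   [reaches] does not mention the starting state. *)
have [v [/negP/negPn/eqP vA vm] jdv0] : exists2 v,
    (~` [set v | kiter step t.+1 v A != 0] `&` size_set m0.+1) v &
    (0 < joint_density M s ndp v)%R.
  apply: exists_joint_density_gt0.
    by apply: measurableI => //; exact: measurableC.
  apply: contraNN rejC => /eqP J0; apply/eqP; apply: rejection_null_measure => //.
  by apply: measurableI => //; exact: measurableC.
exact: ih jdv0 vm mA vA.
Qed.

(** After one step, [J]-almost every state of size [n.+1] must avoid [A] in the remaining [t] steps;
    that size has positive mass, so it contains a good such state. *)
Lemma reaches_move t m n : adjacent m n -> (0 < pn M m.+1)%R -> (0 < pn M n.+1)%R ->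
  reaches t n -> reaches t.+1 m.
Proof.
move=> mn pm pn' ih z A jd0 zm mA /(kiter_null mA)[stepC mC].
have := step_null ps_gt0 px_bounded px_support jd0 mC stepC.
rewrite zm => /(size_move_null ps_gt0 pdp_gt0 mn pm pn' mC) JC.
have [v [/negP/negPn/eqP vA vn] jdv0] : exists2 v,
    (~` [set v | kiter step t v A != 0] `&` size_set n.+1) v &
    (0 < joint_density M s ndp v)%R.
  apply: exists_joint_density_gt0.
    by apply: measurableI => //; exact: measurableC.
  apply/eqP => JnC; have := joint_size_gt0 ps_gt0 pdp_gt0 pn'.
  rewrite -[size_set _]setTI -(setUv [set v | kiter step t v A != 0]) setIUl.
  rewrite [X in _ < X](_ : _ = 0) ?ltxx//.
  apply: etrans (measureU J (measurableI _ _ mC (mS _))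
    (measurableI _ _ (measurableC mC) (mS _)) _) _.
    by apply/seteqP; split => // w [[Cw _] [nCw _]]; exact: nCw.
  by rewrite [X in X + _]JC [X in _ + X]JnC adde0.
exact: ih jdv0 vn mA vA.
Qed.

Lemma pn_loop_gt0 : (0 < pn M m0.+1)%R.
Proof.
have [v vm jdv0] : exists2 v, size_set m0.+1 v & (0 < joint_density M s ndp v)%R.
  apply: exists_joint_density_gt0 => //.
  by apply: contraNN rej0 => /eqP J0; apply/eqP; apply: rejection_null_measure.
by have := joint_density_gt0_pn ps_gt0 pdp_gt0 jdv0; rewrite vm.
Qed.

(** The walk takes [d] steps to size [m0.+1] and one step that is rejected there; any surplus of
    time is spent in further rejections. The interval condition keeps the prior mass positive on the
    way. *)
Lemma reaches_up d : (0 < pn M (m0 + d).+1)%R ->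
  forall t, (d < t)%N -> reaches t (m0 + d).
Proof.
elim: d => [|d ih] pd t dt.
  by rewrite addn0; case: t dt => // t _; exact: reaches_loop.
have pd' : (0 < pn M (m0 + d).+1)%R.
  have [->|d0] := posnP d; first by rewrite addn0 pn_loop_gt0.
  by apply: pn_support_interval pn_loop_gt0 pd => //; rewrite ltnS ?addnS// -[ltnLHS]addn0 ltn_add2l.
case: t dt => // t dt; apply: (reaches_move _ pd pd') (ih pd' t dt).
by rewrite /adjacent addnS eqxx orbT.
Qed.

Lemma reaches_down d m : (m + d = m0)%N -> (0 < pn M m.+1)%R ->
  forall t, (d < t)%N -> reaches t m.
Proof.
elim: d m => [|d ih] m md pm t dt.
  by move: md; rewrite addn0 => ->; case: t dt => // t _; exact: reaches_loop.
have pm' : (0 < pn M m.+2)%R.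
  have [d0|d0] := posnP d; first by move: md; rewrite d0 addn1 => ->; exact: pn_loop_gt0.
  apply: pn_support_interval pm pn_loop_gt0 => //.
  by rewrite ltnS -md addnS ltnS -[ltnLHS]addn0 ltn_add2l.
case: t dt => // t dt; apply: (reaches_move _ pm pm') (ih m.+1 _ pm' t dt).
- by rewrite /adjacent eqxx.
- by rewrite addSnnS.
Qed.

Lemma reaches_all m : (0 < pn M m.+1)%R -> exists d, forall t, (d < t)%N -> reaches t m.
Proof.
move=> pm; have [mm0|mm0] := leqP m m0.
  by exists (m0 - m)%N; apply: reaches_down => //; rewrite subnKC.
exists (m - m0)%N => t.
by have := @reaches_up (m - m0)%N; rewrite subnKC ?(ltnW mm0)// => /(_ pm t).
Qed.

End loop.

(** At any time beyond both thresholds the two laws dominate the same nonzero measure, for which [A]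
    and its complement cannot both be null. *)
Lemma step_overlap z w : J setT < +oo -> ~ joint_null z -> ~ joint_null w ->
  exists t, forall A, measurable A ->
    kiter step t z A = 0 -> kiter step t w (~` A) = 0 -> False.
Proof.
move=> Joo /contrapT jz /contrapT jw.
have [m0 rej0] := exists_rejection ps_gt0 pdp_gt0 Joo.
have [dz zP] := reaches_all rej0 (joint_density_gt0_pn ps_gt0 pdp_gt0 jz).
have [dw wP] := reaches_all rej0 (joint_density_gt0_pn ps_gt0 pdp_gt0 jw).
exists (maxn dz dw).+1 => A mA zA wA.
have zt : (dz < (maxn dz dw).+1)%N by rewrite ltnS leq_maxl.
have wt : (dw < (maxn dz dw).+1)%N by rewrite ltnS leq_maxr.
have := rejection_split rej0 mA (zP _ zt z A jz erefl mA zA).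
by rewrite (wP _ wt w _ jw erefl (measurableC mA) wA) eqxx.
Qed.

End walk.

(** * Invariance and ergodicity for the posterior *)

Section invariance.
Local Open Scope ereal_scope.
Context (R : realType) (dT dX dS dD : measure_display)
  (Theta : measurableType dT) (X : measurableType dX) (S : measurableType dS)
  (D : measurableType dD) (V : nmodType).
Variables (M : dp_model R Theta X S D V) (s : S) (ndp : D).
Hypothesis px_bounded : bounded_density (fun p : Theta * X => px M p.1 p.2).

Local Notation state := (state Theta X).
Local Notation J := (joint M s ndp).
Local Notation step := (rjmcmc_step M s ndp).

Lemma step_invariant (g : state -> \bar R) :
  (forall z, 0 <= g z) -> measurable_fun setT g ->
  \int[J]_z \int[step z]_w g w = \int[J]_z g z.
Proof.
move=> g0 mg; pose h z := \int[size_update M s ndp z]_w g w.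
have h0 z : 0 <= h z by exact: integral_ge0.
have mh : measurable_fun setT h by exact: measurable_integral_kernel.
pose f z := \int[sweep M s z]_w h w.
have f0 z : 0 <= f z by exact: integral_ge0.
have mf : measurable_fun setT f by exact: measurable_integral_kernel.
transitivity (\int[J]_z \int[theta_update M z]_w f w).
  by apply: eq_integral => z _; rewrite integral_kthen// integral_kthen.
apply: etrans (theta_update_invariant s ndp px_bounded f0 mf) _.
apply: etrans (sweep_invariant M s ndp h0 mh) _.
exact: (metropolis_invariant _ _ (size_balance M s ndp) g0 mg).
Qed.

Hypotheses (J_neq0 : J setT != 0) (J_lty : J setT < +oo).

Let c_ge0 : (0 <= (fine (J setT))^-1)%R.
Proof. by rewrite invr_ge0 fine_ge0. Qed.

Lemma posteriorE A : posterior M s ndp A = (fine (J setT))^-1%:E * J A.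
Proof.
have -> : posterior M s ndp A = mnormalize J point A by [].
by rewrite /mnormalize (negbTE J_neq0) (lt_eqF J_lty)/= muleC.
Qed.

Lemma integral_posterior (g : state -> \bar R) :
  (forall z, 0 <= g z) -> measurable_fun setT g ->
  \int[posterior M s ndp]_z g z = (fine (J setT))^-1%:E * \int[J]_z g z.
Proof.
move=> g0 mg.
rewrite (eq_measure_integral (mscale (NngNum c_ge0) J)) => [|A _ _].
  by rewrite ge0_integral_mscale.
exact: posteriorE.
Qed.

Lemma posterior_invariant A : measurable A ->
  \int[posterior M s ndp]_z step z A = posterior M s ndp A.
Proof.
move=> mA; rewrite integral_posterior//; last exact: measurable_kernel.
rewrite posteriorE; congr (_ * _).
transitivity (\int[J]_z \int[step z]_w (\1_A w)%:E).
  apply: eq_integral => z _.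
  by rewrite -[in LHS](setIT A); apply/esym/integral_indic.
rewrite step_invariant//; first by rewrite integral_indic// setIT.
exact/measurable_EFinP.
Qed.

End invariance.

Theorem proposition5p3 (R : realType) (dT dX dS dD : measure_display)
    (Theta : measurableType dT) (X : measurableType dX)
    (S : measurableType dS) (D : measurableType dD) (V : nmodType)
    (M : dp_model R Theta X S D V) (s : S) (ndp : D)
    (s_in_support : forall x, density_support (ps M x) s)
    (ndp_in_support : forall n, (0 < n)%N -> density_support (pdp M n) ndp)
    (posterior_proper : (joint M s ndp [set: state Theta X] < +oo)%E)
    (state_countably_generated : countably_generated (state Theta X))
    (ptheta_bounded : bounded_density (ptheta M))
    (px_bounded : bounded_density (fun p : Theta * X => px M p.1 p.2))
    (ps_bounded : bounded_density (fun p : dataset X * S => ps M p.1 p.2))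
    (pn_support_interval : forall i j k : nat,
      (0 < i)%N -> (i < j)%N -> (j < k)%N ->
      0 < pn M i -> 0 < pn M k -> 0 < pn M j)
    (px_support : forall theta theta',
      density_support (px M theta) = density_support (px M theta'))
    (ps_support : forall x x',
      density_support (ps M x) = density_support (ps M x'))
    (pdp_support : forall n n', (0 < n)%N -> (0 < n')%N ->
      density_support (pdp M n) = density_support (pdp M n')) :
  ergodic (rjmcmc_step M s ndp) (posterior M s ndp) /\
  {ae posterior M s ndp, forall z, forall Q : probability (state Theta X) R,
    converges_in_tv (rjmcmc_step M s ndp) z Q ->
    forall A, measurable A -> Q A = posterior M s ndp A}.
Proof.
(* A zero total mass would make every integral of [rejection] null; nonzero and finite, it keeps
   [posterior] away from the default value of the normalization. *)
have J0 : joint M s ndp setT != 0%E.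
  apply/eqP => J0; have [m0] :=
    exists_rejection s_in_support ndp_in_support posterior_proper.
  move/eqP; apply; apply: null_set_integral.
  - exact: measurable_size_set.
  - by apply: measurable_funS (measurable_rejection M s ndp).
  - apply: (subset_measure0 _ measurableT (@subsetT _ _) J0).
    exact: measurable_size_set.
have erg : ergodic (rjmcmc_step M s ndp) (posterior M s ndp).
  apply: (ergodic_of_overlap state_countably_generated _
    (@measurable_joint_null _ _ _ _ _ _ _ _ _ _ M s ndp)).
  - by move=> A mA; exact: posterior_invariant.
  - by rewrite posteriorE// joint_joint_null mule0.
  - move=> z w; exact: (step_overlap s_in_support ndp_in_support px_bounded
      px_support pn_support_interval posterior_proper).
split => //; apply: filterS erg => z zpi Q zQ A mA.
exact: converges_in_tv_unique zpi zQ A mA.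
Qed.
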